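(* Let $(M,g_0)$ be a compact Riemannian manifold of dimension $n\ge 2$ with volume density $\mu=\mu_{g_0}$. Then the multiplicity locus $S_h$ of a generic direction $h\in T_{g_0}\mathcal{N}_\mu$ is either empty or a compact Whitney stratified subspace of $M$ of codimension two.
   Context: $T_{g_0}\mathcal{N}_\mu=\{h\in\Gamma(S^2(T^*M)) : \operatorname{tr}_{g_0}(h)\equiv 0\}$ is the space of smooth $g_0$-trace-free symmetric $(0,2)$-tensor fields. For such $h$ let $H$ be the $g_0$-self-adjoint traceless endomorphism field of $TM$ with $h(X,Y)=g_0(HX,Y)$, regarded as a smooth section $H:M\to\operatorname{Sym}_0(TM)$ of the bundle of $g_0$-self-adjoint traceless endomorphisms. The multiplicity locus is $S_h=\{p\in M: H(p)\text{ does not have } n \text{ distinct eigenvalues}\}$. An eigenvalue multiplicity is a tuple $\mathfrak{m}=(m_1,\dots,m_L)$ of positive integers with $\sum_i m_i=n$. Let $F_{\mathfrak m}(TM)\subset \operatorname{Sym}_0(TM)$ be the submanifold of endomorphisms having exactly $L$ distinct eigenvalues which, in increasing order, have multiplicities $m_1,\dots,m_L$. The direction $h$ is generic if $H$ is transverse to every $F_{\mathfrak m}(TM)$ with $L<n$, i.e. whenever $H(p)\in F_{\mathfrak m}(TM)$ with $L<n$, $dH_p(T_pM)+T_{H(p)}F_{\mathfrak m}(TM)=T_{H(p)}\operatorname{Sym}_0(TM)$. The stratification of $S_h$ is by the sets $\operatorname{Str}_{\mathfrak m}(h)=\{p\in M: H(p)\in F_{\mathfrak m}(TM)\}$, $L<n$.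 A Whitney stratified subspace is a subset partitioned into a locally finite family of locally closed submanifolds (strata) such that any two distinct strata $X,Y$ with $Y\subset \overline{X}\setminus X$ satisfy, in local charts to $\mathbb{R}^m$, Whitney's conditions: (a) if $x_k\in X$, $x_k\to y\in Y$ and $T_{x_k}X\to T$, then $T_yY\subseteq T$; (b) if $x_k\in X$, $y_k\in Y$, $x_k\to y$, $y_k\to y\in Y$, the secant lines through $x_k,y_k$ converge to a line $\ell$ and $T_{x_k}X\to T$, then $\ell\subset T$. Its codimension is the minimal codimension of its nonempty strata. *)

(* Defs.v *)
From HB Require Import structures.
From mathcomp Require Import all_boot all_order all_algebra.
From mathcomp Require Import all_classical all_reals all_analysis.

Set Implicit Arguments.
Unset Strict Implicit.
Unset Printing Implicit Defensive.
Import Order.TTheory GRing.Theory Num.Theory.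
Import numFieldNormedType.Exports.

Local Open Scope classical_set_scope.
Local Open Scope ring_scope.

(* Vectors of R^n are rows: a matrix A acts by u |-> u *m A, in accordance with
   the library's ['d f x u = u *m 'J f x], [eigenspace] and [rank]. *)

Fixpoint Ck_on (R : realType) (V W : normedModType R) (k : nat)
    (U : set V) (f : V -> W) : Prop :=
  if k is j.+1 then
    (forall x, U x -> differentiable f x) /\
    (forall v : V, Ck_on j U (fun x => 'd f x v))
  else forall x, U x -> {for x, continuous f}.

Definition smooth_on (R : realType) (V W : normedModType R)
    (U : set V) (f : V -> W) : Prop :=
  forall k, Ck_on k U f.

(* Velocities at [x] of smooth curves in [N]: the tangent space at [x] when [N]
   is an embedded submanifold of [V]. *)
Definition tangent (R : realType) (V : normedModType R) (N : set V) (x : V)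
    : set V :=
  [set v | exists (gam : R -> V) (e : R),
    [/\ 0 < e, smooth_on `]- e, e[ gam,
        forall t, t \in `]- e, e[ -> N (gam t),
        gam 0 = x
      & is_derive (0 : R) (1 : R) gam v]].

(* [param] is the inverse of [coord] on [coord @` dom]; the values of [coord]
   and [param] outside [dom] and [coord @` dom] are irrelevant. *)
Record chart (R : realType) (n : nat) (M : topologicalType) := Chart {
  dom : set M;
  coord :> M -> 'rV[R]_n;
  param : 'rV[R]_n -> M;
  dom_open : open dom;
  coord_open : open (coord @` dom);
  coordK : forall p, dom p -> param (coord p) = p;
  coord_continuous : forall p, dom p -> {for p, continuous coord};
  param_continuous : forall p, dom p -> {for coord p, continuous param}
}.

Definition transition_smooth (R : realType) (n : nat) (M : topologicalType)
    (c c' : chart R n M) : Prop :=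
  smooth_on (c @` (dom c `&` dom c')) (c' \o param c).

Definition compatible (R : realType) (n : nat) (M : topologicalType)
    (c c' : chart R n M) : Prop :=
  transition_smooth c c' /\ transition_smooth c' c.

Record smoothManifold (R : realType) (n : nat) := SmoothManifold {
  points :> topologicalType;
  points_hausdorff : hausdorff_space points;
  points_second_countable : @second_countable points;
  atlas : set (chart R n points);
  atlas_cover : forall p : points, exists2 c, atlas c & dom c p;
  atlas_compatible : forall c c', atlas c -> atlas c' -> compatible c c';
  atlas_maximal :
    forall c, (forall c', atlas c' -> compatible c c') -> atlas c
}.

(* A smooth symmetric (0,2)-tensor field, given by its component matrices in
   each chart together with their transformation law. *)
Record sym2Tensor (R : realType) (n : nat) (M : smoothManifold R n) :=
  Sym2Tensor {
  components :> chart R n M -> M -> 'M[R]_n;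
  components_sym : forall c p, atlas c -> dom c p ->
    (components c p)^T = components c p;
  components_smooth : forall c, atlas c ->
    smooth_on (c @` dom c) (components c \o param c);
  components_change : forall c c' p,
    atlas c -> atlas c' -> dom c p -> dom c' p ->
    let J := 'J (c' \o param c) (c p) in
    components c p = J *m components c' p *m J^T
}.

Record riemannianMetric (R : realType) (n : nat) (M : smoothManifold R n) :=
  RiemannianMetric {
  metric :> sym2Tensor M;
  metric_pos : forall c p, atlas c -> dom c p ->
    forall u : 'rV[R]_n, u != 0 -> 0 < (u *m metric c p *m u^T) 0 0
}.

(* g^{ij} h_{ij} *)
Definition metric_trace (R : realType) (n : nat) (M : smoothManifold R n)
    (g : riemannianMetric M) (h : sym2Tensor M) (c : chart R n M) (p : M) : R :=
  \tr (invmx (g c p) *m h c p).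

(* The tangent space at [g] to the metrics with the volume density of [g]. *)
Definition tangent_metrics (R : realType) (n : nat) (M : smoothManifold R n)
    (g : riemannianMetric M) : set (sym2Tensor M) :=
  [set h | forall c p, atlas c -> dom c p -> metric_trace g h c p = 0].

(* The endomorphism H with h(X, Y) = g(HX, Y), i.e. H *m g = h, in the chart
   [c]; another chart yields a conjugate matrix. *)
Definition endo (R : realType) (n : nat) (M : smoothManifold R n)
    (g : riemannianMetric M) (h : sym2Tensor M) (c : chart R n M) (p : M)
    : 'M[R]_n :=
  h c p *m invmx (g c p).

Definition eigmult (n : nat) : Type :=
  {m : seq nat | all (fun k => (0 < k)%N) m && (sumn m == n)}.

Definition degenerate (n : nat) : Type :=
  {m : eigmult n | (size (val m) < n)%N}.

Definition distinct_eigenvalues (R : realType) (n : nat) (A : 'M[R]_n) : Prop :=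
  exists s : seq R, [/\ uniq s, size s = n & all (eigenvalue A) s].

Definition has_multiplicities (R : realType) (n : nat) (A : 'M[R]_n)
    (m : seq nat) : Prop :=
  exists s : seq R,
    [/\ sorted <%R s,
        s =i eigenvalue A
      & [seq \rank (eigenspace A a) | a <- s] = m].

Definition mult_locus (R : realType) (n : nat) (M : smoothManifold R n)
    (g : riemannianMetric M) (h : sym2Tensor M) : set M :=
  [set p | exists c, [/\ atlas c, dom c p
                       & ~ distinct_eigenvalues (endo g h c p)]].

Definition stratum (R : realType) (n : nat) (M : smoothManifold R n)
    (g : riemannianMetric M) (h : sym2Tensor M) (m : eigmult n) : set M :=
  [set p | exists c, [/\ atlas c, dom c p
                       & has_multiplicities (endo g h c p) (val m)]].

Definition degenerate_stratum (R : realType) (n : nat) (M : smoothManifold R n)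
    (g : riemannianMetric M) (h : sym2Tensor M) (m : degenerate n) : set M :=
  stratum g h (val m).

(* The bundle of self-adjoint traceless endomorphisms over [dom c], as a
   submanifold of R^n x M_n(R) by means of the coordinate frame of [c]. *)
Definition sym0_bundle (R : realType) (n : nat) (M : smoothManifold R n)
    (g : riemannianMetric M) (c : chart R n M) : set ('rV[R]_n * 'M[R]_n) :=
  [set z | [/\ (c @` dom c) z.1,
      let G := g c (param c z.1) in z.2 *m G = G *m z.2^T
    & \tr z.2 = 0]].

Definition mult_bundle (R : realType) (n : nat) (M : smoothManifold R n)
    (g : riemannianMetric M) (c : chart R n M) (m : eigmult n)
    : set ('rV[R]_n * 'M[R]_n) :=
  sym0_bundle g c `&` [set z | has_multiplicities z.2 (val m)].

Definition local_section (R : realType) (n : nat) (M : smoothManifold R n)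
    (g : riemannianMetric M) (h : sym2Tensor M) (c : chart R n M)
    (x : 'rV[R]_n) : 'rV[R]_n * 'M[R]_n :=
  (x, endo g h c (param c x)).

Definition generic (R : realType) (n : nat) (M : smoothManifold R n)
    (g : riemannianMetric M) (h : sym2Tensor M) : Prop :=
  forall (m : degenerate n) (c : chart R n M) (p : M),
    atlas c -> dom c p ->
    let s := local_section g h c in
    mult_bundle g c (val m) (s (c p)) ->
    [set 'd s (c p) v + w | v in setT & w in
       tangent (mult_bundle g c (val m)) (s (c p))] =
    tangent (sym0_bundle g c) (s (c p)).

Definition chart_image (R : realType) (n : nat) (M : smoothManifold R n)
    (c : chart R n M) (X : set M) : set 'rV[R]_n :=
  c @` (dom c `&` X).

(* Embedded [d]-dimensional submanifolds, by slice charts. *)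
Definition submanifold (R : realType) (n : nat) (M : smoothManifold R n)
    (d : nat) (X : set M) : Prop :=
  (d <= n)%N /\
  forall p, X p -> exists c : chart R n M, [/\ atlas c, dom c p &
    chart_image c X =
    c @` dom c `&` [set x | forall i : 'I_n, (d <= i)%N -> x 0 i = 0]].

Definition locally_closed (T : topologicalType) (X : set T) : Prop :=
  exists U F : set T, [/\ open U, closed F & X = U `&` F].

Definition row_span (R : realType) (d n : nat) (B : 'M[R]_(d, n))
    : set 'rV[R]_n :=
  [set u | (u <= B)%MS].

(* Convergence in a Grassmannian, whose topology is the quotient of that of the
   manifold of d-frames. *)
Definition subspace_cvg (R : realType) (n : nat)
    (T_ : nat -> set 'rV[R]_n) (T : set 'rV[R]_n) : Prop :=
  exists (d : nat) (B_ : nat -> 'M[R]_(d, n)) (B : 'M[R]_(d, n)),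
    [/\ forall k, row_free (B_ k) /\ T_ k = row_span (B_ k),
        row_free B /\ T = row_span B
      & B_ @ \oo --> B].

Definition whitney_a (R : realType) (n : nat) (X Y : set 'rV[R]_n) : Prop :=
  forall (x_ : nat -> 'rV[R]_n) (y : 'rV[R]_n) (T : set 'rV[R]_n),
    (forall k, X (x_ k)) -> Y y -> x_ @ \oo --> y ->
    subspace_cvg (fun k => tangent X (x_ k)) T ->
    tangent Y y `<=` T.

(* [subspace_cvg] to [l] forces the secants to be lines (or all points to
   coincide); for disjoint [X] and [Y] they are lines. *)
Definition whitney_b (R : realType) (n : nat) (X Y : set 'rV[R]_n) : Prop :=
  forall (x_ y_ : nat -> 'rV[R]_n) (y : 'rV[R]_n) (l T : set 'rV[R]_n),
    (forall k, X (x_ k)) -> (forall k, Y (y_ k)) -> Y y ->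
    x_ @ \oo --> y -> y_ @ \oo --> y ->
    subspace_cvg (fun k => row_span (x_ k - y_ k)) l ->
    subspace_cvg (fun k => tangent X (x_ k)) T ->
    l `<=` T.

(* Strata may be empty; [d i] is the dimension of [X i]. *)
Record whitney_stratification (R : realType) (n : nat) (M : smoothManifold R n)
    (S : set M) (I : Type) (X : I -> set M) (d : I -> nat) : Prop := {
  strata_cover : S = \bigcup_i X i;
  strata_disjoint : trivIset setT X;
  strata_locally_finite : forall p : M,
    exists2 U, nbhs p U & finite_set [set i | X i `&` U !=set0];
  strata_locally_closed : forall i, locally_closed (X i);
  strata_submanifold : forall i, submanifold (d i) (X i);
  strata_whitney : forall i j : I, i <> j -> X j `<=` closure (X i) `\` X i ->
    forall c : chart R n M, atlas c ->
      whitney_a (chart_image c (X i)) (chart_image c (X j)) /\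
      whitney_b (chart_image c (X i)) (chart_image c (X j))
}.

(* The codimension of a stratified subspace: the least codimension of its
   nonempty strata. *)
Definition strata_codim (n : nat) (T I : Type) (X : I -> set T)
    (d : I -> nat) (k : nat) : Prop :=
  (exists2 i, X i !=set0 & (n - d i)%N = k) /\
  (forall i, X i !=set0 -> (k <= n - d i)%N).

(* Main.v *)
(* Near a point p of a stratum, choose a g0-orthonormal eigenframe at p. By the
   inverse function theorem every nearby self-adjoint endomorphism has, in an
   orthonormal frame depending smoothly on it, a symmetric matrix that is block
   diagonal along the eigenspaces at p. The traceless parts of the blocks form a
   smooth function F of the endomorphism; the stratum of p is F = 0, and every
   stratum is invariant under positive scaling of F, since scaling F up to a
   blockwise scalar does not change the order of the eigenvalues. Genericity says
   that F along H is a submersion, so F completes to a chart in which the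
   stratum Y of p is linear and the other strata X are cones with respect to the
   coordinates transverse to Y. Hence T_x X contains the directions parallel to Y
   and the radial direction; as the chart is strictly differentiable, secants
   from Y become asymptotically sums of these two, which gives conditions (a)
   and (b). Transverse codimensions are sums of (k - 1)(k + 2)/2 over the
   multiplicities k, hence at least 2, and moving along a ray of F on which
   just two eigenvalues coincide reaches a stratum of codimension 2. *)

From HB Require Import structures.
Require Import Defs.
From mathcomp Require Import all_boot all_order all_algebra.
From mathcomp Require Import all_classical all_reals all_analysis.
From mathcomp Require Import ring lra zify.
From mathcomp.real_closed Require Import -(notations) complex.

Set Implicit Arguments.
Unset Strict Implicit.
Unset Printing Implicit Defensive.
Import Order.TTheory GRing.Theory Num.Theory.
Import numFieldNormedType.Exports.

Local Open Scope classical_set_scope.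
Local Open Scope ring_scope.

(** * Maps of class C^k *)

(** Eigenvectors need not vary smoothly where eigenvalues meet, so nothing is diagonalised in
    families: smoothness comes from the inverse function theorem alone, and diagonalisation serves
    at single points, to compare the order of eigenvalues. In a chart the metric varies too, so the
    normal form is a function of a metric matrix and an endomorphism matrix, and a square root takes
    the place of an orthonormalisation. Since [tangent] consists of velocities of curves,
    transversality enters through two facts: a straight line in the fibre over the base point has
    its velocity tangent to the traceless bundle, and the differential of F annihilates all
    velocities in the stratum, on which F vanishes. F ignores blockwise scalars, hence the trace,
    and so remains onto on traceless endomorphisms. The same local model also covers points with
    distinct eigenvalues, with no transverse coordinates at all; there it says that eigenvalues stay
    distinct nearby, so that the locus is closed. *)

Section ScaleBilinear.
Context {R : realType} {W : normedModType R}.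
Lemma scale_is_bilinear :
  bilinear_for
    (GRing.Scale.Law.clone _ _ *:%R _) (GRing.Scale.Law.clone _ _ *:%R _)
    (@GRing.scale R W).
Proof.
split=> [u'|u] a x y /=.
- by rewrite scalerDl scalerA.
- by rewrite scalerDr !scalerA mulrC.
Qed.
HB.instance Definition _ := bilinear_isBilinear.Build R R W W _ _
  (@GRing.scale R W) scale_is_bilinear.
End ScaleBilinear.

Section Differentials.
Context {R : realType}.
Implicit Types (V W : normedModType R).

Lemma is_diff_epsP V W (f : V -> W) (L : {linear V -> W}) x :
  continuous L ->
  (forall e : R, 0 < e -> \forall h \near 0,
     `|f (h + x) - f x - L h| <= e * `|h|) ->
  differentiable f x /\ 'd f x = L :> (V -> W).
Proof.
move=> Lc fL.
have E : f \o shift x = cst (f x) + L +o_ 0 id.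
  apply/eqaddoP => e e0; apply: filterS (fL e e0) => h.
  by rewrite /= !fctE /= opprD addrA.
have dfL := diff_unique Lc E; split => //.
by apply/diff_locallyP; rewrite dfL.
Qed.

Lemma diff_eps V W (f : V -> W) x (e : R) : differentiable f x -> 0 < e ->
  \forall h \near 0, `|f (h + x) - f x - 'd f x h| <= e * `|h|.
Proof.
move=> /diff_locallyP[_ /eqaddoP df] e0; apply: filterS (df e e0) => h.
by rewrite /= !fctE /= opprD addrA.
Qed.

Lemma near_diff V W (f g : V -> W) x : {near x, f =1 g} ->
  differentiable f x -> differentiable g x /\ 'd g x = 'd f x :> (V -> W).
Proof.
move=> fg df; apply: is_diff_epsP; first exact: diff_continuous.
move=> e e0.
have fgx : f x = g x by exact: nbhs_singleton fg.
have : \forall h \near 0, f (h + x) = g (h + x).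
  rewrite (near_shift x 0)/=; near=> y => /=.
  by rewrite sub0r subrK; near: y.
move=> fgh; near=> h; rewrite -fgx -(near fgh h)//; near: h; exact: diff_eps.
Unshelve. all: by end_near. Qed.

Lemma diff_scale V W (k : V -> R) (f : V -> W) x :
  differentiable k x -> differentiable f x ->
  differentiable (fun z => k z *: f z) x /\
  'd (fun z => k z *: f z) x = (fun v => k x *: 'd f x v + 'd k x v *: f x)
    :> (V -> W).
Proof.
move=> dk df.
have c : continuous (fun p : R * W => p.1 *: p.2).
  exact: scale_continuous.
have dp := differentiable_pair dk df.
have db := @differentiable_bilin _ _ _ _ (@GRing.scale R W) (k x, f x) c.
split; first exact: (differentiable_comp dp db).
have := diff_comp dp db; rewrite /comp /= => ->.
by rewrite diff_pair// diff_bilin.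
Qed.

End Differentials.

Section Ck.
Context {R : realType}.
Implicit Types (V W : normedModType R).

Lemma Ck_on_continuous V W k U (f : V -> W) : Ck_on k U f ->
  forall x, U x -> {for x, continuous f}.
Proof.
by case: k => // k [df _] x Ux; apply: differentiable_continuous; exact: df.
Qed.

Lemma Ck_onW V W k U (f : V -> W) : Ck_on k.+1 U f -> Ck_on k U f.
Proof.
elim: k f => [|k IH] f; first exact: Ck_on_continuous.
by move=> [df Cf]; split => // v; exact/IH/Cf.
Qed.

Lemma Ck_on_sub V W k U U' (f : V -> W) : U' `<=` U -> Ck_on k U f ->
  Ck_on k U' f.
Proof.
move=> UU; elim: k f => [|k IH] f; first by move=> Cf x /UU; exact: Cf.
by move=> [df Cf]; split => [x /UU|v]; [exact: df|exact/IH/Cf].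
Qed.

Lemma smooth_on_sub V W U U' (f : V -> W) : U' `<=` U -> smooth_on U f ->
  smooth_on U' f.
Proof. by move=> UU Cf k; exact: Ck_on_sub UU (Cf k). Qed.

(** A differential at a point of [U] depends on the values nearby; openness of [U] makes agreement
    on [U] sufficient. *)
Lemma Ck_on_ext V W k U (f g : V -> W) : open U ->
  (forall x, U x -> f x = g x) -> Ck_on k U f -> Ck_on k U g.
Proof.
move=> oU; elim: k f g => [|k IH] f g fg.
  move=> cf x Ux; have := cf x Ux; rewrite /prop_for /continuous_at -fg//.
  apply: cvg_trans; apply: near_eq_cvg; near=> y; apply: fg.
  by near: y; exact: open_nbhs_nbhs.
move=> [df Cf].
have dg x : U x -> differentiable g x /\ 'd g x = 'd f x :> (V -> W).
  move=> Ux; apply: near_diff (df x Ux); near=> y; apply: fg.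
  by near: y; exact: open_nbhs_nbhs.
split=> [x /dg[]//|v]; apply: IH (Cf v) => x /dg[_ ->]//.
Unshelve. all: by end_near. Qed.

Lemma Ck_on_cst V W k U (w : W) : Ck_on k U (fun _ : V => w).
Proof.
elim: k w => [|k IH] w; first by move=> x _; exact: cst_continuous.
split=> [x _|v]; first exact: differentiable_cst.
have -> : (fun x : V => 'd (fun _ : V => w) x v) = fun=> 0.
  by apply/funext => x; rewrite (diff_cst w x).
exact: IH.
Qed.

Lemma Ck_on_linear V W k U (f : {linear V -> W}) : continuous f -> Ck_on k U f.
Proof.
move=> cf; case: k => [x _|k]; first exact: cf.
split=> [x _|v]; first exact: linear_differentiable.
have -> : (fun x : V => 'd f x v) = fun=> f v.
  by apply/funext => x; rewrite diff_lin.
exact: Ck_on_cst.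
Qed.

Lemma Ck_on_id V k U : Ck_on k U (fun x : V => x).
Proof. by apply: (@Ck_on_linear V V k U idfun) => x. Qed.

Lemma Ck_onD V W k U (f g : V -> W) : open U ->
  Ck_on k U f -> Ck_on k U g -> Ck_on k U (fun x => f x + g x).
Proof.
move=> oU; elim: k f g => [|k IH] f g.
  by move=> cf cg x Ux; apply: continuousD; [exact: cf|exact: cg].
move=> [df Cf] [dg Cg]; split=> [x Ux|v].
  exact: differentiableD (df x Ux) (dg x Ux).
apply: Ck_on_ext (IH _ _ (Cf v) (Cg v)) => // x Ux.
by rewrite [RHS](congr1 (@^~ v) (diffD (df x Ux) (dg x Ux))).
Qed.

Lemma Ck_on_scale V W k U (c : V -> R) (f : V -> W) : open U ->
  Ck_on k U c -> Ck_on k U f -> Ck_on k U (fun x => c x *: f x).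
Proof.
move=> oU; elim: k c f => [|k IH] c f.
  by move=> cf cg x Ux; apply: continuousZ; [exact: cf|exact: cg].
move=> Cc1 Cf1; have [dc Cc] := Cc1; have [df Cf] := Cf1.
split=> [x Ux|v].
  by have [] := diff_scale (dc x Ux) (df x Ux).
apply: (@Ck_on_ext _ _ _ _ (fun x => c x *: 'd f x v + 'd c x v *: f x)) => //.
  by move=> x Ux; have [_ ->] := diff_scale (dc x Ux) (df x Ux).
exact: Ck_onD oU (IH _ _ (Ck_onW Cc1) (Cf v)) (IH _ _ (Cc v) (Ck_onW Cf1)).
Qed.

Lemma Ck_onM V k U (f g : V -> R) : open U ->
  Ck_on k U f -> Ck_on k U g -> Ck_on k U (fun x => f x * g x).
Proof. by move=> oU Cf Cg; exact: (Ck_on_scale (W := R^o) oU Cf Cg). Qed.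

Lemma Ck_onN V W k U (f : V -> W) : open U ->
  Ck_on k U f -> Ck_on k U (fun x => - f x).
Proof.
move=> oU Cf; apply: (@Ck_on_ext _ _ _ _ (fun x => (-1) *: f x)) => //.
  by move=> x _; rewrite scaleN1r.
by apply: Ck_on_scale => //; exact: Ck_on_cst.
Qed.

Lemma Ck_on_sum V W k U (I : Type) (r : seq I) (P : pred I) (f : I -> V -> W) :
  open U -> (forall i, P i -> Ck_on k U (f i)) ->
  Ck_on k U (fun x => \sum_(i <- r | P i) f i x).
Proof.
move=> oU Cf; elim: r => [|i r IH].
  apply: (@Ck_on_ext _ _ _ _ (fun=> 0)) => // [x _|]; rewrite ?big_nil//.
  exact: Ck_on_cst.
apply: (@Ck_on_ext _ _ _ _ (fun x => (if P i then f i x else 0)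
   + \sum_(i <- r | P i) f i x)) => // [x _|].
  by rewrite big_cons; case: ifP => // _; rewrite add0r.
by apply: Ck_onD => //; case Pi: (P i); [exact: Cf|exact: Ck_on_cst].
Qed.

Lemma Ck_on_prod V k U (I : Type) (r : seq I) (P : pred I) (f : I -> V -> R) :
  open U -> (forall i, P i -> Ck_on k U (f i)) ->
  Ck_on k U (fun x => \prod_(i <- r | P i) f i x).
Proof.
move=> oU Cf; elim: r => [|i r IH].
  apply: (@Ck_on_ext V R^o _ _ (fun=> 1)) => // [x _|]; rewrite ?big_nil//.
  exact: Ck_on_cst.
apply: (@Ck_on_ext V R^o _ _ (fun x => (if P i then f i x else 1)
   * \prod_(i <- r | P i) f i x)) => // [x _|].
  by rewrite big_cons; case: ifP => // _; rewrite mul1r.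
by apply: Ck_onM => //; case Pi: (P i); [exact: Cf|exact: Ck_on_cst].
Qed.

Lemma Ck_onV V k U (f : V -> R) : open U -> (forall x, U x -> f x != 0) ->
  Ck_on k U f -> Ck_on k U (fun x => (f x)^-1).
Proof.
move=> oU f0; elim: k => [|k IH].
  by move=> cf x Ux; apply: continuousV; [exact: f0|exact: cf].
move=> Cf1; have [df Cf] := Cf1; split=> [x Ux|v].
  by apply: differentiableV; [exact: df|exact: f0].
(* The differential of the inverse is a polynomial in the inverse itself and ['d f], so the
   induction closes. *)
apply: (@Ck_on_ext V R^o _ _ (fun x => - ((f x)^-1 * (f x)^-1 * 'd f x v))) => //.
  move=> x Ux.
  have -> : 'd (fun y => (f y)^-1) x v = - (f x) ^- 2 * 'd f x v.
    by have E := congr1 (@^~ v) (diffV (df x Ux) (f0 _ Ux)); exact: E.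
  by rewrite expr2 invfM -mulNr.
have Cfi := IH (Ck_onW Cf1).
exact: (Ck_onN (W := R^o) oU (Ck_onM oU (Ck_onM oU Cfi Cfi) (Cf v))).
Qed.

Lemma Ck_on_linear_comp V W W' k U (L : {linear W -> W'}) (f : V -> W) :
  open U -> continuous L -> Ck_on k U f -> Ck_on k U (fun x => L (f x)).
Proof.
move=> oU cL; elim: k f => [|k IH] f.
  by move=> cf x Ux; apply: continuous_comp; [exact: cf|exact: cL].
move=> [df Cf].
have dc x (Ux : U x) := diff_comp (df x Ux) (linear_differentiable (f x) cL).
split=> [x Ux|v].
  exact: (differentiable_comp (df x Ux) (linear_differentiable _ cL)).
apply: Ck_on_ext (IH _ (Cf v)) => // x Ux.
by have /(congr1 (@^~ v)) := dc x Ux; rewrite /comp /= diff_lin// => ->.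
Qed.

Section Matrices.
Variables (m n : nat).

Definition entry i j : 'M[R]_(m, n) -> R := fun A => A i j.

Lemma entry_is_linear i j : linear (entry i j : _ -> R^o).
Proof. by move=> a u v; rewrite /entry !mxE. Qed.

HB.instance Definition _ i j := GRing.isLinear.Build R 'M[R]_(m, n) R^o _
  (entry i j) (entry_is_linear i j).

Lemma Ck_on_entry V k U (f : V -> 'M[R]_(m, n)) i j : open U ->
  Ck_on k U f -> Ck_on k U (fun x => f x i j).
Proof.
move=> oU; apply: (@Ck_on_linear_comp _ _ _ _ _ (entry i j : {linear _ -> R^o})) => //.
exact: coord_continuous.
Qed.

Lemma Ck_on_mx V k U (f : V -> 'M[R]_(m, n)) : open U ->
  (forall i j, Ck_on k U (fun x => f x i j)) -> Ck_on k U f.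
Proof.
move=> oU Cf.
apply: (@Ck_on_ext _ _ _ _ (fun x => \sum_i \sum_j f x i j *: delta_mx i j)) => //.
  by move=> x _; rewrite -matrix_sum_delta.
do 2!(apply: Ck_on_sum => // ? _).
by apply: Ck_on_scale => //; exact: Ck_on_cst.
Qed.

Lemma linear_mxE W (f : {linear 'M[R]_(m, n) -> W}) A :
  f A = \sum_i \sum_j A i j *: f (delta_mx i j).
Proof.
rewrite {1}[A]matrix_sum_delta linear_sum; apply: eq_bigr => i _.
by rewrite linear_sum; apply: eq_bigr => j _; rewrite linearZ.
Qed.

Lemma linear_mx_continuous W (f : {linear 'M[R]_(m, n) -> W}) : continuous f.
Proof.
move=> x; rewrite (funext (linear_mxE f)).
suff : Ck_on 0 setT (fun A : 'M[R]_(m, n) => \sum_i \sum_j A i j *: f (delta_mx i j)).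
  exact.
do 2!(apply: Ck_on_sum; [exact: openT|move=> ? _]).
apply: Ck_on_scale; [exact: openT| |exact: Ck_on_cst].
by move=> y _; exact: coord_continuous.
Qed.

(* The chain rule gives ['d g (f x) ('d f x v)], whose two occurrences of [x]
   are separated by expanding ['d f x v] on the canonical basis. *)
Lemma Ck_on_comp V W k U U' (f : V -> 'M[R]_(m, n)) (g : 'M[R]_(m, n) -> W) :
  open U -> open U' -> (forall x, U x -> U' (f x)) ->
  Ck_on k U f -> Ck_on k U' g -> Ck_on k U (g \o f).
Proof.
move=> oU oU' fU; elim: k f g fU => [|k IH] f g fU.
  move=> cf cg x Ux; apply: continuous_comp; first exact: cf.
  by apply: cg; exact: fU.
move=> Cf1 Cg1; have [df Cf] := Cf1; have [dg Cg] := Cg1.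
split=> [x Ux|v].
  by apply: differentiable_comp; [exact: df|apply: dg; exact: fU].
apply: (@Ck_on_ext _ _ _ _ (fun x => \sum_i \sum_j
    ('d f x v) i j *: ((fun y => 'd g y (delta_mx i j)) \o f) x)) => //.
  move=> x Ux.
  by rewrite (congr1 (@^~ v) (diff_comp (df x Ux) (dg _ (fU _ Ux))))/= -linear_mxE.
do 2!(apply: Ck_on_sum => // ? _).
apply: Ck_on_scale => //; first exact/Ck_on_entry/Cf.
by apply: IH => //; [exact: Ck_onW|exact: Cg].
Qed.

End Matrices.

End Ck.

Section CkMatrix.
Context {R : realType}.
Implicit Types (V W : normedModType R).

Lemma Ck_on_mulmx V m n p k U (f : V -> 'M[R]_(m, n)) (g : V -> 'M[R]_(n, p)) :
  open U -> Ck_on k U f -> Ck_on k U g -> Ck_on k U (fun x => f x *m g x).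
Proof.
move=> oU Cf Cg; apply: Ck_on_mx => // i j.
apply: (@Ck_on_ext _ V R^o _ _ (fun x => \sum_k f x i k * g x k j)) => //.
  by move=> x _; rewrite mxE.
apply: Ck_on_sum => // l _.
exact: Ck_onM oU (Ck_on_entry _ _ oU Cf) (Ck_on_entry _ _ oU Cg).
Qed.

Lemma Ck_on_tr V m n k U (f : V -> 'M[R]_(m, n)) : open U ->
  Ck_on k U f -> Ck_on k U (fun x => (f x)^T).
Proof.
move=> oU Cf; apply: Ck_on_mx => // i j.
apply: Ck_on_ext oU _ (Ck_on_entry j i oU Cf) => x _.
by rewrite mxE.
Qed.

Lemma Ck_on_det V n k U (f : V -> 'M[R]_n) : open U ->
  Ck_on k U f -> Ck_on k U (fun x => \det (f x)).
Proof.
move=> oU Cf; rewrite /determinant; apply: (Ck_on_sum (W := R^o)) => // s _.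
apply: Ck_onM => //; first exact: (Ck_on_cst (W := R^o)).
by apply: Ck_on_prod => // i _; exact: Ck_on_entry.
Qed.

Lemma Ck_on_adj V n k U (f : V -> 'M[R]_n) : open U ->
  Ck_on k U f -> Ck_on k U (fun x => \adj (f x)).
Proof.
move=> oU Cf; apply: Ck_on_mx => // i j.
apply: (@Ck_on_ext _ V R^o _ _
  (fun x => (-1) ^+ (j + i) * \det (row' j (col' i (f x))))) => //.
  by move=> x _; rewrite mxE.
apply: Ck_onM => //; first exact: (Ck_on_cst (W := R^o)).
apply: Ck_on_det => //; apply: Ck_on_mx => // a b.
apply: Ck_on_ext oU _ (Ck_on_entry (lift j a) (lift i b) oU Cf) => x _.
by rewrite !mxE.
Qed.

Lemma Ck_on_invmx V n k U (f : V -> 'M[R]_n) : open U ->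
  (forall x, U x -> f x \in unitmx) ->
  Ck_on k U f -> Ck_on k U (fun x => invmx (f x)).
Proof.
move=> oU fu Cf.
apply: (@Ck_on_ext _ _ _ _ _ (fun x => (\det (f x))^-1 *: \adj (f x))) => //.
  by move=> x /fu fxu; rewrite /invmx fxu.
apply: Ck_on_scale => //; last exact: Ck_on_adj.
apply: Ck_onV => //; last exact: Ck_on_det.
by move=> x /fu; rewrite unitmxE unitfE.
Qed.

Lemma cvg_mxP m n (T : Type) (F : set_system T) {FF : Filter F}
    (f : T -> 'M[R]_(m, n)) (A : 'M[R]_(m, n)) :
  (forall i j, f x i j @[x --> F] --> A i j) -> f x @[x --> F] --> A.
Proof.
move=> H; apply/cvgrPdist_lt => e e0.
have : \forall x \near F, forall ij : 'I_m * 'I_n, `|A ij.1 ij.2 - f x ij.1 ij.2| < e.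
  apply: filter_forall => -[i j] /=.
  by move/cvgrPdist_lt : (H i j); exact.
apply: filterS => x H1.
rewrite [ltLHS]/Num.Def.normr/= mx_normrE; apply/bigmax_ltP; split => // ij _.
by rewrite !mxE; exact: H1.
Qed.

Lemma cvg_entry m n (T : Type) (F : set_system T) {FF : Filter F}
    (f : T -> 'M[R]_(m, n)) (A : 'M[R]_(m, n)) i j :
  f x @[x --> F] --> A -> f x i j @[x --> F] --> A i j.
Proof.
move=> fA; have cc := @coord_continuous R m n i j A.
by apply: (continuous_cvg _ cc fA).
Qed.

Lemma cvg_mulmx m n p (T : Type) (F : set_system T) {FF : Filter F}
    (f : T -> 'M[R]_(m, n)) (g : T -> 'M[R]_(n, p)) (A : 'M[R]_(m, n)) (B : 'M[R]_(n, p)) :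
  f x @[x --> F] --> A -> g x @[x --> F] --> B ->
  (f x *m g x) @[x --> F] --> A *m B.
Proof.
move=> fA gB; apply: cvg_mxP => i j; rewrite mxE.
under eq_fun do rewrite mxE.
apply: (@cvg_big R _ +%R 0 xpredT _ _ F _ (fun k x => f x i k * g x k j)).
  exact: add_continuous.
by move=> k _; apply: cvgM; exact: cvg_entry.
Qed.

Lemma cvg_linear_mx m n W (T : Type) (F : set_system T) {FF : Filter F}
    (L : {linear 'M[R]_(m, n) -> W}) (f : T -> 'M[R]_(m, n)) (A : 'M[R]_(m, n)) :
  f x @[x --> F] --> A -> L (f x) @[x --> F] --> L A.
Proof.
move=> fA; have cc := @linear_mx_continuous R m n W L A.
by apply: (continuous_cvg _ cc fA).
Qed.

Lemma le_entry_norm m n (A : 'M[R]_(m, n)) i j : `|A i j| <= `|A|.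
Proof.
by rewrite [leRHS]/Num.Def.normr/= mx_normrE; exact: (le_bigmax _ _ (i, j)).
Qed.

Lemma mx_norm_le m n (A : 'M[R]_(m, n)) (e : R) : 0 <= e ->
  (forall i j, `|A i j| <= e) -> `|A| <= e.
Proof.
move=> e0 Ae; rewrite [leLHS]/Num.Def.normr/= mx_normrE.
by apply/bigmax_leP; split.
Qed.

Lemma is_derive_affine V (w y : V) (t : R) :
  is_derive t 1 (fun s : R => s *: w + y) w.
Proof.
have [d1 E1] := is_diff_scalel t w.
have d2 := differentiableD d1 (differentiable_cst y t).
apply: DeriveDef; first exact: diff_derivable.
rewrite deriveE//.
have /(congr1 (@^~ 1)) E := diffD d1 (differentiable_cst y t).
by rewrite [LHS]E /= diff_cst addr0 E1 scale1r.
Qed.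

Lemma is_derive_curve V W (f : V -> W) (g : R -> V) (t : R) v :
  is_derive t 1 g v -> differentiable f (g t) ->
  is_derive t 1 (f \o g) ('d f (g t) v).
Proof.
move=> [gd gv] df.
have dg : differentiable g t by exact/derivable1_diffP.
have dfg := differentiable_comp dg df.
apply: DeriveDef; first exact: diff_derivable.
rewrite deriveE// (congr1 (@^~ 1) (diff_comp dg df)) /=.
by rewrite -gv deriveE.
Qed.

(** The mean value theorem is scalar, so it is applied to each entry; with the sup norm no constant
    is lost. *)
Lemma mean_value_mx m n p q (f : 'M[R]_(m, n) -> 'M[R]_(p, q)) x y (C : R) :
  (forall t, 0 <= t <= 1 -> differentiable f (t *: (x - y) + y) /\
     `|'d f (t *: (x - y) + y) (x - y)| <= C) ->
  `|f x - f y| <= C.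
Proof.
move=> H; have C0 : 0 <= C.
  by have [|_] := H 0; [rewrite lexx ler01|exact: le_trans].
apply: mx_norm_le => // i j.
pose g (t : R) : R := f (t *: (x - y) + y) i j.
pose dg (t : R) : R := ('d f (t *: (x - y) + y) (x - y)) i j.
have dgP (t : R) : 0 <= t <= 1 -> is_derive t 1 g (dg t).
  move=> /H[df _].
  have D := is_derive_curve (is_derive_affine (x - y) y t) df.
  have dE := linear_differentiable (f (t *: (x - y) + y))
    (@linear_mx_continuous R p q _ (entry i j : {linear _ -> R^o})).
  have := is_derive_curve D dE.
  by rewrite diff_lin //; exact: linear_mx_continuous.
have [t|t|c c01 E] := @MVT_segment R g dg 0 1 ler01.
- by rewrite in_itv/= => /andP[t0 t1]; apply: dgP; rewrite !ltW.
- apply: continuous_in_subspaceT => z /set_mem; rewrite /= in_itv/= => z01.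
  by apply/differentiable_continuous/derivable1_diffP; have [] := dgP z z01.
have [_ Hc] := H c c01.
move: E; rewrite /g scale1r scale0r subrK add0r subr0 mulr1 !mxE => ->.
exact: le_trans (le_entry_norm _ _ _) Hc.
Qed.

End CkMatrix.

(** * Strict differentiability of C^1 maps *)

Section StrictDiff.
Context {R : realType}.
Implicit Types (V W : normedModType R).

Lemma cvg_congr (T : Type) (W : topologicalType) (F : set_system T)
    (u u' : T -> W) (l l' : W) :
  u = u' -> l = l' -> u' x @[x --> F] --> l' -> u x @[x --> F] --> l.
Proof. by move=> -> ->. Qed.

(** Point and vector move at once: on the canonical basis only differentials of fixed vectors at a
    moving point remain, and these are continuous in class C^1. *)
Lemma cvg_diff m n W (U : set 'M[R]_(m, n)) (f : 'M[R]_(m, n) -> W) x0 v0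
    (T : Type) (F : set_system T) {FF : Filter F} (x v : T -> 'M[R]_(m, n)) :
  open U -> Ck_on 1 U f -> U x0 ->
  x t @[t --> F] --> x0 -> v t @[t --> F] --> v0 ->
  'd f (x t) (v t) @[t --> F] --> 'd f x0 v0.
Proof.
move=> oU [df Cf] Ux0 xx0 vv0.
have E z v' : 'd f z v' = \sum_i \sum_j v' i j *: 'd f z (delta_mx i j).
  exact: linear_mxE.
have F1 : (fun t => 'd f (x t) (v t)) =
    (fun t => \sum_i \sum_j v t i j *: 'd f (x t) (delta_mx i j)).
  by apply/funext => t; exact: E.
apply: (cvg_congr F1 (E x0 v0)).
apply: cvg_big; [exact: add_continuous|move=> i _].
apply: cvg_big; [exact: add_continuous|move=> j _].
apply: cvgZ; first exact: cvg_entry.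
have cc := Cf (delta_mx i j) x0 Ux0; by apply: (continuous_cvg _ cc xx0).
Qed.

Lemma diff_sub_linear V W (f : V -> W) (L : {linear V -> W}) z v :
  differentiable f z -> continuous L ->
  'd (fun z => f z - L z) z v = 'd f z v - L v.
Proof.
move=> df cL.
have E1 := congr1 (@^~ v) (diffB df (linear_differentiable z cL)).
have E2 := congr1 (@^~ v) (diff_lin z cL).
exact: (etrans E1 (congr1 (fun w => 'd f z v - w) E2)).
Qed.

(** Mean value inequality for [f - 'd f x0], whose differential is small near [x0]. Both end points
    may move, as the inverse function theorem and the secants of condition (b) require. *)
Lemma strict_diff m n p q U (f : 'M[R]_(m, n) -> 'M[R]_(p, q)) x0 (e : R) :
  open U -> Ck_on 1 U f -> U x0 -> 0 < e ->
  exists2 r : R, 0 < r & ball x0 r `<=` U /\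
    forall x y, ball x0 r x -> ball x0 r y ->
      `|f x - f y - 'd f x0 (x - y)| <= e * `|x - y|.
Proof.
move=> oU [df Cf] Ux0 e0.
pose D z i j := 'd f x0 (delta_mx i j) - 'd f z (delta_mx i j).
(* The increment is a sum of [m * n] terms; the added 1 keeps the denominator positive for empty
   matrices. *)
pose e1 := e / (1 + (m * n)%:R).
have e10 : 0 < e1 by rewrite divr_gt0// ltr_pwDl.
have : \forall z \near x0, U z /\ forall ij : 'I_m * 'I_n, `|D z ij.1 ij.2| < e1.
  have H1 := open_nbhs_nbhs (conj oU Ux0).
  have H2 : \forall z \near x0, forall ij : 'I_m * 'I_n, `|D z ij.1 ij.2| < e1.
    apply: (@filter_forall _ _ (fun (ij : 'I_m * 'I_n) z => `|D z ij.1 ij.2| < e1) (nbhs x0)).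
    move=> [i j] /=.
    have /cvgrPdist_lt/(_ _ e10) := Cf (delta_mx i j) x0 Ux0.
    exact.
  exact: filterS2 H1 H2.
move=> /nbhs_ballP[r r0 rP]; exists r => //; split; first by move=> z /rP[].
move=> x y xr yr.
pose g z := f z - 'd f x0 z.
have cL := diff_continuous (df x0 Ux0).
have -> : f x - f y - 'd f x0 (x - y) = g x - g y.
  by rewrite /g linearB !opprB addrACA [RHS]addrACA; congr (_ + _); rewrite addrC.
apply: mean_value_mx => t t01; set z := t *: (x - y) + y.
have zr : ball x0 r z.
  move: xr yr; rewrite -ball_normE /= => xr yr.
  have -> : x0 - z = t *: (x0 - x) + (1 - t) *: (x0 - y).
    by apply/matrixP => i j; rewrite /z !mxE; ring.
  have /andP[t0 t1] := t01.
  have M1 : Num.max `|x0 - x| `|x0 - y| < r by rewrite gt_max xr.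
  apply: le_lt_trans M1; apply: (le_trans (ler_normD _ _)).
  rewrite !normrZ (ger0_norm t0) (ger0_norm (_ : 0 <= 1 - t)) ?subr_ge0//.
  have a1 : `|x0 - x| <= Num.max `|x0 - x| `|x0 - y| by rewrite le_max lexx.
  have a2 : `|x0 - y| <= Num.max `|x0 - x| `|x0 - y| by rewrite le_max lexx orbT.
  by nra.
have [Uz Dz] := rP z zr.
have dg : differentiable g z.
  exact: differentiableB (df z Uz) (linear_differentiable z cL).
split => //.
have dgE := diff_sub_linear (x - y) (df z Uz) cL.
apply: (@le_trans _ _ `|'d f z (x - y) - 'd f x0 (x - y)|).
  by rewrite -dgE.
have E z' v' : 'd f z' v' = \sum_i \sum_j v' i j *: 'd f z' (delta_mx i j).
  exact: linear_mxE.
have -> : 'd f z (x - y) - 'd f x0 (x - y) = - (\sum_i \sum_j (x - y) i j *: D z i j).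
  apply: (etrans (congr2 (fun a b => a - b) (E z _) (E x0 _))).
  apply: (etrans (esym (opprB _ _))); apply: congr1.
  apply: (etrans (esym (sumrB _ _ _ _))); apply: eq_bigr => i _.
  apply: (etrans (esym (sumrB _ _ _ _))); apply: eq_bigr => j _.
  exact: esym (scalerBr _ _ _).
rewrite normrN.
have le_sum : forall i j, `|(x - y) i j *: D z i j| <= e1 * `|x - y|.
  move=> i j; rewrite normrZ mulrC.
  by apply: ler_pM => //; [exact/ltW/(Dz (i, j))|exact: le_entry_norm].
apply: (le_trans (ler_norm_sum _ _ _)).
apply: (@le_trans _ _ (\sum_(i < m) \sum_(j < n) e1 * `|x - y|)).
  apply: ler_sum => i _; apply: (le_trans (ler_norm_sum _ _ _)).
  by apply: ler_sum => j _; exact: le_sum.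
rewrite !sumr_const !card_ord -mulrnA -mulr_natl mulrA ler_wpM2r//.
rewrite /e1 mulrC -mulrA ger_pMr// mulrC ler_pdivrMr ?ltr_pwDl// mul1r.
by rewrite mulnC lerDr.
Qed.
End StrictDiff.

(** * The inverse function theorem *)

(** Presents matrices as a complete normed module, the setting of the contraction principle used
    below. *)
HB.instance Definition _ (R : realType) m n := Complete.on 'M[R]_(m, n).

Section InverseFunction.
Context {R : realType}.

Section LinMx.
Variables m n : nat.
Local Notation V := 'M[R]_(m, n).

Lemma Ck_on_lin_mx k (U : set V) (f : V -> V) : open U ->
  Ck_on k.+1 U f -> Ck_on k U (fun x => lin_mx ('d f x)).
Proof.
move=> oU [_ Cf]; apply: Ck_on_mx => // i j.
have C1 := Cf (vec_mx (delta_mx 0 i)).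
have C2 := Ck_on_linear_comp (L := mxvec) oU (@linear_mx_continuous R _ _ _ mxvec) C1.
apply: Ck_on_ext oU _ (Ck_on_entry 0 j oU C2) => x _.
by rewrite [RHS]mxE.
Qed.

Lemma lin_mx_unit (L : {linear V -> V}) :
  (forall v, L v = 0 -> v = 0) -> lin_mx L \in unitmx.
Proof.
move=> L0; rewrite -row_free_unit -kermx_eq0; apply/eqP/row_matrixP => i.
rewrite row0; set u := row i _.
have uL : u *m lin_mx L = 0.
  by apply/sub_kermxP; exact: row_sub.
have : L (vec_mx u) = 0.
  by rewrite -[L _]mxvecK -mul_vec_lin vec_mxK uL linear0.
by move/L0 => /(congr1 mxvec); rewrite vec_mxK linear0.
Qed.

Definition lin_inv (A : 'M[R]_(m * n)) (v : V) : V := vec_mx (mxvec v *m invmx A).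

Lemma lin_inv_is_linear A : linear (lin_inv A).
Proof. by move=> a u v; rewrite /lin_inv linearP mulmxDl -scalemxAl linearP. Qed.

HB.instance Definition _ A := GRing.isLinear.Build R V V _ (lin_inv A)
  (lin_inv_is_linear A).

Lemma lin_invK (L : {linear V -> V}) : lin_mx L \in unitmx ->
  cancel L (lin_inv (lin_mx L)).
Proof.
by move=> Lu v; rewrite /lin_inv -mul_vec_lin mulmxK// mxvecK.
Qed.

Lemma lin_invKV (L : {linear V -> V}) : lin_mx L \in unitmx ->
  cancel (lin_inv (lin_mx L)) L.
Proof.
move=> Lu v; apply: (can_inj mxvecK).
by rewrite -mul_vec_lin /lin_inv vec_mxK mulmxKV.
Qed.

End LinMx.

Section Identity.
Variables (m n : nat).
Local Notation V := 'M[R]_(m, n).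
Variables (f : V -> V) (U : set V) (x0 : V) (r : R).
Let B := ball x0 r.
Hypotheses (oU : open U) (Cf : smooth_on U f) (BU : B `<=` U) (r0 : 0 < r).
Hypothesis fid : forall x y, B x -> B y ->
  `|f x - f y - (x - y)| <= 2^-1 * `|x - y|.

Let oB : open B. Proof. exact: ball_open. Qed.

(** Triangle inequality; the factor 2 is [1 / (1 - 1/2)] and recurs in the estimates for the
    inverse. *)
Lemma near_id_expand x y : B x -> B y -> `|x - y| <= 2 * `|f x - f y|.
Proof.
move=> Bx By; have H := fid Bx By.
have : `|x - y| <= `|f x - f y| + `|f x - f y - (x - y)|.
  have -> : x - y = (f x - f y) - (f x - f y - (x - y)) by rewrite subKr.
  by rewrite (le_trans (ler_normB _ _))// !subKr.
by lra.
Qed.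

Lemma near_id_diff_inj x v : B x -> 'd f x v = 0 -> v = 0.
Proof.
move=> Bx dv0; have df : differentiable f x by have [+ _] := Cf 1; apply; exact: BU.
(* With 1/4, a small multiple of a kernel vector has norm at most [2 * (1/4)] times itself by
   [near_id_expand], hence is 0. *)
have e0 : 0 < (4^-1 : R) by rewrite invr_gt0.
have H : \forall h \near 0, B (h + x) /\ `|f (h + x) - f x - 'd f x h| <= 4^-1 * `|h|.
  apply: filterS2 _ (diff_eps df e0); last first.
    have : \forall y \near x, B y by exact: open_nbhs_nbhs.
    by rewrite (near_shift 0 x) /= subr0; exact.
  by move=> h /= Bh.
have /nbhs_ballP[d /= d0 dP] := H.
have v1 : 0 < 1 + `|v| by rewrite ltr_pwDl.
pose t := d / 2 / (1 + `|v|).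
have t0 : 0 < t by rewrite !divr_gt0.
have : ball 0 d (t *: v).
  rewrite -ball_normE /= sub0r normrN normrZ gtr0_norm//.
  rewrite /t mulrAC ltr_pdivrMr//.
  by have := mulr_ge0 (ltW d0) (normr_ge0 v); nra.
have E : 'd f x (t *: v) = 0 by rewrite linearZ /= dv0 scaler0.
move=> /dP[Bh]; rewrite E subr0 => H1.
have := near_id_expand Bh Bx; rewrite addrK => H2.
have : `|t *: v| <= 0 by lra.
by rewrite normr_le0 scaler_eq0 gt_eqF//= => /eqP.
Qed.

Definition near_id_inv (y : V) : V := get [set x | B x /\ f x = y].

Lemma near_id_invK x : B x -> near_id_inv (f x) = x.
Proof.
move=> Bx; have [By fy] : [set z | B z /\ f z = f x] (near_id_inv (f x)).
  by apply: (getI (conj Bx erefl : [set z | B z /\ f z = f x] x)).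
apply/eqP; rewrite -subr_eq0 -normr_le0.
by have := near_id_expand By Bx; rewrite fy subrr normr0 mulr0.
Qed.

(** A solution of [f x = y] is a fixed point of [x - (f x - y)], which contracts by 1/2. *)
Lemma near_id_open : open (f @` B).
Proof.
rewrite openE => _ [x1 Bx1 <-].
have /nbhs_ballP[d /= d0 dB] : nbhs x1 B by exact: open_nbhs_nbhs.
pose p := d / 2.
have p0 : 0 < p by rewrite divr_gt0.
have pB : closed_ball x1 p `<=` B.
  move=> y; rewrite closed_ballE// => H; apply: dB; rewrite -ball_normE.
  by apply: (le_lt_trans H); rewrite ltr_pdivrMr// ltr_pMr// ltr1n.
(* With [y] this close to [f x1] the closed ball of radius [p] is stable: one half of [p] is spent
   by the contraction, the other by the distance of [y]. *)
apply/nbhs_ballP; exists (p / 2) => [|y]; first by rewrite /= divr_gt0.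
rewrite -ball_normE /= => yp.
pose T x := x - (f x - y).
have TB : set_fun (closed_ball x1 p) (closed_ball x1 p) T.
  move=> x xp; have Bx := pB x xp; move: xp; rewrite closed_ballE//.
  rewrite /closed_ball_ /= => xp.
  have -> : x1 - T x = (f x - f x1 - (x - x1)) + (f x1 - y).
    by rewrite /T; apply/matrixP => i j; rewrite !mxE; ring.
  rewrite (le_trans (ler_normD _ _))//.
  have := fid Bx Bx1; rewrite (distrC x x1); lra.
pose Tf : {fun (closed_ball x1 p) >-> (closed_ball x1 p)} := mkfun TB.
have ctr : is_contraction Tf.
  have h0 : (0 : R) <= 2^-1 by rewrite invr_ge0.
  exists (NngNum h0); split => /=; first by lra.
  move=> [x y'] /= [xp yp']; have := fid (pB _ xp) (pB _ yp').
  by rewrite -normrN /T; congr (`|_| <= _); apply/matrixP => i j; rewrite !mxE; ring.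
have [||z zp zE] := @banach_fixed_point R _ (closed_ball x1 p) Tf ctr.
- exact: closed_ball_closed.
- by exists x1; exact: closed_ballxx.
- exists z; first exact: pB.
  have : T z = z by [].
  by rewrite /T => /eqP; rewrite subr_eq addrC -subr_eq subrr eq_sym subr_eq0 => /eqP.
Qed.

Let dfB x : B x -> differentiable f x.
Proof. by move=> Bx; have [+ _] := Cf 1; apply; exact: BU. Qed.

Lemma near_id_unit x : B x -> lin_mx ('d f x) \in unitmx.
Proof. by move=> Bx; apply: lin_mx_unit => v; exact: near_id_diff_inj. Qed.

Lemma near_id_inv_diff x : B x -> differentiable near_id_inv (f x) /\
  'd near_id_inv (f x) = lin_inv (lin_mx ('d f x)) :> (V -> V).
Proof.
move=> Bx; set M := lin_inv _.
have Mc : continuous M by exact: linear_mx_continuous.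
have [c c0 Mle] := linear_lipschitz Mc.
apply: (is_diff_epsP (L := M)) => // e e0.
(* [c] is a Lipschitz constant of the inverse differential and 2 the factor of [near_id_expand]; the
   radius [d / 2] below compensates the same 2. *)
have e10 : 0 < e / (2 * c) by rewrite divr_gt0// mulr_gt0.
have /nbhs_ballP[d /= d0 dP] := diff_eps (dfB Bx) e10.
have imf : \forall h \near 0, (f @` B) (h + f x).
  have : \forall y \near f x, (f @` B) y.
    by apply: open_nbhs_nbhs; split; [exact: near_id_open|exists x].
  by rewrite (near_shift 0 (f x)) /= subr0; exact.
have hd : \forall h \near (0 : V), `|h| < d / 2.
  by apply: nbhs0_lt; rewrite divr_gt0.
apply: filterS2 imf hd => h [z Bz zE] hd.
rewrite -zE !near_id_invK//.
have hE : h = f z - f x by rewrite zE addrK.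
have le1 : `|z - x| <= 2 * `|h| by rewrite hE; exact: near_id_expand.
have /dP : ball 0 d (z - x).
  by rewrite -ball_normE /= sub0r normrN; lra.
rewrite subrK => H1.
have ME : z - x - M h = - M (f z - f x - 'd f x (z - x)).
  have H2 : M ('d f x (z - x)) = z - x by exact: lin_invK (near_id_unit Bx) _.
  have E3 : M (f z - f x - 'd f x (z - x)) = M h - M ('d f x (z - x)).
    by rewrite -hE; exact: linearB.
  by rewrite E3 H2 opprB.
rewrite ME normrN; apply: (le_trans (Mle _)).
rewrite -(ler_pdivlMl _ _ c0).
apply: (le_trans H1); apply: (@le_trans _ _ (e / (2 * c) * (2 * `|h|))).
  by rewrite ler_wpM2l// ltW.
rewrite le_eqVlt; apply/orP; left; apply/eqP.
by field; rewrite gt_eqF.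
Qed.

(** Bootstrapping: the differential at [y] inverts ['d f] at [near_id_inv y], so order [k] of the
    inverse map gives order [k.+1]. *)
Lemma near_id_inv_smooth : smooth_on (f @` B) near_id_inv.
Proof.
have oI := near_id_open.
have imB y : (f @` B) y -> B (near_id_inv y) /\ f (near_id_inv y) = y.
  by move=> [x Bx <-]; rewrite near_id_invK.
elim=> [|k IH].
  by move=> _ [x Bx <-]; apply: differentiable_continuous; have [] := near_id_inv_diff Bx.
split=> [_ [x Bx <-]|v]; first by have [] := near_id_inv_diff Bx.
pose A y := lin_mx ('d f (near_id_inv y)).
have CA : Ck_on k (f @` B) A.
  have C1 := Ck_on_lin_mx oB (Ck_on_sub BU (Cf k.+1)).
  by apply: Ck_on_comp oI oB _ IH C1 => y /imB[].
have CI : Ck_on k (f @` B) (fun y => mxvec v *m invmx (A y)).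
  apply: Ck_on_mulmx => //; first exact: Ck_on_cst.
  by apply: Ck_on_invmx => // y /imB[By _]; exact: near_id_unit.
have C2 := Ck_on_linear_comp (L := vec_mx) oI (@linear_mx_continuous R _ _ _ vec_mx) CI.
apply: Ck_on_ext oI _ C2 => y yI.
have [By fy] := imB y yI.
have [_ E] := near_id_inv_diff By.
by have := congr1 (@^~ v) E; rewrite /= fy => ->.
Qed.

End Identity.

Section Main.
Variables m n : nat.
Local Notation V := 'M[R]_(m, n).
Implicit Types (f g : V -> V) (U : set V).

Lemma diff_cancel f g x : differentiable f x -> differentiable g (f x) ->
  (\forall z \near x, g (f z) = z) -> forall v, 'd g (f x) ('d f x v) = v.
Proof.
move=> df dg gf v.
have dgf := differentiable_comp df dg.
have [_ E] : differentiable id x /\ 'd id x = 'd (g \o f) x :> (V -> V).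
  exact: near_diff dgf.
have E1 := congr1 (@^~ v) E.
have E2 := congr1 (@^~ v) (diff_comp df dg).
have E3 := congr1 (@^~ v) (diff_val (is_diff_def := is_diff_id x)).
by rewrite -[RHS]E3 [RHS]E1 [RHS]E2.
Qed.

(** Composition with the inverse of ['d f x0] reduces to a map strictly close to the identity. *)
Let inverse_function_image f U x0 : open U -> smooth_on U f -> U x0 ->
  (forall v, 'd f x0 v = 0 -> v = 0) ->
  exists U0 g, [/\ open U0, U0 x0, U0 `<=` U, open (f @` U0) &
    (forall x, U0 x -> g (f x) = x) /\ smooth_on (f @` U0) g].
Proof.
move=> oU Cf Ux0 inj.
have Lu := lin_mx_unit inj.
pose L := 'd f x0; pose M := lin_inv (lin_mx L).
have Mc : continuous M by exact: linear_mx_continuous.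
have df : differentiable f x0 by have [+ _] := Cf 1; exact.
pose h x := M (f x).
have Ch : smooth_on U h by move=> k; exact: Ck_on_linear_comp.
have dh v : 'd h x0 v = v.
  have E := congr1 (@^~ v) (diff_comp df (linear_differentiable (f x0) Mc)).
  have E2 := congr1 (@^~ ('d f x0 v)) (diff_lin (f x0) Mc).
  by rewrite [LHS]E [LHS]E2; exact: lin_invK.
have h0 : 0 < (2^-1 : R) by rewrite invr_gt0.
have [r r0 [BU hB]] := strict_diff oU (Ch 1) Ux0 h0.
have hid x y : ball x0 r x -> ball x0 r y ->
    `|h x - h y - (x - y)| <= 2^-1 * `|x - y|.
  by move=> xr yr; have := hB x y xr yr; rewrite dh.
have imE : f @` (ball x0 r) = M @^-1` (h @` (ball x0 r)).
  apply/seteqP; split => [_ [x xr <-]|y [x xr xE]]; first by exists x.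
  by exists x => //; exact: (can_inj (lin_invKV Lu)).
exists (ball x0 r), (near_id_inv h x0 r \o M); split => //.
- exact: ball_open.
- exact: ballxx.
- rewrite imE; apply: open_comp; first by move=> x _; exact: Mc.
  exact: near_id_open hid.
split=> [x xr|]; first exact: (near_id_invK hid).
move=> k; rewrite imE; apply: (@Ck_on_comp _ _ _ _ _ _ _ (h @` (ball x0 r))).
- apply: open_comp; first by move=> x _; exact: Mc.
  exact: near_id_open hid.
- exact: near_id_open hid.
- by [].
- exact: Ck_on_linear.
- exact: (near_id_inv_smooth Ch BU hid).
Qed.

Definition local_inverse f U g (W : set V) : Prop :=
  [/\ open U, open W, forall x, U x -> W (f x) /\ g (f x) = x,
      forall y, W y -> U (g y) /\ f (g y) = y & smooth_on W g].

Theorem inverse_function f U x0 : open U -> smooth_on U f -> U x0 ->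
  (forall v, 'd f x0 v = 0 -> v = 0) ->
  exists U0 g W, [/\ U0 x0, U0 `<=` U & local_inverse f U0 g W].
Proof.
move=> oU Cf Ux0 inj.
have [U0 [g [oU0 U0x0 UU0 oW [gK Cg]]]] := inverse_function_image oU Cf Ux0 inj.
exists U0, g, (f @` U0); split => //; split => // [x U0x|_ [x U0x <-]].
  by split; [exists x|exact: gK].
by rewrite gK.
Qed.

End Main.

End InverseFunction.

(** * Eigenvalue multiplicities of self-adjoint endomorphisms *)

Section Spectral.
Context {R : rcfType}.

Lemma symmetric_transfer n (G A : 'M[R]_n) (x y : 'rV_n) : G^T = G ->
  A *m G = G *m A^T -> (x *m A *m G *m y^T) 0 0 = (y *m A *m G *m x^T) 0 0.
Proof.
move=> Gs AG.
have -> : x *m A *m G *m y^T = (y *m A *m G *m x^T)^T.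
  by rewrite !trmx_mul trmxK Gs !mulmxA -(mulmxA x) AG !mulmxA.
by rewrite mxE.
Qed.

(** For a complex eigenvector [x + i y] with eigenvalue [a + i b], exchanging [x] and [y] in the
    symmetric form [u A G v^T] shows that [b] times the sum of their squared lengths is 0. Hence
    [b = 0], and whichever of [x], [y] is nonzero is a real eigenvector. *)
Lemma real_eigenvalue n (G A : 'M[R]_n) : (0 < n)%N -> G^T = G ->
  (forall u : 'rV_n, u != 0 -> 0 < (u *m G *m u^T) 0 0) ->
  A *m G = G *m A^T -> exists a, eigenvalue A a.
Proof.
move=> n0 Gs Gp AG.
pose Ac := map_mx (real_complex R) A.
have [z zroot] : exists z, root (char_poly Ac) z.
  by apply/closed_rootP; rewrite size_char_poly; case: (n) n0.
rewrite -eigenvalue_root_char in zroot.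
have [w wA w0] := eigenvalueP zroot.
pose x := map_mx (@complex.Re R) w; pose y := map_mx (@complex.Im R) w.
pose a := complex.Re z; pose b := complex.Im z.
have xA : x *m A = a *: x - b *: y.
  apply/rowP => j; move/rowP/(_ j): wA; rewrite !mxE => /(congr1 (@complex.Re R)).
  rewrite raddf_sum /= => E.
  have -> : \sum_j0 x 0 j0 * A j0 j = \sum_i complex.Re (w 0 i * Ac i j).
    by apply: eq_bigr => k _; rewrite !mxE; case: (w 0 k) => p q /=; ring.
  by rewrite E /a /b; case: (z) (w 0 j) => p q [p' q'] /=; ring.
have yA : y *m A = a *: y + b *: x.
  apply/rowP => j; move/rowP/(_ j): wA; rewrite !mxE => /(congr1 (@complex.Im R)).
  rewrite raddf_sum /= => E.
  have -> : \sum_j0 y 0 j0 * A j0 j = \sum_i complex.Im (w 0 i * Ac i j).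
    by apply: eq_bigr => k _; rewrite !mxE; case: (w 0 k) => p q /=; ring.
  by rewrite E /a /b; case: (z) (w 0 j) => p q [p' q'] /=; ring.
have xy0 : (x != 0) || (y != 0).
  apply: contraNT w0; rewrite negb_or !negbK => /andP[/eqP x0 /eqP y0].
  apply/eqP/rowP => j; move/rowP/(_ j): x0; move/rowP/(_ j): y0.
  by rewrite !mxE; case: (w 0 j) => p q /= -> ->.
have ge0 (u : 'rV_n) : 0 <= (u *m G *m u^T) 0 0.
  by have [->|/Gp/ltW//] := eqVneq u 0; rewrite !mul0mx mxE.
have E1 := symmetric_transfer x y Gs AG.
have E2 : b * ((x *m G *m x^T) 0 0 + (y *m G *m y^T) 0 0) = 0.
  have E3 : (x *m G *m y^T) 0 0 = (y *m G *m x^T) 0 0.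
    have -> : x *m G *m y^T = (y *m G *m x^T)^T.
      by rewrite !trmx_mul trmxK Gs mulmxA.
    by rewrite mxE.
  move: E1; rewrite xA yA !(mulmxBl, mulmxDl) -!scalemxAl.
  have -> (p q : R) (M N : 'M[R]_1) : (p *: M - q *: N) 0 0 = p * M 0 0 - q * N 0 0.
    by rewrite !mxE.
  have -> (p q : R) (M N : 'M[R]_1) : (p *: M + q *: N) 0 0 = p * M 0 0 + q * N 0 0.
    by rewrite !mxE.
  by rewrite E3 => E1; lra.
have b0 : b = 0.
  move/eqP: E2; rewrite mulf_eq0 => /orP[/eqP//|].
  rewrite paddr_eq0// => /andP[/eqP x0 /eqP y0].
  by case/orP: xy0 => /Gp; rewrite ?x0 ?y0 ltxx.
case/orP: xy0 => v0; exists a; apply/eigenvalueP.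
- by exists x => //; rewrite xA b0 scale0r subr0.
- by exists y => //; rewrite yA b0 scale0r addr0.
Qed.

(* The rows of [P] are a [G]-orthonormal basis of eigenvectors of [A]. *)
Lemma spectral_pair n (G A : 'M[R]_n) : G^T = G ->
  (forall u : 'rV_n, u != 0 -> 0 < (u *m G *m u^T) 0 0) ->
  A *m G = G *m A^T ->
  exists (P : 'M[R]_n) (d : 'rV[R]_n),
    P *m G *m P^T = 1%:M /\ P *m A = diag_mx d *m P.
Proof.
elim: n G A => [|n IH] G A Gs Gp AG.
  by exists 1%:M, 0; split; apply/matrixP => -[].
have [a /eigenvalueP[v vA v0]] := real_eigenvalue (ltn0Sn n) Gs Gp AG.
pose c := (v *m G *m v^T) 0 0.
have c0 : 0 < c by exact: Gp.
pose u := (Num.sqrt c)^-1 *: v.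
have u0 : u != 0.
  by rewrite scaler_eq0 negb_or v0 andbT invr_eq0 gt_eqF// sqrtr_gt0.
have uG : u *m G *m u^T = 1%:M.
  rewrite /u linearZ /= -!scalemxAl -scalemxAr scalerA.
  rewrite [v *m G *m v^T]mx11_scalar -/c scale_scalar_mx -invfM -expr2 sqr_sqrtr ?ltW//.
  by rewrite mulVf// gt_eqF.
have uA : u *m A = a *: u by rewrite -scalemxAl vA !scalerA mulrC.
(* The [G]-orthogonal complement of [u], preserved by [A] because [A] is self-adjoint. *)
pose K := kermx (G *m u^T).
have Gu0 : G *m u^T != 0.
  apply/eqP => E; have := uG; rewrite -mulmxA E mulmx0 => /matrixP/(_ 0 0).
  by rewrite !mxE /= => /eqP; rewrite eq_sym oner_eq0.
have rK : \rank K = n.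
  rewrite mxrank_ker; have -> : \rank (G *m u^T) = 1%N; last by rewrite subn1.
  by apply/eqP; rewrite eqn_leq rank_leq_col lt0n mxrank_eq0.
(* Generalising the rank gives a basis of [K] typed with [n] rows, as the induction hypothesis
   wants. *)
have H m (e : \rank K = m) : exists (W : 'M[R]_(m, n.+1)), row_free W /\ (W :=: K)%MS.
  by rewrite -e; exists (row_base K); split; [exact: row_base_free|exact: eq_row_base].
have [W [Wf WK]] := H n rK.
have WGu : W *m G *m u^T = 0.
  by apply/eqP; rewrite -mulmxA -sub_kermx -/K WK.
have WAK : (W *m A <= W)%MS.
  rewrite WK sub_kermx mulmxA -(mulmxA W) AG mulmxA -(mulmxA (W *m G)) -trmx_mul uA.
  by rewrite linearZ /= -scalemxAr WGu scaler0.
pose A' := W *m A *m pinvmx W.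
have WA : W *m A = A' *m W by rewrite mulmxKpV.
(* The Gram matrix of the basis [W] is the new scalar product; this is why the induction runs over
   all [G]. *)
have [|x x0||P' [d' [PG PA]]] := IH (W *m G *m W^T) A'.
- by rewrite !trmx_mul trmxK Gs mulmxA.
- have := Gp (x *m W); rewrite trmx_mul !mulmxA; apply.
  by apply: contra_neq x0 => xW; apply: (row_free_inj Wf); rewrite xW mul0mx.
- rewrite !mulmxA -WA -(mulmxA W) AG.
  by rewrite -(mulmxA _ W^T) -trmx_mul -WA trmx_mul !mulmxA.
pose Q : 'M[R]_(1 + n, n.+1) := col_mx u (P' *m W).
pose d : 'rV[R]_(1 + n) := row_mx a%:M d'.
suff [H1 H2] : Q *m G *m Q^T = (1%:M : 'M[R]_(1 + n)) /\ Q *m A = diag_mx d *m Q.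
  by exists Q, d.
rewrite /Q /d; split.
  rewrite mul_col_mx tr_col_mx mul_col_row uG !trmx_mul !mulmxA.
  rewrite (_ : u *m G *m W^T = 0) ?mul0mx; last first.
    by apply: trmx_inj; rewrite !trmx_mul trmxK Gs mulmxA WGu trmx0.
  rewrite -(mulmxA P') -(mulmxA P') WGu mulmx0.
  rewrite !mulmxA in PG; rewrite !mulmxA PG.
  by rewrite (scalar_mx_block 1 n).
rewrite mul_col_mx uA -mulmxA WA mulmxA PA diag_mx_row mul_block_col.
rewrite !mul0mx addr0 add0r mulmxA; congr col_mx.
by apply/rowP => j; rewrite !mxE big_ord1 !mxE !eqxx mulr1n.
Qed.

Lemma rank_diag n (e : 'rV[R]_n) : \rank (diag_mx e) = #|[set i | e 0 i != 0]%SET|.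
Proof.
set S := [set i | _]%SET.
pose E : 'M[R]_(#|S|, n) := \matrix_(i, j) (enum_val i == j)%:R.
apply/eqP; rewrite eqn_leq; apply/andP; split.
  have -> : diag_mx e = E^T *m (E *m diag_mx e).
    apply/matrixP => i j; rewrite mulmxA mul_mx_diag !mxE.
    case: (boolP (i \in S)) => iS.
      rewrite (bigD1 (enum_rank_in iS i))//= !mxE enum_rankK_in// eqxx mul1r.
      rewrite big1 ?addr0 => [|k ki]; first by case: eqP => [->|]; rewrite ?mul1r// mul0r.
      rewrite !mxE (_ : (enum_val k == i) = false) ?mul0r//.
      by apply: contraNF ki => /eqP ki; apply/eqP/enum_val_inj; rewrite enum_rankK_in.
    have -> : e 0 i = 0 by move: iS; rewrite inE negbK => /eqP.
    rewrite mul0rn big1 ?mul0r// => k _; rewrite !mxE.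
    rewrite (_ : (enum_val k == i) = false) ?mul0r//.
    by apply: contraNF iS => /eqP <-; exact: enum_valP.
  by apply: leq_trans (mulmx_max_rank _ _) _.
have -> : #|S| = \rank (diag_mx (\row_(i < #|S|) e 0 (enum_val i))).
  apply/esym/mxrank_unit; rewrite unitmxE det_diag unitfE.
  apply/prodf_neq0 => i _; rewrite mxE.
  by have := enum_valP i; rewrite inE.
have -> : diag_mx (\row_(i < #|S|) e 0 (enum_val i)) = E *m diag_mx e *m E^T.
  apply/matrixP => i j; rewrite mul_mx_diag !mxE.
  rewrite (bigD1 (enum_val i))//= !mxE eqxx mul1r big1 ?addr0 => [|k ki].
    by rewrite (inj_eq enum_val_inj) (eq_sym j i); case: (i == j); rewrite ?mulr1 ?mulr0.
  by rewrite !mxE (eq_sym _ k) (negbTE ki) !mul0r.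
by apply: leq_trans (mxrankM_maxl _ _) _; exact: mxrankM_maxr.
Qed.

Lemma rank_eigenspace_diag n (A P : 'M[R]_n) (d : 'rV[R]_n) a :
  P \in unitmx -> P *m A = diag_mx d *m P ->
  \rank (eigenspace A a) = #|[set i | d 0 i == a]%SET|.
Proof.
move=> Pu PA; rewrite mxrank_ker.
have -> : A - a%:M = invmx P *m diag_mx (d - const_mx a) *m P.
  rewrite linearB /= diag_const_mx mulmxBr mulmxBl -mulmxA -PA mulKmx//.
  by rewrite mul_mx_scalar -scalemxAl mulVmx// scalemx1.
rewrite mxrankMfree ?row_free_unit// -mxrank_tr trmx_mul mxrankMfree; last first.
  by rewrite row_free_unit unitmx_tr unitmx_inv.
rewrite mxrank_tr rank_diag; set S := [set i | d 0 i == a]%SET.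
have -> : [set i | (d - const_mx a) 0 i != 0]%SET = (~: S)%SET.
  by apply/setP => i; rewrite !inE !mxE subr_eq0.
by rewrite cardsCs finset.setCK card_ord subKn// -[X in (_ <= X)%N](card_ord n) max_card.
Qed.

Lemma eigenvalue_diag n (A P : 'M[R]_n) (d : 'rV[R]_n) a :
  P \in unitmx -> P *m A = diag_mx d *m P ->
  eigenvalue A a = [exists i, d 0 i == a].
Proof.
move=> Pu PA; rewrite /eigenvalue -mxrank_eq0 (rank_eigenspace_diag a Pu PA).
rewrite cards_eq0; apply/set0Pn/existsP => -[k]; first by rewrite inE; exists k.
by exists k; rewrite inE.
Qed.

End Spectral.

Section Multiplicities.
Context {R : realType}.

Definition diag_class n (d : 'rV[R]_n) (a : R) : {set 'I_n} :=
  [set i | d 0 i == a]%SET.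

(** Multiplicities as combinatorics of the diagonal alone; [has_multiplicities_diag] links them to
    every matrix diagonalised to [d]. *)
Definition mult_of n (d : 'rV[R]_n) (m : seq nat) : Prop :=
  exists s : seq R, [/\ sorted <%R s, forall a, (a \in s) = [exists i, d 0 i == a] &
    [seq #|diag_class d a| | a <- s] = m].

Lemma has_multiplicities_diag n (A P : 'M[R]_n) (d : 'rV[R]_n) m :
  P \in unitmx -> P *m A = diag_mx d *m P ->
  has_multiplicities A m <-> mult_of d m.
Proof.
move=> Pu PA; split=> -[s [s1 s2 s3]]; exists s; split => //.
- by move=> a; rewrite s2 -(eigenvalue_diag a Pu PA).
- by rewrite -s3; apply: eq_map => a; rewrite (rank_eigenspace_diag a Pu PA).
- by move=> a; rewrite s2 -(eigenvalue_diag a Pu PA).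
- by rewrite -s3; apply: eq_map => a; rewrite (rank_eigenspace_diag a Pu PA).
Qed.

Lemma mult_of_exists n (d : 'rV[R]_n) : exists m, mult_of d m.
Proof.
pose s := sort <=%R (undup (codom (d 0))).
exists [seq #|diag_class d a| | a <- s], s; split => // [|a].
  by rewrite lt_sorted_uniq_le sort_uniq undup_uniq sort_sorted//; exact: le_total.
rewrite mem_sort mem_undup; apply/codomP/existsP => -[k].
  by move=> ->; exists k.
by move/eqP <-; exists k.
Qed.

Lemma mult_of_inj n (d : 'rV[R]_n) m m' : mult_of d m -> mult_of d m' -> m = m'.
Proof.
move=> [s [s1 s2 <-]] [s' [s1' s2' <-]].
have -> // : s = s'.
by apply: lt_sorted_eq => // a; rewrite s2 s2'.
Qed.

Lemma sum_diag_class n (d : 'rV[R]_n) (s : seq R) (F : 'I_n -> nat) : uniq s ->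
  (forall i, d 0 i \in s) ->
  (\sum_(a <- s) \sum_(i in diag_class d a) F i = \sum_i F i)%N.
Proof.
move=> us ds; rewrite (exchange_big_dep xpredT)//=; apply: eq_bigr => i _.
rewrite (eq_bigl (fun a => a == d 0 i)) => [|a]; last by rewrite inE eq_sym.
by rewrite -big_filter filter_pred1_uniq// big_seq1.
Qed.

Lemma mult_of_size n (d : 'rV[R]_n) m : mult_of d m -> (size m <= n)%N.
Proof.
move=> [s [s1 s2 <-]]; rewrite size_map.
have us : uniq s by move: s1; rewrite lt_sorted_uniq_le => /andP[].
have : {subset s <= codom (d 0)}.
  by move=> a; rewrite s2 => /existsP[i /eqP <-]; exact: codom_f.
by move/(uniq_leq_size us); rewrite size_codom card_ord.
Qed.

Lemma mult_of_wf n (d : 'rV[R]_n) m : mult_of d m ->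
  all (fun k => (0 < k)%N) m && (sumn m == n).
Proof.
move=> [s [s1 s2 <-]].
have us : uniq s by move: s1; rewrite lt_sorted_uniq_le => /andP[].
apply/andP; split.
  apply/allP => k /mapP[a]; rewrite s2 => /existsP[i di] ->.
  by apply/card_gt0P; exists i; rewrite inE.
rewrite sumnE big_map -[X in _ == X](card_ord n) -sum1_card.
rewrite -(@sum_diag_class n d s (fun=> 1%N) us).
  by apply/eqP; apply: eq_bigr => a _; rewrite sum1_card.
by move=> i; rewrite s2; apply/existsP; exists i.
Qed.

Lemma distinct_eigenvalues_diag n (A P : 'M[R]_n) (d : 'rV[R]_n) m :
  P \in unitmx -> P *m A = diag_mx d *m P -> mult_of d m ->
  distinct_eigenvalues A <-> size m = n.
Proof.
move=> Pu PA dm; have sm := mult_of_size dm; case: dm => s [s1 s2 sE].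
have us : uniq s by move: s1; rewrite lt_sorted_uniq_le => /andP[].
rewrite -sE size_map; split=> [[s' [us' ss' sA]]|sn].
  apply/eqP; rewrite eqn_leq -{1}(size_map (fun a => #|diag_class d a|)) sE sm -ss'.
  apply: uniq_leq_size => // a /(allP sA).
  by rewrite (eigenvalue_diag a Pu PA) s2.
exists s; split => //; apply/allP => a.
by rewrite (eigenvalue_diag a Pu PA) s2.
Qed.

(** Only the weak order of the entries matters: [phi] relabels the values monotonically and carries
    classes to classes. *)
Lemma mult_of_order n (d d' : 'rV[R]_n) m :
  (forall i j, (d 0 i < d 0 j) = (d' 0 i < d' 0 j)) ->
  mult_of d m -> mult_of d' m.
Proof.
move=> dd [s [s1 s2 <-]].
have eqd i j : (d 0 i == d 0 j) = (d' 0 i == d' 0 j).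
  by rewrite !eq_le !leNgt !dd.
pose phi a := if [pick i | d 0 i == a] is Some i then d' 0 i else 0.
have phiE i : phi (d 0 i) = d' 0 i.
  rewrite /phi; case: pickP => [j|/(_ i)]; last by rewrite eqxx.
  by rewrite eqd => /eqP.
exists (map phi s); split.
- rewrite sorted_map; apply: (sub_in_sorted (P := mem s)) s1.
  + move=> a b sa sb; move: (sa : a \in s) (sb : b \in s).
    rewrite !s2 => /existsP[i /eqP <-] /existsP[j /eqP <-].
    by rewrite /= !phiE dd.
  + by apply/allP.
- move=> b; apply/mapP/existsP => [[a]|[i /eqP <-]].
    by rewrite s2 => /existsP[i /eqP <-] ->; exists i; rewrite phiE.
  by exists (d 0 i); rewrite ?phiE// s2; apply/existsP; exists i.
- rewrite -map_comp; apply/eq_in_map => a; rewrite s2 => /existsP[i /eqP <-] /=.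
  by apply: eq_card => j; rewrite !inE phiE eqd.
Qed.

(* ['C(k, 2) + k.-1] is the dimension of the traceless symmetric matrices of
   size [k]. *)
Definition codim (m : seq nat) : nat := sumn [seq ('C(k, 2) + k.-1)%N | k <- m].

Definition class_rep n (d : 'rV[R]_n) (i : 'I_n) : 'I_n :=
  odflt i [pick j | d 0 j == d 0 i].

Lemma class_rep_class n (d : 'rV[R]_n) i : d 0 (class_rep d i) = d 0 i.
Proof. by rewrite /class_rep; case: pickP => //= j /eqP. Qed.

(** [pick] sees only the predicate, which is the same for equal values; the default of [odflt] is
    never reached, since [i] itself qualifies. *)
Lemma class_rep_eq n (d : 'rV[R]_n) i j : d 0 i = d 0 j ->
  class_rep d i = class_rep d j.
Proof.
move=> ij; rewrite /class_rep -ij; case: pickP => //= /(_ i).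
by rewrite eqxx.
Qed.

(* The entries [S a b] with [a < b] in the same block, and the differences of
   diagonal entries [S a a - S r r] with [r] the representative of the block of
   [a], are linear coordinates on the symmetric block diagonal matrices
   with traceless blocks. *)
Definition block_coords n (d : 'rV[R]_n) : {set 'I_n * 'I_n} :=
  [set p | (d 0 p.1 == d 0 p.2) &&
     ((p.1 < p.2)%N || ((p.1 == p.2) && (class_rep d p.1 != p.1)))]%SET.

(** The square of [B] splits into the pairs above, below and on the diagonal, and a flip exchanges
    the first two. *)
Lemma card_ordered_pairs n (B : {set 'I_n}) :
  #|[set p : 'I_n * 'I_n | [&& p.1 \in B, p.2 \in B & (p.1 < p.2)%N]]%SET| = 'C(#|B|, 2).
Proof.
set J := [set p | _]%SET.
pose J' := [set p : 'I_n * 'I_n | [&& p.1 \in B, p.2 \in B & (p.2 < p.1)%N]]%SET.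
pose D := [set p : 'I_n * 'I_n | [&& p.1 \in B, p.2 \in B & p.1 == p.2]]%SET.
have JJ' : #|J'| = #|J|.
  have swap_inj : injective (fun p : 'I_n * 'I_n => (p.2, p.1)) by move=> [? ?] [? ?] [-> ->].
  rewrite -(card_imset _ swap_inj); apply: eq_card => -[i j].
  apply/imsetP/idP => [[[i' j']]|]; rewrite !inE /=.
    by move=> /and3P[? ? ?] [-> ->]; apply/and3P.
  by move=> /and3P[? ? ?]; exists (j, i) => //; rewrite inE; apply/and3P.
have cD : #|D| = #|B|.
  have diag_inj : injective (fun i : 'I_n => (i, i)) by move=> ? ? [].
  rewrite -(card_imset _ diag_inj); apply: eq_card => -[i j].
  apply/idP/imsetP => [|[k kB [-> ->]]]; rewrite !inE /=.
    by move=> /and3P[iB jB /eqP ->]; exists j.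
  by rewrite kB eqxx.
have tot : (#|J| + #|J'| + #|D| = #|B| * #|B|)%N.
  rewrite -cardsX -(cardsID J (finset.setX B B)) -addnA; congr (_ + _)%N.
    by apply: eq_card => -[i j]; rewrite !inE /=; case: (i \in B); case: (j \in B).
  rewrite -(cardsID J' (finset.setX B B :\: J)); congr (_ + _)%N.
    apply: eq_card => -[i j]; rewrite !inE /=; case: (i \in B); case: (j \in B) => //=.
    by case: ltngtP.
  apply: eq_card => -[i j]; rewrite !inE /= -val_eqE /=; case: (i \in B); case: (j \in B) => //=.
  by case: ltngtP.
rewrite bin2 JJ' cD in tot *; rewrite -[LHS]doubleK; congr half.
have -> : (#|B| * #|B|.-1 = #|B| * #|B| - #|B|)%N by rewrite -subn1 mulnBr muln1.
by rewrite -tot addnK addnn.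
Qed.

Lemma card_block_coords n (d : 'rV[R]_n) m : mult_of d m ->
  #|block_coords d| = codim m.
Proof.
move=> [s [s1 s2 <-]].
have us : uniq s by move: s1; rewrite lt_sorted_uniq_le => /andP[].
have ds i : d 0 i \in s by rewrite s2; apply/existsP; exists i.
rewrite /codim sumnE !big_map big_split /=.
pose J1 := [set p : 'I_n * 'I_n | (d 0 p.1 == d 0 p.2) && (p.1 < p.2)%N]%SET.
pose J2 := [set k : 'I_n | class_rep d k != k]%SET.
have diag_inj : injective (fun k : 'I_n => (k, k)) by move=> ? ? [].
have -> : #|block_coords d| = (#|J1| + #|J2|)%N.
  rewrite -(cardsID J1 (block_coords d)); congr (_ + _)%N.
    by apply: eq_card => -[i j]; rewrite !inE /=; case: (d 0 i == d 0 j);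
      case: (i < j)%N; rewrite /= ?andbT ?andbF.
  rewrite -(card_imset _ diag_inj); apply: eq_card => -[i j]; rewrite !inE /=.
  apply/idP/imsetP => [|[k]].
    case: (d 0 i == d 0 j) => //=; case: (i < j)%N => //= /andP[/eqP ij ri].
    by exists i; rewrite ?inE// ij.
  by rewrite inE => rk [-> ->]; rewrite eqxx ltnn eqxx.
congr (_ + _)%N.
- pose F (k : 'I_n) := #|[set j | (d 0 k == d 0 j) && (k < j)%N]%SET|.
  transitivity (\sum_k F k)%N.
    rewrite -sum1_card (eq_bigl (fun p => (d 0 p.1 == d 0 p.2) && (p.1 < p.2)%N)); last first.
      by move=> p; rewrite inE.
    rewrite -(pair_big_dep xpredT (fun k j => (d 0 k == d 0 j) && (k < j)%N) (fun _ _ => 1%N)) /=.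
    by apply: eq_bigr => k _; rewrite /F -sum1_card; apply: eq_bigl => j; rewrite inE.
  rewrite -(sum_diag_class F us ds); apply: eq_bigr => a _.
  rewrite -card_ordered_pairs -sum1_card.
  rewrite (eq_bigl (fun p => (p.1 \in diag_class d a) &&
    ((d 0 p.1 == d 0 p.2) && (p.1 < p.2)%N))); last first.
    move=> -[k j]; rewrite !inE /=; case: (eqVneq (d 0 k) a) => //= ->.
    by rewrite eq_sym.
  rewrite -(pair_big_dep (mem (diag_class d a))
    (fun k j => (d 0 k == d 0 j) && (k < j)%N) (fun _ _ => 1%N)) /=.
  by apply: eq_bigr => k _; rewrite /F -sum1_card; apply: eq_bigl => j; rewrite inE.
(* Exactly one index of each class is its own representative, which leaves [k.-1] diagonal
   coordinates in a class of size [k]. *)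
- transitivity (\sum_k (class_rep d k != k))%N.
    by rewrite -sum1_card big_mkcond /=; apply: eq_bigr => k _; rewrite inE; case: ifP.
  rewrite -(sum_diag_class _ us ds) [in LHS]big_seq [in RHS]big_seq; apply: eq_bigr => a.
  rewrite s2 => /existsP[k /eqP ka].
  have rka : class_rep d k \in diag_class d a by rewrite inE class_rep_class ka.
  rewrite (bigD1 (class_rep d k))//= (class_rep_eq (class_rep_class d k)) eqxx add0n.
  rewrite (eq_bigr (fun=> 1%N)) => [|j /andP[]].
    rewrite sum1_card [in RHS](cardD1 (class_rep d k)) rka /=.
    by rewrite add0n; apply: eq_card => j; rewrite [LHS]unfold_in !inE andbC.
  rewrite inE -ka => /eqP jk jr.
  by rewrite (class_rep_eq jk) eq_sym jr.
Qed.

(** A multiplicity 1 contributes 0, so some [k >= 2] occurs, and it contributes at least 2. *)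
Lemma codim_degenerate m : all (fun k => (0 < k)%N) m -> (size m < sumn m)%N ->
  (2 <= codim m)%N.
Proof.
rewrite /codim; elim: m => [//|k m IH] /= /andP[k0 m0] H.
case: k k0 H => [//|[_|k _ _]] /=.
  by rewrite add1n ltnS => /(IH m0) /leq_trans; apply; exact: leq_addl.
by rewrite binS bin1 /=; lia.
Qed.

Lemma size_le_sumn m : all (fun k => (0 < k)%N) m -> (size m <= sumn m)%N.
Proof. by elim: m => //= k m IH /andP[k0 /IH]; lia. Qed.

Lemma codim_nondegenerate m : all (fun k => (0 < k)%N) m ->
  sumn m = size m -> codim m = 0%N.
Proof.
rewrite /codim; elim: m => //= k m IH /andP[k0 m0] H.
have := size_le_sumn m0 => H1.
by rewrite (_ : k = 1%N) ?IH//; lia.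
Qed.

(** [block_coords d] reduces to one off-diagonal and one diagonal pair. *)
Lemma codim_one_coincidence n (d : 'rV[R]_n) m (a b : 'I_n) : mult_of d m ->
  a != b -> d 0 a = d 0 b ->
  (forall i j, d 0 i = d 0 j -> i != j -> (i = a /\ j = b) \/ (i = b /\ j = a)) ->
  codim m = 2%N /\ (size m < n)%N.
Proof.
move=> dm; have cm := card_block_coords dm.
wlog ab : a b / (a < b)%N.
  move=> H ab; have := ab; rewrite neq_ltn => /orP[abl|bal] dab U; first exact: (H a b).
  by apply: (H b a) => // [|i j dij ij]; rewrite 1?eq_sym//; case: (U i j dij ij); tauto.
move=> nab dab U.
have ra : class_rep d a = a \/ class_rep d a = b.
  have [E|/eqP E] := eqVneq (class_rep d a) a; first by left.
  by case: (U _ _ (class_rep_class d a)); [exact/eqP|move=> [/E]|move=> []; right].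
(* Of [a] and [b], the one that does not represent their class. *)
pose k := if class_rep d a == a then b else a.
have kE j : (class_rep d j != j) = (j == k).
  have rb : class_rep d b = class_rep d a by exact: class_rep_eq.
  have [->|ja] := eqVneq j a.
    by rewrite /k; case: (eqVneq (class_rep d a) a); rewrite ?eqxx ?(negbTE nab).
  have [->|jb] := eqVneq j b.
    rewrite rb /k; case: ra => ->; first by rewrite !eqxx nab.
    by rewrite !eqxx (eq_sym b a) (negbTE nab) (eq_sym b a) (negbTE nab).
  have -> : class_rep d j = j.
    apply/eqP/negPn/negP => /(U _ _ (class_rep_class d j))[[_ jE]|[_ jE]].
      by rewrite jE eqxx in jb.
    by rewrite jE eqxx in ja.
  by rewrite eqxx /k; case: ifP => _; rewrite ?(negbTE ja) ?(negbTE jb).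
have bcE : block_coords d = [set (a, b); (k, k)]%SET.
  apply/setP => -[i j]; rewrite !inE /= kE !xpair_eqE.
  apply/idP/orP => [/andP[/eqP dij /orP[ij|/andP[/eqP <- ik]]]|[]].
  - left; have : i != j by rewrite neq_ltn ij.
    by move/(U _ _ dij) => [[-> ->]|[iE jE]]; rewrite ?eqxx//; move: ij ab; rewrite iE jE; lia.
  - by right; rewrite ik.
  - by move=> /andP[/eqP -> /eqP ->]; rewrite dab eqxx ab.
  - by move=> /andP[/eqP -> /eqP ->]; rewrite !eqxx orbT.
split.
  rewrite -cm bcE cards2 xpair_eqE.
  by case: eqP => //= ak; case: eqP => //= bk; rewrite ak bk eqxx in nab.
have := mult_of_size dm; rewrite leq_eqVlt => /orP[/eqP sm|//].
have /andP[al /eqP su] := mult_of_wf dm.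
have c0 : codim m = 0%N by apply: codim_nondegenerate; rewrite // su.
by move: cm; rewrite bcE c0 cards2.
Qed.

Lemma eigmult_size_le n (m : eigmult n) : (size (val m) <= n)%N.
Proof. by case: m => m /= /andP[m0 /eqP <-]; exact: size_le_sumn. Qed.

Lemma eigmult_nondegenerate n (m : eigmult n) : ~~ (size (val m) < n)%N ->
  codim (val m) = 0%N.
Proof.
case: m => m /= /andP[m0 /eqP <-]; rewrite -leqNgt => H.
by apply: codim_nondegenerate => //; apply/eqP; rewrite eqn_leq H size_le_sumn.
Qed.

End Multiplicities.

(** * Normal form of an endomorphism near a diagonal one *)

Section SpectralBlocks.
Context {R : realType} {n : nat}.
Variable d : 'rV[R]_n.
Let D := diag_mx d.
Local Notation M := 'M[R]_n.

(** The projection onto the commutant of [diag_mx d] ([comm_blk]); it is linear over that commutant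
    on both sides, so equations with block diagonal coefficients split. *)
Definition blk (Z : M) : M := \matrix_(i, j) (if d 0 i == d 0 j then Z i j else 0).

Lemma blk_is_linear : linear blk.
Proof.
move=> a u v; apply/matrixP => i j; rewrite !mxE; case: ifP => // _.
by rewrite mulr0 addr0.
Qed.

HB.instance Definition _ := GRing.isLinear.Build R M M _ blk blk_is_linear.

Definition off (Z : M) : M := Z - blk Z.

Lemma off_is_linear : linear off.
Proof.
by move=> a u v; rewrite /off linearP scalerBr opprD addrACA.
Qed.

HB.instance Definition _ := GRing.isLinear.Build R M M _ off off_is_linear.

Lemma comm_diagE (Z : M) i j : (Z *m D - D *m Z) i j = (d 0 j - d 0 i) * Z i j.
Proof.
by rewrite /D mul_mx_diag mul_diag_mx !mxE mulrC mulrBl.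
Qed.

Lemma comm_blk Z : comm_mx Z D <-> blk Z = Z.
Proof.
split=> [ZD|<-]; last first.
  apply/eqP; rewrite -subr_eq0; apply/eqP/matrixP => i j; rewrite comm_diagE !mxE.
  by case: eqP => [->|_]; rewrite ?subrr ?mul0r ?mulr0.
apply/matrixP => i j; rewrite mxE; case: eqP => // /eqP dij.
have /eqP := comm_diagE Z i j; rewrite ZD subrr mxE eq_sym mulf_eq0 subr_eq0.
by rewrite eq_sym (negbTE dij) => /eqP.
Qed.

Lemma blkK Z : blk (blk Z) = blk Z.
Proof. by apply/matrixP => i j; rewrite !mxE; case: (d 0 i == d 0 j). Qed.

Lemma comm_mx_blk Z : comm_mx (blk Z) D.
Proof. by apply/comm_blk; exact: blkK. Qed.

Lemma blk_mulr (B N : M) : comm_mx B D -> blk (B *m N) = B *m blk N.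
Proof.
move=> /comm_blk BE; apply/matrixP => i j; rewrite !mxE.
case: ifPn => dij.
  apply: eq_bigr => k _; rewrite -BE !mxE; case: eqP => [dik|_]; last by rewrite !mul0r.
  by rewrite -dik dij.
rewrite big1// => k _; rewrite -BE !mxE; case: eqP => [dik|_]; last by rewrite !mul0r.
by rewrite -dik (negbTE dij) mulr0.
Qed.

Lemma blk_tr N : blk N^T = (blk N)^T.
Proof. by apply/matrixP => i j; rewrite !mxE eq_sym. Qed.

Lemma comm_tr (B : M) : comm_mx B D -> comm_mx B^T D.
Proof.
by move=> BD; apply: trmx_inj; rewrite !trmx_mul trmxK /D tr_diag_mx -/D BD.
Qed.

Lemma blk_mull (B N : M) : comm_mx B D -> blk (N *m B) = blk N *m B.
Proof.
move=> BD; apply: trmx_inj.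
by rewrite -blk_tr !trmx_mul -blk_tr; apply: blk_mulr; exact: comm_tr.
Qed.

(* The perturbation [S - D] is too small to mix the eigenvalues coming from
   different blocks of [D]. *)
Definition separated_blocks (S : M) : Prop :=
  forall i j, d 0 i != d 0 j -> 2 * n%:R * `|S - D| < `|d 0 i - d 0 j|.

Lemma separatedD : separated_blocks D.
Proof. by move=> i j dij; rewrite subrr normr0 mulr0 normr_gt0 subr_eq0. Qed.

Lemma near_separated T (F : set_system T) {FF : Filter F} (f : T -> M) :
  f x @[x --> F] --> D -> \forall x \near F, separated_blocks (f x).
Proof.
move=> fD.
have H : \forall x \near F, forall ij : 'I_n * 'I_n, d 0 ij.1 != d 0 ij.2 ->
    2 * n%:R * `|f x - D| < `|d 0 ij.1 - d 0 ij.2|.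
  apply: (@filter_forall _ _ (fun (ij : 'I_n * 'I_n) x => d 0 ij.1 != d 0 ij.2 ->
    2 * n%:R * `|f x - D| < `|d 0 ij.1 - d 0 ij.2|) F) => -[i j] /=.
  have [->|dij] := eqVneq (d 0 i) (d 0 j); first by apply: nearW.
  have e0 : 0 < `|d 0 i - d 0 j| / (2 * n%:R + 1).
    by rewrite divr_gt0 ?normr_gt0 ?subr_eq0// ltr_wpDl// mulr_ge0.
  have /cvgrPdist_lt/(_ _ e0) := fD; apply: filterS => x Hx _.
  rewrite distrC in Hx; move: Hx; rewrite ltr_pdivlMr ?ltr_wpDl ?mulr_ge0// => Hx.
  apply: le_lt_trans Hx; rewrite mulrC ler_wpM2l//; lra.
by apply: filterS H => x H i j; exact: (H (i, j)).
Qed.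

(* The blocks of [B] have disjoint spectra, so the Sylvester equation
   [B N = N B^T] forces [N] to be block diagonal. *)
Lemma sylvester_comm (B N : M) : comm_mx B D ->
  separated_blocks B -> B *m N = N *m B^T -> comm_mx N D.
Proof.
move=> BD small BN; apply/comm_blk.
set Y := off N; have BY : B *m Y = Y *m B^T.
  rewrite /Y /off mulmxBr mulmxBl BN -blk_mulr// -(blk_mull _ (comm_tr BD)).
  by rewrite BN.
suff Y0 : Y = 0 by apply/esym/eqP; rewrite -subr_eq0; apply/eqP; exact: Y0.
have Yblk i j : d 0 i = d 0 j -> Y i j = 0.
  by move=> dij; rewrite !mxE dij eqxx subrr.
clearbody Y; apply/eqP/negPn/negP => Yn0.
have Yn : mx_norm Y != 0 by apply: contra_neq Yn0; exact: mx_norm_eq0.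
(* The equation is tested at an entry where [Y] attains its norm; it must lie outside the blocks. *)
have [[i j] /= Yij] := mx_norm_neq0 Yn.
have Y_norm : `|Y| = `|Y i j| by exact: Yij.
have Y_gt0 : 0 < `|Y| by rewrite normr_gt0.
have [dij|dij] := eqVneq (d 0 i) (d 0 j).
  by move: Y_gt0; rewrite Y_norm Yblk// normr0 ltxx.
set E := B - D.
have EY : (d 0 i - d 0 j) * Y i j = (Y *m E^T - E *m Y) i j.
  have /(congr1 (fun X : M => X i j)) : Y *m D - D *m Y = - (Y *m E^T - E *m Y).
    have -> : E^T = B^T - D by rewrite /E raddfB /= /D tr_diag_mx.
    rewrite /E mulmxBr mulmxBl BY opprB (opprB (Y *m B^T)).
    by rewrite [RHS]addrC addrA subrK.
  by rewrite comm_diagE mxE => /eqP; rewrite -eqr_oppLR -mulNr opprB => /eqP.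
(* Two products are bounded in this way, whence the factor [2 * n%:R] in [separated_blocks]. *)
have bound (X X' : M) : `|(X *m X') i j| <= n%:R * (`|X| * `|X'|).
  rewrite mxE; apply: (le_trans (ler_norm_sum _ _ _)).
  rewrite -[X in X%:R]card_ord -sum1_card natr_sum mulr_suml.
  by apply: ler_sum => k _; rewrite mul1r normrM ler_pM// le_entry_norm.
have trE : `|E^T| <= `|E|.
  by apply: mx_norm_le => // a b; rewrite mxE le_entry_norm.
have := small i j dij; rewrite -/E.
have : `|d 0 i - d 0 j| * `|Y| <= 2 * n%:R * `|E| * `|Y|.
  rewrite {1}Y_norm -normrM EY mxE [X in `|_ + X|]mxE.
  rewrite (le_trans (ler_normB _ _))//.
  have b1 := bound Y E^T; have b2 := bound E Y.
  have b3 : n%:R * (`|Y| * `|E^T|) <= n%:R * (`|Y| * `|E|).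
    by rewrite ler_wpM2l// ler_wpM2l.
  by nra.
by rewrite ler_pM2r// => H /lt_le_trans/(_ H); rewrite ltxx.
Qed.

End SpectralBlocks.

Section DiffMulmx.
Context {R : realType}.

Lemma diff_mulmx (V : normedModType R) m n p (f : V -> 'M[R]_(m, n))
    (g : V -> 'M[R]_(n, p)) x : differentiable f x -> differentiable g x ->
  differentiable (fun z => f z *m g z) x /\
  'd (fun z => f z *m g z) x = (fun v => f x *m 'd g x v + 'd f x v *m g x)
    :> (V -> 'M[R]_(m, p)).
Proof.
move=> df dg.
have c : continuous (fun q : 'M[R]_(m, n) * 'M[R]_(n, p) => q.1 *m q.2).
  by move=> q; apply: cvg_mulmx; [exact: cvg_fst|exact: cvg_snd].
have dp := differentiable_pair df dg.
have db := @differentiable_bilin _ _ _ _ (@mulmx R m n p) (f x, g x) c.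
split; first exact: (differentiable_comp dp db).
have := diff_comp dp db; rewrite /comp /= => ->.
by rewrite diff_pair// diff_bilin.
Qed.

Lemma diff_affine (V W : normedModType R) (a : W) (L : {linear V -> W}) x v :
  continuous L -> 'd (fun z => a + L z) x v = L v.
Proof.
move=> cL.
have E1 := congr1 (@^~ v) (diffD (differentiable_cst a x) (linear_differentiable x cL)).
have E2 := congr1 (@^~ v) (diff_lin x cL).
have E3 := congr1 (@^~ v) (diff_cst a x).
have E4 := etrans E1 (congr2 (fun p q => p + q) E3 E2).
exact: (etrans E4 (add0r _)).
Qed.

Lemma diff_linear (V W : normedModType R) (L : {linear V -> W}) x v :
  continuous L -> 'd L x v = L v.
Proof. by move=> cL; exact: (congr1 (@^~ v) (diff_lin x cL)). Qed.

End DiffMulmx.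

Section SquareRoot.
Context {R : realType} {n : nat}.
Local Notation M := 'M[R]_n.

(** Squaring has differential [v |-> v + v] at 1. Its injectivity on [U] matters as much as the
    smoothness of [rho]: two roots of one matrix in [U] coincide. *)
Lemma local_sqrt : exists U (rho : M -> M) W,
  U 1%:M /\ local_inverse (fun X : M => X *m X) U rho W.
Proof.
have Csq : smooth_on setT (fun X : M => X *m X).
  by move=> k; apply: Ck_on_mulmx; [exact: openT|exact: Ck_on_id..].
have did : differentiable (fun X : M => X) (1%:M : M).
  by case: (is_diff_id (1%:M : M)).
have dE v : 'd (fun X : M => X) (1%:M : M) v = v.
  by have [_ /(congr1 (@^~ v))] := is_diff_id (1%:M : M).
have dsq v : 'd (fun X : M => X *m X) (1%:M : M) v = v + v.
  have [_ /(congr1 (@^~ v)) E] := diff_mulmx did did.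
  by rewrite [LHS]E mul1mx mulmx1 dE.
have [||U [rho [W [U1 _ H]]]] := @inverse_function R n n _ setT (1%:M : M) openT Csq.
- by [].
- move=> v; rewrite dsq => /matrixP H; apply/matrixP => i j.
  by have := H i j; rewrite !mxE; lra.
- by exists U, rho, W.
Qed.

End SquareRoot.

Section NormalFormExists.
Context {R : realType} {n : nat}.
Variable d : 'rV[R]_n.
Let D := diag_mx d.
Local Notation M := 'M[R]_n.
Local Notation blk := (blk d).
Local Notation off := (off d).

(** The off-block entries of [Z] parametrise the conjugation and its blocks the block diagonal
    matrix, so a local inverse block diagonalises all matrices near [D]. *)
Definition block_param (Z : M) : M :=
  invmx (1%:M + off Z) *m blk Z *m (1%:M + off Z).

Let U := [set Z : M | 1%:M + off Z \in unitmx].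

Let offc : continuous off. Proof. exact: linear_mx_continuous. Qed.
Let blkc : continuous blk. Proof. exact: linear_mx_continuous. Qed.

Lemma open_unitmx : open [set X : M | X \in unitmx].
Proof.
have -> : [set X : M | X \in unitmx] = (fun X : M => \det X) @^-1` [set x | x != 0].
  by apply/seteqP; split => X /=; rewrite unitmxE unitfE.
apply: open_comp; last exact: open_neq.
move=> X _; have := @Ck_on_det R M n 0 setT id openT.
by apply => //; exact: Ck_on_id.
Qed.

Let Coff1 k U' : open U' -> Ck_on k U' (fun Z : M => 1%:M + off Z).
Proof.
by move=> oU; apply: Ck_onD => //; [exact: Ck_on_cst|exact: Ck_on_linear].
Qed.

Let oU : open U.
Proof.
apply: (@open_comp _ _ (fun Z : M => 1%:M + off Z) [set X : M | X \in unitmx]).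
  by move=> Z _; exact: (Coff1 0 openT).
exact: open_unitmx.
Qed.

Let offD : off D = 0.
Proof. by apply/eqP; rewrite subr_eq0; apply/eqP/esym/comm_blk. Qed.

Let blkD : blk D = D. Proof. exact/comm_blk. Qed.

Let UD : U D. Proof. by rewrite /U /= offD addr0 unitmx1. Qed.

Let Cparam : smooth_on U block_param.
Proof.
move=> k; apply: Ck_on_mulmx => //; last exact: Coff1.
apply: Ck_on_mulmx => //; last exact: Ck_on_linear.
by apply: Ck_on_invmx => //; exact: Coff1.
Qed.

Let block_paramE Z : U Z ->
  (1%:M + off Z) *m block_param Z = blk Z *m (1%:M + off Z).
Proof. by move=> UZ; rewrite /block_param !mulmxA mulmxV// mul1mx. Qed.

Let paramD (B : M) : comm_mx B D -> block_param B = B.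
Proof.
move=> /comm_blk E; have o0 : off B = 0 by apply/eqP; rewrite subr_eq0 E.
by rewrite /block_param o0 addr0 E invmx1 mul1mx mulmx1.
Qed.

(** Differentiating the identity [block_paramE] at [D] avoids the inverse matrix and gives
    [blk v = off v *m D - D *m off v]. The left side lives in the blocks; the right side lives
    outside, where it multiplies entries by nonzero differences of eigenvalues. *)
Let dparam_inj v : 'd block_param D v = 0 -> v = 0.
Proof.
move=> dv0.
have dP : differentiable block_param D by have [+ _] := Cparam 1; apply.
have d1 : differentiable (fun Z : M => 1%:M + off Z) D.
  by have [+ _] := Coff1 1 oU; apply.
have d2 : differentiable blk D by apply: linear_differentiable.
have [dL EL] := diff_mulmx d1 dP.
have [dR ER] := diff_mulmx d2 d1.
have nE : \forall Z \near D, (1%:M + off Z) *m block_param Z = blk Z *m (1%:M + off Z).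
  by apply: filterS block_paramE (open_nbhs_nbhs (conj oU UD)).
have [_ EE] := near_diff nE dL.
have E1 w : 'd (fun Z : M => 1%:M + off Z) D w = off w.
  exact: diff_affine.
have E2 w : 'd blk D w = blk w by exact: diff_linear.
have key : blk v + D *m off v = off v *m D.
  have K1 := congr1 (@^~ v) EL; have K2 := congr1 (@^~ v) ER.
  have L1 := congr2 (fun p q => (1%:M + off D) *m p + q *m block_param D) dv0 (E1 v).
  have L2 := congr2 (fun p q => blk D *m p + q *m (1%:M + off D)) (E1 v) (E2 v).
  have K : blk D *m off v + blk v *m (1%:M + off D) =
      (1%:M + off D) *m 0 + off v *m block_param D.
    exact: (etrans (esym L2) (etrans (esym K2) (etrans (congr1 (@^~ v) EE) (etrans K1 L1)))).
  have pD : block_param D = D by exact: paramD.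
  clear - K pD offD blkD.
  move: K; rewrite pD offD blkD addr0 mulmx1 mulmx0 add0r => <-.
  exact: addrC.
have key' : blk v = off v *m D - D *m off v by rewrite -key addrK.
apply/matrixP => i j; have := congr1 (fun X : M => X i j) key'.
rewrite comm_diagE !mxE; case: eqP => [_|/eqP dij]; first by rewrite subrr mulr0.
rewrite subr0 => /esym/eqP; rewrite mulf_eq0 subr_eq0 eq_sym (negbTE dij).
by move=> /eqP.
Qed.

(* Conjugation by [1 + off Z] turns [A] into a block diagonal [B] and [G] into a
   scalar product [N] for which [B] is self-adjoint. By Sylvester [N] is block
   diagonal, hence so is its square root near [1], by uniqueness of that root;
   conjugation by the latter makes [B] symmetric. *)
Theorem normal_form : exists (nf : M -> M -> M) (O : set (M * M)),
  [/\ open O, O (1%:M, D),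
   forall G A, O (G, A) -> G^T = G -> A *m G = G *m A^T ->
     [/\ (nf G A)^T = nf G A, comm_mx (nf G A) D &
       exists2 P, P \in unitmx & P *m A = nf G A *m P],
   forall B, O (1%:M, B) -> comm_mx B D -> nf 1%:M B = B &
   forall (V : normedModType R) (U' : set V) (gg hh : V -> M), open U' ->
     smooth_on U' gg -> smooth_on U' hh -> (forall z, U' z -> O (gg z, hh z)) ->
     smooth_on U' (fun z => nf (gg z) (hh z))].
Proof.
have [U0 [zeta [W [U0D UU0 [oU0 oW gK fK Cz]]]]] :=
  inverse_function oU Cparam UD dparam_inj.
have [U1 [rho [W1 [U11 [oU1 oW1 rK sK Cr]]]]] := @local_sqrt R n.
have DD : comm_mx D D by [].
have WD : W D by have [] := gK D U0D; rewrite paramD.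
have zD : zeta D = D by have [_] := gK D U0D; rewrite paramD.
have W11 : W1 1%:M by have [+ _] := rK 1%:M U11; rewrite mulmx1.
have r1 : rho 1%:M = 1%:M by have [_] := rK 1%:M U11; rewrite mulmx1.
pose X A := 1%:M + off (zeta A).
pose B A := blk (zeta A).
pose N (p : M * M) := X p.2 *m p.1 *m (X p.2)^T.
pose S p := rho (N p).
(* The shift makes [C] invertible with the same commutant as [D]. Commuting with [D] becomes
   invariance under conjugation by [C], which sends square roots to square roots. *)
pose c := 1 + `|d|.
pose C := D + c%:M.
have Cu : C \in unitmx.
  have -> : C = diag_mx (d + const_mx c) by rewrite linearD /= diag_const_mx.
  rewrite unitmxE det_diag unitfE; apply/prodf_neq0 => i _; rewrite !mxE.
  have := le_entry_norm d 0 i; rewrite ler_norml => /andP[H _].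
  by rewrite gt_eqF// /c; lra.
have CE Z : comm_mx Z C <-> comm_mx Z D.
  rewrite /comm_mx /C mulmxDr mulmxDl scalar_mxC.
  by split=> [/addIr|->].
pose F := nbhs ((1%:M : M), (D : M)).
have c1 : (fun p : M * M => p.1) @ F --> (1%:M : M) by exact: cvg_fst.
have c2 : (fun p : M * M => p.2) @ F --> (D : M) by exact: cvg_snd.
have cz : zeta p.2 @[p --> F] --> D.
  have := Cz 0 D WD => cz; rewrite /prop_for /continuous_at zD in cz.
  by apply: cvg_comp c2 cz.
have cB : B p.2 @[p --> F] --> blk D by apply: cvg_linear_mx.
rewrite blkD in cB.
have cX : X p.2 @[p --> F] --> (1%:M : M) + off D.
  by apply: cvgD; [exact: cvg_cst|apply: cvg_linear_mx].
rewrite offD addr0 in cX.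
have cN : N p @[p --> F] --> (1%:M : M) *m 1%:M *m 1%:M^T.
  by apply: cvg_mulmx; [exact: cvg_mulmx|exact: cvg_linear_mx].
rewrite trmx1 !mulmx1 in cN.
have cS : S p @[p --> F] --> (1%:M : M).
  have := Cr 0 1%:M W11 => cr; rewrite /prop_for /continuous_at r1 in cr.
  by apply: cvg_comp cN cr.
have nearo (T : topologicalType) (u : M * M -> T) (l : T) (Q : set T) :
    u p @[p --> F] --> l -> open Q -> Q l -> \forall p \near F, Q (u p).
  by move=> ul oQ Ql; apply: ul; exact: open_nbhs_nbhs.
(* The transpose and the conjugate of the root must also lie in [U1], so that uniqueness identifies
   them with the root. *)
pose good (p : M * M) := [/\ W p.2, W1 (N p), S p \in unitmx,
  U1 (S p)^T /\ U1 (C *m S p *m invmx C) &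
  U0 p.2 /\ separated_blocks d (B p.2)].
have ngood : \forall p \near F, good p.
  have n1 := nearo _ _ _ _ c2 oW WD.
  have n2 := nearo _ _ _ _ cN oW1 W11.
  have n3 := nearo _ _ _ _ cS open_unitmx (unitmx1 _ _).
  have n4 : \forall p \near F, U1 (S p)^T.
    have c4 : (S p)^T @[p --> F] --> (1%:M : M)^T by exact: cvg_linear_mx.
    rewrite trmx1 in c4.
    exact: nearo _ _ _ _ c4 oU1 U11.
  have n5 : \forall p \near F, U1 (C *m S p *m invmx C).
    have c5 : (C *m S p *m invmx C) @[p --> F] --> C *m 1%:M *m invmx C.
      exact: (cvg_mulmx (cvg_mulmx (cvg_cst C) cS) (cvg_cst (invmx C))).
    rewrite mulmx1 mulmxV// in c5.
    exact: nearo _ _ _ _ c5 oU1 U11.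
  have n6 := nearo _ _ _ _ c2 oU0 U0D.
  have n7 : \forall p \near F, separated_blocks d (B p.2) by exact: near_separated cB.
  near=> p; split; [near: p|near: p|near: p|split; near: p|split; near: p] => //.
have [Q oQ QP] : exists2 Q, open_nbhs ((1%:M : M), (D : M)) Q & Q `<=` good.
  by move: ngood; rewrite /F nbhsE.
have [oQ1 oQ2] := oQ.
exists (fun G A => invmx (S (G, A)) *m B A *m S (G, A)), Q; split => //.
- move=> G A /QP[/= WA W1N Su [U1St U1C] [_ small]] Gs AG.
  have [U0z zE] := fK A WA.
  have Xu : X A \in unitmx by apply: UU0.
  have XA : X A *m A = B A *m X A by rewrite -{2}zE; apply: block_paramE; apply: UU0.
  have BD : comm_mx (B A) D by exact: comm_mx_blk.
  set s := S (G, A) in Su U1St U1C *; set Np := N (G, A).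
  have [U1s ss] : U1 s /\ s *m s = Np by exact: sK.
  have NE : Np = X A *m G *m (X A)^T by [].
  have Ns : Np^T = Np by rewrite NE !trmx_mul trmxK Gs mulmxA.
  have BN : B A *m Np = Np *m (B A)^T.
    rewrite NE !mulmxA -XA -(mulmxA (X A)) AG !mulmxA.
    by rewrite -(mulmxA _ (X A)^T) -trmx_mul -XA trmx_mul !mulmxA.
  have ND : comm_mx Np D.
    exact: (sylvester_comm BD small BN).
  have uniq Y : U1 Y -> Y *m Y = Np -> Y = s.
    move=> U1Y YY; rewrite -(proj2 (rK Y U1Y)) YY -ss.
    exact: (proj2 (rK s U1s)).
  have sT : s^T = s by apply: uniq => //; rewrite -trmx_mul ss.
  have sC : C *m s *m invmx C = s.
    apply: uniq => //; rewrite !mulmxA mulmxKV// -(mulmxA C) ss.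
    by have /CE <- := ND; rewrite mulmxK.
  have sD : comm_mx s D.
    by apply/CE; rewrite /comm_mx -{1}sC mulmxKV.
  split.
  (* With [N = s s], the relation [B N = N B^T] multiplied by [invmx s] on both sides is the
     symmetry of [invmx s B s]. *)
  + rewrite !trmx_mul trmx_inv sT.
    have E1 : invmx s *m (B A *m Np) *m invmx s = invmx s *m B A *m s.
      by rewrite -ss !mulmxA mulmxK.
    have E2 : invmx s *m (Np *m (B A)^T) *m invmx s = s *m (B A)^T *m invmx s.
      by rewrite -ss !mulmxA mulVmx// mul1mx.
    by rewrite mulmxA -E2 -BN E1.
  + have sVD : comm_mx (invmx s) D.
      apply: (can_inj (mulKmx Su)); apply: (can_inj (mulmxK Su)).
      by rewrite /= !mulmxA mulmxV// mul1mx -!mulmxA mulVmx// mulmx1 sD.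
    rewrite /comm_mx -!mulmxA sD (mulmxA (B A)) BD !mulmxA.
    by rewrite sVD.
  + exists (invmx s *m X A); first by rewrite unitmx_mul unitmx_inv Su.
    by rewrite -(mulmxA (invmx s) (X A) A) XA !mulmxA mulmxK.
- move=> Bb /QP[/= _ _ _ _ [U0B _]] BD.
  have zB : zeta Bb = Bb by have [_] := gK Bb U0B; rewrite paramD.
  have oB : off Bb = 0 by apply/eqP; rewrite subr_eq0; apply/eqP/esym/comm_blk.
  have BB : B Bb = Bb by rewrite /B zB; exact/comm_blk.
  rewrite BB /S /N /X /= zB oB addr0 trmx1 !mulmx1 r1.
  by rewrite invmx1 mul1mx mulmx1.
- move=> V U' gg hh oU' Cg Ch HO k.
  have HG z (U'z : U' z) := QP _ (HO z U'z).
  have Cz' : Ck_on k U' (fun z => zeta (hh z)).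
    by apply: (Ck_on_comp oU' oW _ (Ch k) (Cz k)) => z /HG[].
  have CX : Ck_on k U' (fun z => X (hh z)).
    by apply: Ck_onD => //; [exact: Ck_on_cst|apply: Ck_on_linear_comp].
  have CN : Ck_on k U' (fun z => N (gg z, hh z)).
    by apply: Ck_on_mulmx => //; [exact: Ck_on_mulmx|exact: Ck_on_tr].
  have CS : Ck_on k U' (fun z => S (gg z, hh z)).
    by apply: (Ck_on_comp oU' oW1 _ CN (Cr k)) => z /HG[].
  apply: Ck_on_mulmx => //; apply: Ck_on_mulmx => //.
    by apply: Ck_on_invmx => // z /HG[].
  exact: (Ck_on_linear_comp oU' blkc Cz').
Unshelve. all: by end_near. Qed.

End NormalFormExists.

(** * Eigenvalues of symmetric block diagonal matrices near [D] *)

Section SeparatedBlocks.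
Context {R : realType} {n : nat}.
Local Notation M := 'M[R]_n.

Lemma symmetric_diagonal (S : M) : S^T = S ->
  exists (P : M) (s : 'rV[R]_n), P \in unitmx /\ P *m S = diag_mx s *m P.
Proof.
move=> Ss; have [u u0||P [s [PP PS]]] := @spectral_pair R n 1%:M S (trmx1 _ _).
- rewrite mulmx1; have [i ui] : exists i, u 0 i != 0.
    apply/existsP; apply: contraNT u0 => /existsPn H.
    by apply/eqP/rowP => i; rewrite mxE; apply/eqP/negPn.
  rewrite mxE (bigD1 i)//= ltr_wpDr// ?sumr_ge0// => [j _|].
    by rewrite mxE -expr2 sqr_ge0.
  by rewrite mxE -expr2 exprn_even_gt0.
- by rewrite mulmx1 mul1mx Ss.
exists P, s; split => //.
by move: PP; rewrite mulmx1 => /mulmx1_unit[].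
Qed.

Variable d : 'rV[R]_n.
Let D := diag_mx d.

(** Commuting diagonalisable matrices have a common eigenbasis; in it the eigenvalues [e] of [D] may
    come in another order than [d]. *)
Lemma symmetric_codiagonal (S : M) : S^T = S -> comm_mx S D ->
  exists (P : M) (s e : 'rV[R]_n),
    [/\ P \in unitmx, P *m S = diag_mx s *m P & P *m D = diag_mx e *m P].
Proof.
move=> Ss SD.
have dg (A : M) : A^T = A -> exists2 P : M, P \in unitmx & mxpoly.diagonalizable_for P A.
  move=> As; have [P [s [Pu PA]]] := symmetric_diagonal As.
  exists P => //; apply/mxpoly.diagonalizable_forPex; exists s.
  exact/mxpoly.simmxP.
have [|P Pu /and3P[/mxpoly.diagonalizable_forPex[s sP] /mxpoly.diagonalizable_forPex[e eP] _]] :=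
  (@mxpoly.codiagonalizableP R n [:: S; D]).1.
  split=> [A B|A]; rewrite !inE.
    by move=> /orP[/eqP ->|/eqP ->] /orP[/eqP ->|/eqP ->] //; exact: esym.
  by move=> /orP[/eqP ->|/eqP ->]; apply: dg => //; rewrite tr_diag_mx.
exists P, s, e; split => //; exact/mxpoly.simmxP.
Qed.

(** Row [a] of [P] is a common eigenvector [u], and [u (S - D)] is a multiple of [u] by the
    difference of the two eigenvalues; the sup norm bounds it for any invertible [P]. *)
Lemma codiagonal_entry (P S : M) (s e : 'rV[R]_n) a :
  P \in unitmx -> P *m S = diag_mx s *m P -> P *m D = diag_mx e *m P ->
  exists2 i, e 0 a = d 0 i & `|s 0 a - e 0 a| <= n%:R * `|S - D|.
Proof.
move=> Pu PS PD.
have [k Pak] : exists k, P a k != 0.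
  case: (boolP [exists k, P a k != 0]) => [/existsP//|/existsPn H].
  have r0 : row a P = 0 by apply/rowP => k; rewrite !mxE; apply/eqP/negPn.
  have Pf : row_free P by rewrite row_free_unit.
  have : (delta_mx 0 a : 'rV[R]_n) = 0.
    by apply: (row_free_inj Pf); rewrite -rowE r0 mul0mx.
  by move=> /matrixP/(_ 0 a)/eqP; rewrite !mxE !eqxx /= oner_eq0.
have PDak (i : 'I_n) : P a i * d 0 i = e 0 a * P a i.
  by have /matrixP/(_ a i) := PD; rewrite mul_mx_diag mul_diag_mx !mxE.
exists k; first by apply: (mulIf Pak); rewrite -PDak mulrC.
pose u := row a P.
have u_gt0 : 0 < `|u|.
  rewrite normr_gt0; apply: contra_neq Pak => u0.
  by have /rowP/(_ k) := u0; rewrite !mxE.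
have uE : u *m (S - D) = (s 0 a - e 0 a) *: u.
  rewrite /u -row_mul mulmxBr PS PD; apply/rowP => j.
  by rewrite !mul_diag_mx !mxE mulrBl.
rewrite -(ler_pM2r u_gt0) -normrZ -uE.
apply: mx_norm_le => [|i j]; first by rewrite !mulr_ge0.
rewrite mxE; apply: (le_trans (ler_norm_sum _ _ _)).
rewrite -mulrA -[X in X%:R * _]card_ord -sum1_card natr_sum mulr_suml.
apply: ler_sum => l _; rewrite mul1r normrM mulrC.
by rewrite ler_pM// le_entry_norm.
Qed.

(** Each eigenvalue moves by at most [n] times the norm of [S - D], and gaps between blocks exceed
    twice that. *)
Lemma codiagonal_lt (P S : M) (s e : 'rV[R]_n) a b :
  P \in unitmx -> P *m S = diag_mx s *m P -> P *m D = diag_mx e *m P ->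
  separated_blocks d S -> e 0 a < e 0 b -> s 0 a < s 0 b.
Proof.
move=> Pu PS PD sep.
have [i ei si] := codiagonal_entry a Pu PS PD.
have [j ej sj] := codiagonal_entry b Pu PS PD => eab.
have := sep i j; rewrite -ei -ej (lt_eqF eab) => /(_ isT).
rewrite (distrC (e 0 a)) (gtr0_norm (_ : 0 < e 0 b - e 0 a)) ?subr_gt0//.
move: si sj; rewrite !ler_norml => /andP[_ si] /andP[sj _].
by rewrite -mulrA; lra.
Qed.

(** The entry of [P] at [a], [i] vanishes unless [e 0 a = d 0 i], so [P] also diagonalises every
    function of [D]. *)
Lemma codiagonal_fun (P : M) (e m me : 'rV[R]_n) :
  P *m D = diag_mx e *m P ->
  (forall a i, e 0 a = d 0 i -> me 0 a = m 0 i) ->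
  P *m diag_mx m = diag_mx me *m P.
Proof.
move=> PD H; apply/matrixP => a i; rewrite mul_mx_diag mul_diag_mx !mxE.
have /matrixP/(_ a i) := PD; rewrite mul_mx_diag mul_diag_mx !mxE => /eqP.
rewrite mulrC -subr_eq0 -mulrBl mulf_eq0 subr_eq0 => /orP[/eqP E|/eqP ->].
  by rewrite (H a i) 1?mulrC.
by rewrite mul0r mulr0.
Qed.

(* The hypothesis on [m] makes [diag_mx m] a function of [D], so [S] and [S'] are
   diagonal in the same basis. *)
Lemma mult_cone (S S' : M) (t : R) (m : 'rV[R]_n) k :
  S^T = S -> comm_mx S D -> separated_blocks d S -> separated_blocks d S' -> 0 < t ->
  S' = t *: S + diag_mx m -> (forall i j, d 0 i = d 0 j -> m 0 i = m 0 j) ->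
  has_multiplicities S k -> has_multiplicities S' k.
Proof.
move=> Ss SD sep sep' t0 S'E mE.
have [P [s [e [Pu PS PD]]]] := symmetric_codiagonal Ss SD.
pose me : 'rV[R]_n := \row_a (if [pick i | d 0 i == e 0 a] is Some i then m 0 i else 0).
have meE a i : e 0 a = d 0 i -> me 0 a = m 0 i.
  move=> eai; rewrite mxE eai; case: pickP => [j /eqP|/(_ i)]; last by rewrite eqxx.
  exact: mE.
have Pm := codiagonal_fun PD meE.
pose s' := t *: s + me.
have PS' : P *m S' = diag_mx s' *m P.
  by rewrite S'E mulmxDr -scalemxAr PS Pm /s' linearP /= mulmxDl -scalemxAl.
rewrite (has_multiplicities_diag k Pu PS) (has_multiplicities_diag k Pu PS').
apply: mult_of_order => a b.
(* Across blocks the order is that of [e] for both matrices; within a block the eigenvalues undergo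
   one increasing affine map. *)
have [eab|eab|eab] := ltgtP (e 0 a) (e 0 b).
- by rewrite (codiagonal_lt Pu PS PD sep eab) (codiagonal_lt Pu PS' PD sep' eab).
- have l1 := codiagonal_lt Pu PS PD sep eab.
  have l2 := codiagonal_lt Pu PS' PD sep' eab.
  by rewrite (lt_gtF l1) (lt_gtF l2).
- have [i ei _] := codiagonal_entry a Pu PS PD.
  have s'E c : s' 0 c = t * s 0 c + me 0 c by rewrite [LHS]mxE [X in X + _]mxE.
  by rewrite !s'E (meE a i ei) (meE b i) -?eab// ltrD2r ltr_pM2l.
Qed.

Lemma has_multiplicities_diagE (m : 'rV[R]_n) k :
  has_multiplicities (diag_mx m) k <-> mult_of m k.
Proof. by apply: (has_multiplicities_diag k (unitmx1 _ _)); rewrite mul1mx mulmx1. Qed.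

(* [D] has the fewest eigenvalues among the separated matrices, and when [S] has
   the same multiplicities as [D] each block of [S] is scalar. *)
Lemma mult_rigid (S : M) k : S^T = S -> comm_mx S D -> separated_blocks d S ->
  has_multiplicities S k -> mult_of d k ->
  exists2 m : 'rV[R]_n, S = diag_mx m & forall i j, d 0 i = d 0 j -> m 0 i = m 0 j.
Proof.
move=> Ss SD sep.
have [P [s [e [Pu PS PD]]]] := symmetric_codiagonal Ss SD.
rewrite (has_multiplicities_diag k Pu PS) => sk /has_multiplicities_diagE.
rewrite (has_multiplicities_diag k Pu PD) => ek.
have se a b : s 0 a = s 0 b -> e 0 a = e 0 b.
  move=> sab; apply: le_anti; rewrite !leNgt; apply/andP; split; apply/negP => eab.
    by have := codiagonal_lt Pu PS PD sep eab; rewrite sab ltxx.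
  by have := codiagonal_lt Pu PS PD sep eab; rewrite sab ltxx.
(* Both lists of distinct values have the length of [k], and [g] maps the values of [s] onto those
   of [e], hence injectively. *)
have es a b : e 0 a = e 0 b -> s 0 a = s 0 b.
  case: sk => ss [ss1 ss2 ssk]; case: ek => es [es1 es2 esk].
  pose g x := if [pick a | s 0 a == x] is Some a then e 0 a else 0.
  have gE c : g (s 0 c) = e 0 c.
    rewrite /g; case: pickP => [c' /eqP|/(_ c)]; last by rewrite eqxx.
    exact: se.
  have sz : size es = size ss.
    by rewrite -(size_map (fun x => #|diag_class e x|)) esk -ssk size_map.
  have ues : uniq es by move: es1; rewrite lt_sorted_uniq_le => /andP[].
  have sub : {subset es <= map g ss}.
    move=> x; rewrite es2 => /existsP[c /eqP <-]; rewrite -gE map_f// ss2.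
    by apply/existsP; exists c.
  have ug : uniq (map g ss) by apply: (leq_size_uniq ues sub); rewrite size_map sz.
  have ing c : s 0 c \in ss by rewrite ss2; apply/existsP; exists c.
  rewrite -!gE => gab.
  have ia := nth_index (0 : R) (ing a); have ib := nth_index (0 : R) (ing b).
  have : index (s 0 a) ss = index (s 0 b) ss.
    apply/eqP; rewrite -(nth_uniq (0 : R) _ _ ug) ?size_map ?index_mem ?ing//.
    by rewrite !(nth_map (0 : R)) ?index_mem ?ing// ia ib gab.
  by move=> ab; rewrite -ia -ib ab.
pose m : 'rV[R]_n := \row_i (if [pick a | e 0 a == d 0 i] is Some a then s 0 a else 0).
have mE a i : e 0 a = d 0 i -> s 0 a = m 0 i.
  move=> eai; rewrite mxE; case: pickP => [b /eqP|/(_ a)]; last by rewrite eai eqxx.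
  by rewrite -eai => /es.
exists m.
  by apply: (can_inj (mulKmx Pu)); rewrite PS (codiagonal_fun PD mE).
by move=> i j dij; rewrite !mxE dij.
Qed.

End SeparatedBlocks.

(** * Linear coordinates transverse to a stratum *)

Section Coordinates.
Context {R : realType} {n : nat}.
Local Notation M := 'M[R]_n.
Variable d : 'rV[R]_n.
Let D := diag_mx d.
Local Notation J := (block_coords d).
Local Notation rep := (class_rep d).

Definition block_coord (S : M) (p : 'I_n * 'I_n) : R :=
  S p.1 p.2 - (if p.1 == p.2 then S (rep p.1) (rep p.1) else 0).

Definition block_vec (S : M) : 'rV[R]_#|J| := \row_q block_coord S (enum_val q).

Lemma block_vec_is_linear : linear block_vec.
Proof.
move=> a S T; apply/rowP => q; rewrite !mxE /block_coord; case: ifP => _; rewrite !mxE; ring.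
Qed.

HB.instance Definition _ := GRing.isLinear.Build R M 'rV[R]_#|J| _ block_vec
  block_vec_is_linear.

Lemma block_vec_eq0 (S : M) : S^T = S -> comm_mx S D -> block_vec S = 0 ->
  exists2 m : 'rV[R]_n, S = diag_mx m & forall i j, d 0 i = d 0 j -> m 0 i = m 0 j.
Proof.
move=> Ss /comm_blk SE S0.
have SJ p : p \in J -> block_coord S p = 0.
  by move=> pJ; have /rowP/(_ (enum_rank_in pJ p)) := S0; rewrite !mxE enum_rankK_in.
have Slt i j : d 0 i = d 0 j -> (i < j)%N -> S i j = 0.
  move=> dij ij; have := SJ (i, j); rewrite inE /= dij eqxx ij => /(_ isT).
  by rewrite /block_coord /= -val_eqE /= (ltn_eqF ij) subr0.
have Sne i j : i != j -> S i j = 0.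
  move=> ij; have [dij|/eqP dij] := eqVneq (d 0 i) (d 0 j); last first.
    by rewrite -SE mxE; case: eqP.
  move: (ij); rewrite neq_ltn => /orP[lij|lji]; first exact: Slt.
  by rewrite -Ss mxE; exact: Slt.
have Sd i : S i i = S (rep i) (rep i).
  have [->//|ri] := eqVneq (rep i) i.
  have := SJ (i, i); rewrite inE /= !eqxx ri orbT => /(_ isT).
  by rewrite /block_coord /= eqxx => /eqP; rewrite subr_eq0 => /eqP.
exists (\row_i S i i).
  by apply/matrixP => i j; rewrite !mxE; have [->|/Sne] := eqVneq i j.
by move=> i j dij; rewrite !mxE Sd (Sd j) (class_rep_eq dij).
Qed.

Lemma block_vec_diag (m : 'rV[R]_n) : (forall i j, d 0 i = d 0 j -> m 0 i = m 0 j) ->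
  block_vec (diag_mx m) = 0.
Proof.
move=> mE; apply/rowP => q; rewrite !mxE /block_coord !mxE.
have [E|_] := eqVneq; last by rewrite mulr0n subr0.
by rewrite E eqxx !mulr1n (mE _ _ (class_rep_class d _)) subrr.
Qed.

Lemma block_vec_surj (x : 'rV[R]_#|J|) : (0 < n)%N ->
  exists S : M, [/\ S^T = S, comm_mx S D, \tr S = 0 & block_vec S = x].
Proof.
move=> n0.
(* Extends [x] by 0 from [block_coords d] to all pairs. *)
pose xi (p : 'I_n * 'I_n) : R := \sum_(q | enum_val q == p) x 0 q.
have xiE q : xi (enum_val q) = x 0 q.
  by rewrite /xi (big_pred1 q) // => q'; rewrite (inj_eq enum_val_inj).
pose T : M := \matrix_(i, j) (if i == j then (if rep i == i then 0 else xi (i, i))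
  else if d 0 i == d 0 j then (if (i < j)%N then xi (i, j) else xi (j, i)) else 0).
(* Removing the trace by a scalar matrix leaves [block_vec] unchanged. *)
pose S := T - (\tr T / n%:R)%:M.
have Ts : T^T = T.
  apply/matrixP => i j; rewrite !mxE (eq_sym j i); have [->//|ij] := eqVneq i j.
  rewrite (eq_sym (d 0 j)); case: eqP => // _.
  by move: ij; rewrite neq_ltn => /orP[lij|lij]; rewrite lij ltnNge (ltnW lij).
have TD : comm_mx T D.
  by apply/comm_blk/matrixP => i j; rewrite !mxE; case: eqP => // dij; case: eqP dij => [->|].
have bT : block_vec T = x.
  apply/rowP => q; rewrite !mxE -xiE /block_coord !mxE.
  have := enum_valP q; set p := enum_val q; rewrite inE => /andP[dp].
  have [pE|pE] := eqVneq p.1 p.2.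
    rewrite pE ltnn eqxx /= => rp; rewrite (negbTE rp).
    rewrite (class_rep_eq (class_rep_class d p.2)) eqxx subr0.
    by rewrite [p]surjective_pairing /= pE.
  by rewrite /= orbF => plt; rewrite dp plt subr0 [p]surjective_pairing.
exists S; split.
- by rewrite /S raddfB /= Ts tr_scalar_mx.
- by rewrite /comm_mx /S mulmxBl mulmxBr TD scalar_mxC.
- rewrite /S raddfB /= mxtrace_scalar -[X in _ - X]mulr_natr divfK ?subrr//.
  by rewrite pnatr_eq0 -lt0n.
- rewrite /S linearB /= bT -diag_const_mx block_vec_diag ?subr0// => i j _.
  by rewrite !mxE.
Qed.

(** Proportional coordinates mean that [S' - t *: S] is scalar on each block, the situation of
    [mult_cone]. *)
Lemma block_vec_same_mult (S S' : M) (t : R) k :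
  S^T = S -> S'^T = S' -> comm_mx S D -> comm_mx S' D ->
  separated_blocks d S -> separated_blocks d S' -> 0 < t -> block_vec S' = t *: block_vec S ->
  has_multiplicities S k -> has_multiplicities S' k.
Proof.
move=> Ss S's SD S'D sep sep' t0 bE.
have [|||m mE mc] := @block_vec_eq0 (S' - t *: S).
- by rewrite linearB linearZ /= Ss S's.
- by rewrite /comm_mx mulmxBl mulmxBr S'D -scalemxAl -scalemxAr SD.
- by rewrite linearB linearZ /= bE subrr.
by apply: (mult_cone Ss SD sep sep' t0 _ mc); rewrite -mE addrC subrK.
Qed.

Lemma block_vec_strata (S : M) k : S^T = S -> comm_mx S D -> separated_blocks d S ->
  mult_of d k -> (has_multiplicities S k <-> block_vec S = 0).
Proof.
move=> Ss SD sep dk; split=> [Sk|S0].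
  have [m -> mc] := mult_rigid Ss SD sep Sk dk.
  exact: block_vec_diag.
apply: (@block_vec_same_mult D S 1) => //.
- exact: tr_diag_mx.
- exact: separatedD.
- by rewrite S0 /D block_vec_diag ?scaler0.
- exact/has_multiplicities_diagE.
Qed.

(* Inside a degenerate [D], perturbing each block by a diagonal matrix whose
   entries have a single coincidence leads to the codimension two stratum. *)
Lemma codim2_direction (a b : 'I_n) : a != b -> d 0 a = d 0 b ->
  exists x : 'rV[R]_#|J|, forall (S : M) (t : R), S^T = S -> comm_mx S D ->
    separated_blocks d S -> 0 < t -> block_vec S = t *: x ->
    exists k, [/\ has_multiplicities S k, codim k = 2 & (size k < n)%N].
Proof.
move=> ab dab.
(* The entries are the indices themselves, except that [b] receives the value of [a]: a single
   coincidence. *)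
pose th : 'rV[R]_n := \row_i (if i == b then a else i)%:R.
have thE i j : th 0 i = th 0 j -> i != j -> (i = a /\ j = b) \/ (i = b /\ j = a).
  rewrite !mxE => /eqP; rewrite eqr_nat => /eqP E ij.
  move: E ij; have [->|ib] := eqVneq i b; have [->|jb] := eqVneq j b.
  - by [].
  - by move=> /val_inj <-; right.
  - by move=> /val_inj ->; left.
  - by move=> /val_inj ->; rewrite eqxx.
exists (block_vec (diag_mx th)) => S t Ss SD sep t0 bE.
have [|||m mE mc] := @block_vec_eq0 (S - t *: diag_mx th).
- by rewrite linearB linearZ /= Ss tr_diag_mx.
- rewrite /comm_mx mulmxBl mulmxBr SD -scalemxAl -scalemxAr.
  by rewrite (diag_mx_comm th d).
- by rewrite linearB linearZ /= bE subrr.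
pose s := t *: th + m.
have SE : S = diag_mx s.
  by rewrite /s linearD linearZ /= -mE addrC subrK.
have P1 : (1%:M : M) *m S = diag_mx s *m 1%:M by rewrite mul1mx mulmx1 SE.
have P2 : (1%:M : M) *m D = diag_mx d *m 1%:M by rewrite mul1mx mulmx1.
have u1 := unitmx1 R n.
(* By separation, entries of [s] coincide only within a block, where [s] is an affine image of
   [th]. *)
have sd i j : s 0 i = s 0 j -> d 0 i = d 0 j.
  move=> sij; apply: le_anti; rewrite !leNgt; apply/andP; split; apply/negP => dij.
    by have := codiagonal_lt u1 P1 P2 sep dij; rewrite sij ltxx.
  by have := codiagonal_lt u1 P1 P2 sep dij; rewrite sij ltxx.
have sE i : s 0 i = t * th 0 i + m 0 i by rewrite [LHS]mxE [X in X + _]mxE.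
have sab : s 0 a = s 0 b.
  rewrite !sE (mc _ _ dab); congr (t * _ + _).
  by rewrite !mxE eqxx (negbTE ab).
have [k sk] := mult_of_exists s.
have [|c2 kn] := codim_one_coincidence sk ab sab.
  move=> i j sij ij; apply: thE => //.
  move: (sij); rewrite !sE (mc _ _ (sd _ _ sij)) => /addIr.
  by apply: mulfI; rewrite gt_eqF.
by exists k; split => //; rewrite SE; exact/has_multiplicities_diagE.
Qed.

End Coordinates.

(** * Whitney conditions for conical strata *)

Section Straighten.
Context {R : realType}.

(** With the rank factorisation [A = L *m pid_mx k *m B] of the differential, [Theta] puts [F] times
    [invmx B] in the first [k] coordinates and completes it by the linear map [L - L *m p *m q]; its
    differential at [x0] is then the invertible [L]. *)
Lemma straighten n k (F : 'rV[R]_n -> 'rV[R]_k) U x0 :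
  open U -> smooth_on U F -> U x0 -> (forall w, exists v, 'd F x0 v = w) ->
  (k <= n)%N /\ exists (E : 'M[R]_k) (Theta : 'rV[R]_n -> 'rV[R]_n) U0 Psi W,
    [/\ E \in unitmx, U0 x0 /\ U0 `<=` U, local_inverse Theta U0 Psi W,
        smooth_on U0 Theta & forall x, Theta x *m pid_mx k = F x *m E].
Proof.
move=> oU CF Ux0 surj.
pose A := lin1_mx ('d F x0).
have AE v : v *m A = 'd F x0 v by exact: mul_rV_lin1.
have Afull : row_full A.
  apply/row_fullP; pose v i := sval (cid (surj (delta_mx 0 i))).
  exists (\matrix_i v i); apply/row_matrixP => i.
  by rewrite row_mul rowK AE row1 /v; case: cid.
have rA : \rank A = k by exact/eqP.
have kn : (k <= n)%N by rewrite -rA rank_leq_row.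
split=> //.
pose L := col_ebase A; pose B := row_ebase A.
have Lu : L \in unitmx by exact: col_ebase_unit.
have Bu : B \in unitmx by exact: row_ebase_unit.
have AD : L *m pid_mx k *m B = A by have := mulmx_ebase A; rewrite rA.
pose p : 'M[R]_(n, k) := pid_mx k; pose q : 'M[R]_(k, n) := pid_mx k.
have qp : q *m p = 1%:M by rewrite mul_pid_mx minnn (minn_idPr kn) pid_mx_1.
pose L1 : {linear 'rV[R]_n -> 'rV[R]_n} := mulmxr (L - L *m p *m q).
pose L2 : {linear 'rV[R]_k -> 'rV[R]_n} := mulmxr (invmx B *m q).
pose Theta x := L1 x + L2 (F x).
have L1c : continuous L1 by exact: linear_mx_continuous.
have L2c : continuous L2 by exact: linear_mx_continuous.
have CT : smooth_on U Theta.
  move=> j; apply: Ck_onD => //; first exact: Ck_on_linear.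
  exact: Ck_on_linear_comp.
have dF : differentiable F x0 by have [+ _] := CF 1; exact.
have dT v : 'd Theta x0 v = v *m L.
  have d1 := linear_differentiable x0 L1c.
  have d2 := linear_differentiable (F x0) L2c.
  have d3 := differentiable_comp dF d2.
  have E1 := congr1 (@^~ v) (diffD d1 d3).
  have E2 := diff_linear x0 v L1c.
  have E3 := etrans (congr1 (@^~ v) (diff_comp dF d2)) (diff_linear (F x0) ('d F x0 v) L2c).
  apply: (etrans E1); apply: (etrans (congr2 (fun a b => a + b) E2 E3)).
  rewrite -AE /L1 /L2 /= -AD mulmxBr !mulmxA mulmxK// subrK//.
have inj v : 'd Theta x0 v = 0 -> v = 0.
  by move=> E; apply: (can_inj (mulmxK Lu)); rewrite mul0mx -dT.
have [U0 [Psi [W [U0x0 UU0 H]]]] := inverse_function oU CT Ux0 inj.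
exists (invmx B), Theta, U0, Psi, W; split => //.
- by rewrite unitmx_inv.
- exact: smooth_on_sub UU0 CT.
- have e1 : (L - L *m p *m q) *m p = 0 by rewrite mulmxBl -(mulmxA (L *m p)) qp mulmx1 subrr.
  move=> x; rewrite /Theta /L1 /L2 /= mulmxDl -(mulmxA x) e1 mulmx0 add0r.
  by rewrite -!mulmxA qp mulmx1.
Qed.

End Straighten.

Section TangentKernel.
Context {R : realType}.

(** Along a curve in [N] the function [f] vanishes near time 0: equations of a set become
    constraints on its velocities. *)
Lemma tangent_ker (V W : normedModType R) (N U : set V) (f : V -> W) x v :
  open U -> U x -> differentiable f x -> (forall z, U z -> N z -> f z = 0) ->
  tangent N x v -> 'd f x v = 0.
Proof.
move=> oU Ux df f0 [gam [e [e0 Cg gN g0 gv]]].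
have dfg : differentiable f (gam 0) by rewrite g0.
have D1 := is_derive_curve gv dfg.
have gc : {for 0, continuous gam}.
  by apply: differentiable_continuous; apply/derivable1_diffP; case: gv.
have nU : \forall t \near (0 : R), U (gam t).
  by apply: gc; rewrite g0; exact: open_nbhs_nbhs.
have nE : \forall t \near (0 : R), t \in `]- e, e[.
  have : nbhs (0 : R) `]- e, e[%classic.
    by apply: open_nbhs_nbhs; split; [exact: interval_open|rewrite /= in_itv /= oppr_lt0 e0].
  exact.
have nz : \forall t \near (0 : R), (f \o gam) t = cst 0 t.
  by apply: filterS2 nU nE => t Ut te; exact: (f0 _ Ut (gN t te)).
have E1 := @derive_val _ _ _ _ _ _ _ D1.
have E2 := near_eq_derive (1 : R) nz.
have E3 := etrans (esym E1) (etrans E2 (derive_cst _ _ _)).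
by rewrite -g0; exact: E3.
Qed.

End TangentKernel.

Section FlatModel.
Context {R : realType} {n k : nat}.
Local Notation V := 'rV[R]_n.
Variables (Theta Psi : V -> V) (U0 W : set V).
Hypotheses (LI : local_inverse Theta U0 Psi W) (CT : smooth_on U0 Theta).
Let oU0 : open U0. Proof. by case: LI. Qed.
Let oW : open W. Proof. by case: LI. Qed.
Let TK x : U0 x -> W (Theta x) /\ Psi (Theta x) = x.
Proof. by case: LI => _ _ H _ _; exact: H. Qed.
Let OK y : W y -> U0 (Psi y) /\ Theta (Psi y) = y.
Proof. by case: LI => _ _ _ H _; exact: H. Qed.
Let CO : smooth_on W Psi. Proof. by case: LI. Qed.
Let dT x : U0 x -> differentiable Theta x.
Proof. by have [+ _] := CT 1; exact. Qed.
Let dO y : W y -> differentiable Psi y.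
Proof. by have [+ _] := CO 1; exact. Qed.

Let p : 'M[R]_(n, k) := pid_mx k.
Let f x := Theta x *m p.

Lemma flat_diffK x v : U0 x -> 'd Psi (Theta x) ('d Theta x v) = v.
Proof.
move=> Ux; have [WT _] := TK Ux; apply: diff_cancel; [exact: dT|exact: dO|].
by apply: filterS (open_nbhs_nbhs (conj oU0 Ux)) => z /TK[].
Qed.

Lemma flat_diffVK x w : U0 x -> 'd Theta x ('d Psi (Theta x) w) = w.
Proof.
move=> Ux; have [WT OT] := TK Ux.
have dTO : differentiable Theta (Psi (Theta x)) by rewrite OT; exact: dT.
have H : \forall z \near Theta x, Theta (Psi z) = z.
  by apply: filterS (open_nbhs_nbhs (conj oW WT)) => z /OK[].
by have := diff_cancel (dO WT) dTO H w; rewrite OT.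
Qed.

(** [t = 1] is included: [X] is also invariant under motions that fix the transverse coordinates
    [f]. *)
Definition conic (X : set V) : Prop := forall x x' t,
  U0 x -> U0 x' -> 0 < t -> f x' = t *: f x -> X x -> X x'.

Lemma flat_tangent X x v a : conic X -> U0 x -> X x ->
  'd Theta x v *m p = a *: f x -> tangent X x v.
Proof.
move=> Xc Ux Xx dv; have [WT OT] := TK Ux.
pose w := 'd Theta x v.
pose aff (t : R) : V := t *: w + Theta x.
have caff : continuous aff.
  move=> t; apply: differentiable_continuous; apply/derivable1_diffP.
  by have [] := is_derive_affine w (Theta x) t.
have aff0 : aff 0 = Theta x by rewrite /aff scale0r add0r.
have nW : \forall t \near (0 : R), W (aff t).
  by apply: caff; rewrite aff0; exact: open_nbhs_nbhs.
have na : \forall t \near (0 : R), 0 < 1 + t * a.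
  have ca : {for 0, continuous (fun t : R => 1 + t * a)}.
    by apply: cvgD; [exact: cvg_cst|apply: cvgMl; exact: cvg_id].
  apply: (ca [set x : R | 0 < x]); rewrite mul0r addr0.
  by apply: open_nbhs_nbhs; split; [exact: open_gt|exact: ltr01].
have /nbhs_ballP[e /= e0 eP] : \forall t \near (0 : R), W (aff t) /\ 0 < 1 + t * a.
  exact: filterI.
have itvP (t : R) : t \in `]- e, e[ -> ball 0 e t.
  by rewrite in_itv /= -ball_normE /= sub0r normrN ltr_norml.
exists (Psi \o aff), e; split => //.
- move=> j; apply: (@Ck_on_comp _ _ _ _ _ _ _ W) => //.
  + by move=> t /itvP/eP[].
  + apply: Ck_onD => //; last exact: Ck_on_cst.
    apply: Ck_on_scale => //; last exact: Ck_on_cst.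
    exact: Ck_on_id.
- move=> t /itvP/eP[Wt at0] /=; have [Ut TO] := OK Wt.
  apply: (Xc x _ (1 + t * a)) => //.
  rewrite /f TO mulmxDl -scalemxAl dv scalerDl scale1r scalerA addrC.
  by rewrite -/(f x).
- by rewrite /= aff0.
- have D := is_derive_affine w (Theta x) (0 : R).
  have dOa : differentiable Psi (aff 0) by rewrite aff0; exact: dO.
  have D' : is_derive (0 : R) (1 : R) (Psi \o aff) ('d Psi (aff 0) w).
    exact: is_derive_curve D dOa.
  have E : 'd Psi (aff 0) w = v by rewrite aff0; exact: flat_diffK.
  by move: D'; rewrite E.
Qed.

Lemma flat_tangent_ker Y y v : (forall x, U0 x -> Y x -> f x = 0) -> U0 y ->
  tangent Y y v -> 'd Theta y v *m p = 0.
Proof.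
move=> Y0 Uy tv.
pose L : {linear 'rV[R]_n -> 'rV[R]_k} := mulmxr p.
have Lc : continuous L by exact: linear_mx_continuous.
have dL := linear_differentiable (Theta y) Lc.
have E := tangent_ker oU0 Uy (differentiable_comp (dT Uy) dL) Y0 tv.
have E1 := congr1 (@^~ v) (diff_comp (dT Uy) dL).
exact: (etrans (esym (diff_linear (Theta y) ('d Theta y v) Lc)) (etrans (esym E1) E)).
Qed.

End FlatModel.

Section Whitney.
Context {R : realType} {n : nat}.
Local Notation V := 'rV[R]_n.

(* A convergence [a_k B_k -> v] only controls the coefficients [a_k] once they
   are recovered, up to the factor [det (B_k C) -> 1], by means of a right
   inverse [C] of the limit frame. *)
Lemma subspace_limit (T_ : nat -> set V) T (v_ : nat -> V) v :
  subspace_cvg T_ T -> (\forall j \near \oo, T_ j (v_ j)) ->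
  v_ @ \oo --> v -> T v.
Proof.
move=> [d [B_ [B [H1 [Bfree ->] BB]]]] Tv vv.
have [C BC] := row_freeP Bfree.
rewrite /row_span /=.
pose X j := B_ j *m C.
have cX : X j @[j --> \oo] --> (1%:M : 'M[R]_d).
  by rewrite -BC; apply: cvg_mulmx => //; exact: cvg_cst.
have cdet : \det (X j) @[j --> \oo] --> (1 : R).
  have := (@Ck_on_det R 'M[R]_d d 0 setT id openT (Ck_on_id _ _)) 1%:M I.
  rewrite /prop_for /continuous_at det1 => cd.
  by apply: cvg_comp cX cd.
have cadj : \adj (X j) @[j --> \oo] --> (\adj 1%:M : 'M[R]_d).
  have := (@Ck_on_adj R 'M[R]_d d 0 setT id openT (Ck_on_id _ _)) 1%:M I.
  rewrite /prop_for /continuous_at => cd.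
  by apply: cvg_comp cX cd.
have l1 : \det (X j) *: v_ j @[j --> \oo] --> 1 *: v by exact: cvgZ.
have l2 : (v_ j *m C *m \adj (X j) *m B_ j) @[j --> \oo] --> v *m C *m \adj 1%:M *m B.
  apply: cvg_mulmx => //; apply: cvg_mulmx => //; apply: cvg_mulmx => //.
  exact: cvg_cst.
have E : \forall j \near \oo, \det (X j) *: v_ j = v_ j *m C *m \adj (X j) *m B_ j.
  apply: filterS Tv => j; have [Bf ->] := H1 j.
  rewrite /row_span /= => /submxP[a ->].
  rewrite -(mulmxA a) -/(X j) -(mulmxA a) mul_mx_adj mul_mx_scalar.
  by rewrite -scalemxAl.
have l3 : \det (X j) *: v_ j @[j --> \oo] --> v *m C *m \adj 1%:M *m B.
  apply: cvg_trans l2; apply: near_eq_cvg.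
  by apply: filterS E => j ->.
have : 1 *: v = v *m C *m \adj 1%:M *m B.
  by apply: (cvg_unique _ l1 l3); exact: norm_hausdorff.
by rewrite scale1r => ->; exact: submxMl.
Qed.

Variables (k : nat) (Theta Psi : V -> V) (U0 W : set V).
Hypotheses (LI : local_inverse Theta U0 Psi W) (CT : smooth_on U0 Theta).
Let oU0 : open U0. Proof. by case: LI. Qed.
Let oW : open W. Proof. by case: LI. Qed.
Let TK x : U0 x -> W (Theta x) /\ Psi (Theta x) = x.
Proof. by case: LI => _ _ H _ _; exact: H. Qed.
Let CO : smooth_on W Psi. Proof. by case: LI. Qed.
Let p : 'M[R]_(n, k) := pid_mx k.
Variables (X Y : set V) (y : V).
Hypotheses (Xc : conic (k := k) Theta U0 X)
  (Y0 : forall x, U0 x -> Y x -> Theta x *m p = 0) (Uy : U0 y).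

Let cvg_U (x_ : nat -> V) : x_ @ \oo --> y -> \forall j \near \oo, U0 (x_ j).
Proof. by move=> xy; apply: xy; exact: open_nbhs_nbhs. Qed.

Let cvg_Theta (x_ : nat -> V) : x_ @ \oo --> y ->
  Theta (x_ j) @[j --> \oo] --> Theta y.
Proof.
move=> xy; have cT := CT 0 y Uy.
by apply: cvg_comp xy cT.
Qed.

Let cvg_dPsi (x_ w_ : nat -> V) w : x_ @ \oo --> y -> w_ @ \oo --> w ->
  'd Psi (Theta (x_ j)) (w_ j) @[j --> \oo] --> 'd Psi (Theta y) w.
Proof.
move=> xy ww; have [WT _] := TK Uy.
exact: (cvg_diff oW (CO 1) WT (cvg_Theta xy) ww).
Qed.

(** The vectors with constant coordinates ['d Theta y v] have no transverse part, so they are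
    tangent to [X] at [x_ j], and they tend to [v]. *)
Lemma flat_whitney_a (x_ : nat -> V) T v :
  (forall j, X (x_ j)) -> x_ @ \oo --> y ->
  subspace_cvg (fun j => tangent X (x_ j)) T -> tangent Y y v -> T v.
Proof.
move=> Xx xy sT tv.
have dv0 := flat_tangent_ker (k := k) LI CT Y0 Uy tv.
pose w := 'd Theta y v.
have vv : 'd Psi (Theta (x_ j)) w @[j --> \oo] --> v.
  have c0 : (fun _ : nat => w) @ \oo --> w by exact: cvg_cst.
  exact: (cvg_congr erefl (esym (flat_diffK LI CT v Uy)) (cvg_dPsi xy c0)).
apply: (subspace_limit sT _ vv); apply: filterS (cvg_U xy) => j Uj.
apply: (flat_tangent (k := k) LI CT (a := 0)) => //.
apply: (etrans (congr1 (fun z : V => z *m p) (flat_diffVK LI CT w Uj))).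
by rewrite scale0r.
Qed.

(** As [Y] has zero transverse coordinates, a scaled secant read through [Theta] has transverse part
    [r j] times that of [x_ j], the form that [flat_tangent] accepts. *)
Lemma flat_whitney_b (x_ y_ : nat -> V) l T u :
  (forall j, X (x_ j)) -> (forall j, Y (y_ j)) ->
  x_ @ \oo --> y -> y_ @ \oo --> y ->
  subspace_cvg (fun j => row_span (x_ j - y_ j)) l ->
  subspace_cvg (fun j => tangent X (x_ j)) T -> l u -> T u.
Proof.
move=> Xx Yy xy yy [d [b_ [b [H1 [bfree ->] bb]]]] sT /submxP[a uE].
pose u_ j := a *m b_ j.
have uu : u_ @ \oo --> u by rewrite uE; apply: cvg_mulmx => //; exact: cvg_cst.
have rex j : exists c, u_ j = c *: (x_ j - y_ j).
  have [_ E] := H1 j; have : row_span (b_ j) (u_ j) by exact: submxMl.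
  by rewrite -E => /sub_rVP.
pose r j := sval (cid (rex j)).
have rE j : u_ j = r j *: (x_ j - y_ j) by exact: (svalP (cid (rex j))).
pose w_ j := r j *: (Theta (x_ j) - Theta (y_ j)).
have ww : w_ @ \oo --> 'd Theta y u.
  have du : 'd Theta y (u_ j) @[j --> \oo] --> 'd Theta y u.
    apply: cvg_linear_mx; exact: uu.
  have d0 : (w_ j - 'd Theta y (u_ j)) @[j --> \oo] --> (0 : V).
    (* The factors [r j] may blow up, but the scaled secants [u_ j] stay bounded, and strict
       differentiability gives an error relative to them. *)
    have [Mb Mb0 uM] : exists2 c : R, 0 < c & \forall j \near \oo, `|u_ j| <= c.
      exists (`|u| + 1); first by rewrite ltr_pwDr.
      have /cvgrPdist_le/(_ 1 ltr01) := uu; apply: filterS => j H.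
      rewrite -lerBlDl; apply: le_trans H; rewrite distrC.
      exact: lerB_dist.
    apply/cvgr0Pnorm_le => e e0.
    have e1 : 0 < e / Mb by rewrite divr_gt0.
    have [q q0 [qU qP]] := strict_diff oU0 (CT 1) Uy e1.
    have nx : \forall j \near \oo, ball y q (x_ j) by apply: xy; exact: nbhsx_ballx.
    have ny : \forall j \near \oo, ball y q (y_ j) by apply: yy; exact: nbhsx_ballx.
    near=> j.
    have bx : ball y q (x_ j) by near: j; exact: nx.
    have by_ : ball y q (y_ j) by near: j; exact: ny.
    have H := qP (x_ j) (y_ j) bx by_.
    have E : w_ j - 'd Theta y (u_ j) =
       r j *: (Theta (x_ j) - Theta (y_ j) - 'd Theta y (x_ j - y_ j)).
      rewrite scalerBr; congr (_ - _); rewrite rE; exact: linearZ.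
    have uj : `|u_ j| <= Mb by near: j; exact: uM.
    have uEj : `|u_ j| = `|r j| * `|x_ j - y_ j| by rewrite rE normrZ.
    apply: (@le_trans _ _ (e / Mb * `|u_ j|)).
      rewrite (congr1 (fun z : V => `|z|) E) normrZ uEj mulrCA.
      exact: ler_wpM2l.
    by rewrite mulrAC ler_pdivrMr// ler_wpM2l// ltW.
  have E j : w_ j = w_ j - 'd Theta y (u_ j) + 'd Theta y (u_ j).
    exact: (esym (subrK _ _)).
  exact: (cvg_congr (funext E) (esym (add0r _)) (cvgD d0 du)).
have vv : 'd Psi (Theta (x_ j)) (w_ j) @[j --> \oo] --> u.
  exact: (cvg_congr erefl (esym (flat_diffK LI CT u Uy)) (cvg_dPsi xy ww)).
apply: (subspace_limit sT _ vv); apply: filterS2 (cvg_U xy) (cvg_U yy) => j Ux Uyj.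
apply: (flat_tangent (k := k) LI CT (a := r j)) => //.
apply: (etrans (congr1 (fun z : V => z *m p) (flat_diffVK LI CT (w_ j) Ux))).
rewrite /w_ -scalemxAl mulmxBl.
by rewrite (Y0 Uyj (Yy j)) subr0.
Unshelve. all: by end_near. Qed.

End Whitney.

(** * Strata of the multiplicity locus *)

Section Charts.
Context {R : realType} {n : nat}.

Lemma chart_image_open (M : topologicalType) (c : chart R n M) (U : set M) :
  open U -> open (c @` (dom c `&` U)).
Proof.
move=> oU; rewrite openE => _ [q [cq Uq] <-].
have H1 : nbhs (c q) (c @` dom c).
  by apply: open_nbhs_nbhs; split; [exact: coord_open|exists q].
have H2 : nbhs (c q) (param c @^-1` U).
  apply: (param_continuous cq); rewrite coordK//.
  by apply: open_nbhs_nbhs.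
apply: filterS2 H1 H2 => x [q' cq' <-]; rewrite /= coordK// => Uq'.
by exists q'.
Qed.

Context {M : smoothManifold R n} (g : riemannianMetric M) (h : sym2Tensor M).

Lemma transition_jacobian_unit (c c' : chart R n M) p : atlas c -> atlas c' ->
  dom c p -> dom c' p -> 'J (c' \o param c) (c p) \in unitmx.
Proof.
move=> ac ac' cp c'p.
have [T1 T2] := atlas_compatible ac ac'.
have d1 : differentiable (c' \o param c) (c p).
  by have [+ _] := T1 1; apply; exists p.
have d2 : differentiable (c \o param c') ((c' \o param c) (c p)).
  by have [+ _] := T2 1; rewrite /= coordK//; apply; exists p.
have H : \forall z \near c p, (c \o param c') ((c' \o param c) z) = z.
  have O1 := @chart_image_open _ c _ (@dom_open _ _ _ c').
  have : nbhs (c p) (c @` (dom c `&` dom c')).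
    by apply: open_nbhs_nbhs; split => //; exists p.
  by apply: filterS => _ [q [cq c'q] <-] /=; rewrite !coordK.
have K := diff_cancel d1 d2 H.
rewrite -row_free_unit; apply: inj_row_free => v.
rewrite (mul_rV_lin1 ('d (c' \o param c) (c p))) => v0.
have E := congr1 ('d (c \o param c') ((c' \o param c) (c p))) v0.
exact: (etrans (esym (K v)) (etrans E (linear0 _))).
Qed.

Lemma metric_unit (c : chart R n M) p : atlas c -> dom c p -> g c p \in unitmx.
Proof.
move=> ac cp; rewrite -row_free_unit; apply: inj_row_free => v vg.
apply/eqP/negPn/negP => /(metric_pos g ac cp).
by rewrite vg mul0mx mxE ltxx.
Qed.

Lemma endo_metric (c : chart R n M) p : atlas c -> dom c p ->
  endo g h c p *m g c p = h c p.
Proof. by move=> ac cp; rewrite /endo mulmxKV// metric_unit. Qed.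

Lemma endo_self_adjoint (c : chart R n M) p : atlas c -> dom c p ->
  endo g h c p *m g c p = g c p *m (endo g h c p)^T.
Proof.
move=> ac cp; rewrite -{2}(components_sym g ac cp) -trmx_mul !endo_metric//.
by rewrite (components_sym h ac cp).
Qed.

Lemma endo_diagonal (c : chart R n M) p : atlas c -> dom c p ->
  exists (Q : 'M[R]_n) (d : 'rV[R]_n), Q *m g c p *m Q^T = 1%:M /\
    Q *m endo g h c p = diag_mx d *m Q.
Proof.
move=> ac cp; apply: spectral_pair.
- exact: components_sym.
- exact: (metric_pos g ac cp).
- exact: endo_self_adjoint.
Qed.

(** By the transformation laws of [g] and [h], both sides become [h c p] after multiplication by the
    invertible [g c' p *m J^T]. *)
Lemma endo_change (c c' : chart R n M) p : atlas c -> atlas c' ->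
  dom c p -> dom c' p -> exists2 J, J \in unitmx &
    endo g h c p *m J = J *m endo g h c' p.
Proof.
move=> ac ac' cp c'p; set J := 'J (c' \o param c) (c p).
have Ju : J \in unitmx by exact: transition_jacobian_unit.
exists J => //.
have gE := components_change g ac ac' cp c'p; rewrite -/J in gE.
have hE := components_change h ac ac' cp c'p; rewrite -/J in hE.
apply: (can_inj (mulmxK (metric_unit ac' c'p))).
apply: (can_inj (@mulmxK _ _ n J^T _)); first by rewrite unitmx_tr.
have eg := endo_metric ac cp; have eg' := endo_metric ac' c'p.
have E1 : endo g h c p *m J *m g c' p *m J^T = h c p by rewrite -eg gE !mulmxA.
have E2 : J *m endo g h c' p *m g c' p *m J^T = h c p.
  by rewrite -(mulmxA J) eg' hE.
by rewrite E1 E2.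
Qed.

Lemma unitmx_orthonormal (Q G : 'M[R]_n) : Q *m G *m Q^T = 1%:M -> Q \in unitmx.
Proof. by rewrite -mulmxA => /mulmx1_unit[]. Qed.

Lemma endo_multiplicities (c c' : chart R n M) p k : atlas c -> atlas c' ->
  dom c p -> dom c' p -> has_multiplicities (endo g h c p) k ->
  has_multiplicities (endo g h c' p) k.
Proof.
move=> ac ac' cp c'p.
have [Q [d [/unitmx_orthonormal Qu QE]]] := endo_diagonal ac cp.
have [J Ju JE] := endo_change ac ac' cp c'p.
have QJu : Q *m J \in unitmx by rewrite unitmx_mul Qu.
have QJE : Q *m J *m endo g h c' p = diag_mx d *m (Q *m J).
  by rewrite -(mulmxA Q) -JE (mulmxA Q) QE -mulmxA.
by rewrite (has_multiplicities_diag k Qu QE) (has_multiplicities_diag k QJu QJE).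
Qed.

Lemma stratumE (c : chart R n M) p (m : eigmult n) : atlas c -> dom c p ->
  stratum g h m p <-> has_multiplicities (endo g h c p) (val m).
Proof.
move=> ac cp; split=> [[c' [ac' c'p]]|H]; last by exists c.
exact: endo_multiplicities.
Qed.

Lemma stratum_exists p : exists m : eigmult n, stratum g h m p.
Proof.
have [c ac cp] := atlas_cover p.
have [Q [d [/unitmx_orthonormal Qu QE]]] := endo_diagonal ac cp.
have [k dk] := mult_of_exists d.
exists (Sub k (mult_of_wf dk)); apply/(stratumE _ ac cp).
exact/(has_multiplicities_diag k Qu QE).
Qed.

Lemma stratum_inj p (m m' : eigmult n) :
  stratum g h m p -> stratum g h m' p -> m = m'.
Proof.
have [c ac cp] := atlas_cover p.
rewrite !(stratumE _ ac cp).
have [Q [d [/unitmx_orthonormal Qu QE]]] := endo_diagonal ac cp.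
rewrite !(has_multiplicities_diag _ Qu QE) => dm dm'.
by apply: val_inj; exact: mult_of_inj dm dm'.
Qed.

Lemma mult_locusE p :
  mult_locus g h p <-> exists2 m : eigmult n, (size (val m) < n)%N & stratum g h m p.
Proof.
have [c0 ac0 c0p] := atlas_cover p.
split=> [[c [ac cp nd]]|[m mn]]; last first.
  rewrite (stratumE _ ac0 c0p) => Hm; exists c0; split => //.
  have [Q [d [/unitmx_orthonormal Qu QE]]] := endo_diagonal ac0 c0p.
  move: Hm; rewrite (has_multiplicities_diag _ Qu QE) => dm.
  by rewrite (distinct_eigenvalues_diag Qu QE dm) => sm; rewrite sm ltnn in mn.
have [m Hm] := stratum_exists p; exists m => //.
move: Hm; rewrite (stratumE _ ac cp).
have [Q [d [/unitmx_orthonormal Qu QE]]] := endo_diagonal ac cp.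
rewrite (has_multiplicities_diag _ Qu QE) => dm.
have := mult_of_size dm; rewrite leq_eqVlt => /orP[/eqP sm|//].
by case: nd; apply/(distinct_eigenvalues_diag Qu QE dm).
Qed.

Lemma components_param_smooth (t : sym2Tensor M) (c : chart R n M) : atlas c ->
  smooth_on (c @` dom c) (fun x => t c (param c x)).
Proof. by move=> ac; exact: components_smooth. Qed.

Lemma endo_param_smooth (c : chart R n M) : atlas c ->
  smooth_on (c @` dom c) (fun x => endo g h c (param c x)).
Proof.
move=> ac k; have oc := @coord_open _ _ _ c.
apply: Ck_on_mulmx => //; first exact: components_param_smooth.
apply: Ck_on_invmx => //; last exact: components_param_smooth.
by move=> _ [q cq <-]; rewrite coordK// metric_unit.
Qed.

End Charts.

Lemma open_preimage_on (T T' : topologicalType) (U : set T) (Q : set T')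
    (f : T -> T') : open U -> open Q -> (forall x, U x -> {for x, continuous f}) ->
  open (U `&` f @^-1` Q).
Proof.
move=> oU oQ cf; rewrite openE => x [Ux Qx].
apply: filterI; first exact: open_nbhs_nbhs.
by apply: cf => //; exact: open_nbhs_nbhs.
Qed.

(** * Local model of the strata around a point *)

Section LocalModelDef.
Context {R : realType} {n : nat}.

(* In the coordinates [Theta] around [x0] the stratum of [x0] is the zero set of
   the first [k] coordinates, every stratum is invariant under scaling them, and
   some ray in them lies in strata of codimension two. *)
Definition flat_model (M : smoothManifold R n) (g : riemannianMetric M)
    (h : sym2Tensor M) (c : chart R n M) (x0 : 'rV[R]_n) (m0 : eigmult n) : Prop :=
  exists (k : nat) (Theta Psi : 'rV[R]_n -> 'rV[R]_n) (U W : set 'rV[R]_n),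
  [/\ k = codim (val m0) /\ (k <= n)%N, U x0 /\ U `<=` c @` dom c,
   local_inverse Theta U Psi W, smooth_on U Theta &
   [/\ forall x, U x -> chart_image c (stratum g h m0) x <->
         Theta x *m (pid_mx k : 'M[R]_(n, k)) = 0,
     forall m, conic (k := k) Theta U (chart_image c (stratum g h m)) &
     (size (val m0) < n)%N -> exists xi : 'rV[R]_k, forall x (t : R), U x -> 0 < t ->
       Theta x *m (pid_mx k : 'M[R]_(n, k)) = t *: xi ->
       exists m : eigmult n, [/\ chart_image c (stratum g h m) x,
         codim (val m) = 2 & (size (val m) < n)%N]]].

Lemma mult_of_coincidence (d : 'rV[R]_n) m : mult_of d m -> (size m < n)%N ->
  exists a b, a != b /\ d 0 a = d 0 b.
Proof.
move=> [s [s1 s2 <-]]; rewrite size_map => sn.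
case: (boolP (injectiveb (d 0))) => [/injectiveP dinj|/injectivePn[a [b ab dab]]].
  have uc : uniq (codom (d 0)) by exact/injectiveP.
  have sub : {subset codom (d 0) <= s}.
    by move=> _ /codomP[i ->]; rewrite s2; apply/existsP; exists i.
  by have := uniq_leq_size uc sub; rewrite size_codom card_ord leqNgt sn.
by exists a, b.
Qed.

End LocalModelDef.

Section LocalModel.
Context {R : realType} {n : nat} (n_gt0 : (0 < n)%N).
Context {M : smoothManifold R n} (g : riemannianMetric M) (h : sym2Tensor M).
Hypotheses (h_traceless : tangent_metrics g h) (h_generic : generic g h).
Variables (c : chart R n M) (ac : atlas c).

Lemma chart_stratumE (m : eigmult n) x : (c @` dom c) x ->
  chart_image c (stratum g h m) x <->
  has_multiplicities (endo g h c (param c x)) (val m).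
Proof.
move=> [q cq <-]; rewrite coordK//; split=> [[q' [cq' Sq'] qq']|H].
  have <- : q' = q by rewrite -(coordK cq') qq' coordK.
  exact/(stratumE g h m ac cq').
by exists q => //; split => //; apply/(stratumE g h m ac cq).
Qed.

Variables (p0 : M) (cp0 : dom c p0) (m0 : eigmult n) (p0m0 : stratum g h m0 p0).
Let x0 := c p0.
Let cx0 : (c @` dom c) x0. Proof. by exists p0. Qed.
Let px0 : param c x0 = p0. Proof. exact: coordK. Qed.
Let oc : open (c @` dom c). Proof. exact: coord_open. Qed.

Variables (Q : 'M[R]_n) (d : 'rV[R]_n).
Hypotheses (QG : Q *m g c p0 *m Q^T = 1%:M)
  (QH : Q *m endo g h c p0 = diag_mx d *m Q).
Let D := diag_mx d.
Let Qu : Q \in unitmx. Proof. exact: unitmx_orthonormal QG. Qed.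

Variables (nf : 'M[R]_n -> 'M[R]_n -> 'M[R]_n) (N : set ('M[R]_n * 'M[R]_n)).
Hypotheses (oN : open N) (N1D : N (1%:M, D))
  (nfP : forall G A, N (G, A) -> G^T = G -> A *m G = G *m A^T ->
     [/\ (nf G A)^T = nf G A, comm_mx (nf G A) D &
       exists2 P, P \in unitmx & P *m A = nf G A *m P])
  (nf1 : forall B, N (1%:M, B) -> comm_mx B D -> nf 1%:M B = B)
  (nfC : forall (V : normedModType R) (U' : set V) (gg hh : V -> 'M[R]_n),
     open U' -> smooth_on U' gg -> smooth_on U' hh ->
     (forall z, U' z -> N (gg z, hh z)) ->
     smooth_on U' (fun z => nf (gg z) (hh z))).

Local Notation E := ('rV[R]_n * 'M[R]_n)%type.
Let s := local_section g h c.

(** Components in the constant frame [Q], orthonormal at [p0]: over [x0] they are [1%:M] and [D],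
    the base point of the normal form. *)
Let gQ (x : 'rV[R]_n) : 'M[R]_n := Q *m g c (param c x) *m Q^T.
Let hQ (A : 'M[R]_n) : 'M[R]_n := Q *m A *m invmx Q.
(** Defined on the bundle and not just along [h], because genericity compares tangent vectors of the
    bundle. *)
Let S (z : E) : 'M[R]_n := nf (gQ z.1) (hQ z.2).

Let gQC : smooth_on (c @` dom c) gQ.
Proof.
move=> k; apply: Ck_on_mulmx => //; last exact: Ck_on_cst.
by apply: Ck_on_mulmx => //; [exact: Ck_on_cst|exact: components_param_smooth].
Qed.

Let hQC (V : normedModType R) (U : set V) (f : V -> 'M[R]_n) : open U -> smooth_on U f ->
  smooth_on U (fun z => hQ (f z)).
Proof.
move=> oU Cf k; apply: Ck_on_mulmx => //; last exact: Ck_on_cst.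
by apply: Ck_on_mulmx => //; exact: Ck_on_cst.
Qed.

Let fst_lin : {linear E -> 'rV[R]_n} := fst.
Let snd_lin : {linear E -> 'M[R]_n} := snd.

Let U1 : set E := fst @^-1` (c @` dom c).
Let oU1 : open U1.
Proof. by apply: open_comp => // z _; exact: cvg_fst. Qed.

Let gC1 : smooth_on U1 (fun z : E => gQ z.1).
Proof.
move=> k; apply: (Ck_on_comp oU1 oc _ _ (gQC k)); first by [].
by apply: (@Ck_on_linear _ _ _ k U1 fst_lin) => z; exact: cvg_fst.
Qed.

Let hC1 : smooth_on U1 (fun z : E => hQ z.2).
Proof.
apply: hQC => // k.
by apply: (@Ck_on_linear _ _ _ k U1 snd_lin) => z; exact: cvg_snd.
Qed.

Let U2 : set E := U1 `&` (fun z => (gQ z.1, hQ z.2)) @^-1` N.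
Let oU2 : open U2.
Proof.
apply: (open_preimage_on oU1 oN) => z U1z.
have c1 := gC1 0 z U1z; have c2 := hC1 0 z U1z.
exact: (cvg_pair c1 c2).
Qed.

Let SC : smooth_on U2 S.
Proof.
apply: nfC => // [||z []//].
- by apply: smooth_on_sub gC1 => z [].
- by apply: smooth_on_sub hC1 => z [].
Qed.

Let g0E : gQ x0 = 1%:M. Proof. by rewrite /gQ px0. Qed.
Let h0E : hQ (s x0).2 = D.
Proof. by rewrite /hQ /s /local_section /= px0 QH mulmxK. Qed.
Let U2s : U2 (s x0).
Proof. by split => //=; rewrite g0E h0E. Qed.
Let S0E : S (s x0) = D.
Proof. by rewrite /S g0E h0E; apply: nf1. Qed.

Let near_sep : \forall z \near s x0, separated_blocks d (S z).
Proof.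
have cS := SC 0 _ U2s; rewrite /prop_for /continuous_at S0E in cS.
exact: near_separated cS.
Qed.

Let good : exists2 U : set E, open_nbhs (s x0) U &
  U `<=` [set z | U2 z /\ separated_blocks d (S z)].
Proof.
have : nbhs (s x0) [set z | U2 z /\ separated_blocks d (S z)].
  by apply: filterI near_sep; exact: open_nbhs_nbhs.
by rewrite nbhsE.
Qed.

Section Domain.
Variables (U : set E).
Hypotheses (oU : open U) (Us : U (s x0))
  (UP : U `<=` [set z | U2 z /\ separated_blocks d (S z)]).

(** The two alternatives are the sources of self-adjoint [z.2]: the bundle, where velocities are
    tested, and the section [s], from which the strata in [M] are read. *)
Let S_sym z : U z -> sym0_bundle g c z \/ (exists2 x, (c @` dom c) x & z = s x) ->
  [/\ (S z)^T = S z, comm_mx (S z) D &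
    forall k, has_multiplicities z.2 k <-> has_multiplicities (S z) k].
Proof.
move=> Uz zP.
have [[[q cq qz] Nz] _] := UP Uz.
pose G := g c (param c z.1).
have Gs : G^T = G by rewrite /G -qz coordK//; exact: components_sym.
have AG : z.2 *m G = G *m z.2^T.
  case: zP => [[_ + _]//|[x [q' cq' <-] zE]].
  rewrite /G zE /s /local_section /= (coordK cq').
  exact: endo_self_adjoint.
have gQs : (gQ z.1)^T = gQ z.1 by rewrite /gQ !trmx_mul trmxK -/G Gs mulmxA.
have hg : hQ z.2 *m gQ z.1 = gQ z.1 *m (hQ z.2)^T.
  rewrite /hQ /gQ -/G !trmx_mul trmx_inv !mulmxA mulmxKV// mulmxK ?unitmx_tr//.
  by rewrite -!(mulmxA Q) AG.
have [Ss SD [P Pu PA]] := nfP Nz gQs hg.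
split => // k.
have [P1 [e [P1u P1S]]] := symmetric_diagonal Ss.
have PQu : P1 *m P *m Q \in unitmx by rewrite !unitmx_mul P1u Pu.
have PQA : P1 *m P *m Q *m z.2 = diag_mx e *m (P1 *m P *m Q).
  have E1 : P *m Q *m z.2 = S z *m P *m Q.
    by rewrite -PA /hQ !mulmxA mulmxKV.
  by rewrite -(mulmxA P1) -(mulmxA P1) E1 !mulmxA P1S.
by rewrite (has_multiplicities_diag k PQu PQA) (has_multiplicities_diag k P1u P1S).
Qed.

Let d_m0 : mult_of d (val m0).
Proof.
have := p0m0; rewrite (stratumE g h m0 ac cp0).
by rewrite (has_multiplicities_diag _ Qu QH).
Qed.

Let F z := block_vec d (S z).

Let FC : smooth_on U F.
Proof.
move=> k; apply: Ck_on_linear_comp => //; first exact: linear_mx_continuous.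
by apply: Ck_on_sub (SC k) => z /UP[].
Qed.

Let sU : set 'rV[R]_n := c @` dom c `&` s @^-1` U.

Let s_diff x : (c @` dom c) x -> differentiable s x.
Proof.
move=> cx; apply: differentiable_pair; first by case: (is_diff_id x).
by have [+ _] := endo_param_smooth g h ac 1; exact.
Qed.

Let osU : open sU.
Proof.
by apply: (open_preimage_on oc oU) => x cx; apply: differentiable_continuous; exact: s_diff.
Qed.

Let FsC : smooth_on sU (F \o s).
Proof.
move=> k; apply: Ck_on_linear_comp => //; first exact: linear_mx_continuous.
apply: nfC => //.
- by apply: smooth_on_sub gQC => x [].
- apply: hQC => //; apply: smooth_on_sub (endo_param_smooth g h ac).
  by move=> x [].
- by move=> x [_ /UP[[]]].
Qed.

Let sUx0 : sU x0. Proof. by split. Qed.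

(** The line [t *: T + D], in the frame [Q] over [x0], lies in the traceless bundle, and [F] equals
    [t *: xi] on it for small [t]. By genericity its velocity splits into an image of ['d s] and a
    velocity in the stratum; ['d F] annihilates the latter, so it sends the former to [xi]. *)
Let model_submersion : (size (val m0) < n)%N ->
  forall xi, exists v, 'd (F \o s) x0 v = xi.
Proof.
move=> m0n xi.
have [T [Ts TD T0 Txi]] := block_vec_surj xi n_gt0.
pose wT : E := (0, invmx Q *m T *m Q).
pose gam (t : R) : E := t *: wT + s x0.
have gam1 t : (gam t).1 = x0 by rewrite /gam /= scaler0 add0r.
have gam2 t : hQ (gam t).2 = t *: T + D.
  have -> : (gam t).2 = t *: (invmx Q *m T *m Q) + (s x0).2 by [].
  rewrite /hQ mulmxDr mulmxDl -/(hQ (s x0).2) h0E -scalemxAr -scalemxAl !mulmxA.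
  by rewrite mulmxV// mul1mx mulmxK.
have gam2' t : (gam t).2 = invmx Q *m (t *: T + D) *m Q.
  by rewrite -gam2 /hQ !mulmxA mulVmx// mul1mx mulmxKV.
have gamC : continuous gam.
  move=> t; apply: differentiable_continuous; apply/derivable1_diffP.
  by have [] := is_derive_affine wT (s x0) t.
have gam0 : gam 0 = s x0 by rewrite /gam scale0r add0r.
(* The line stays in the traceless bundle because [h] is traceless at [p0]. *)
have D_tr0 : \tr D = 0.
  have := h_traceless ac cp0; rewrite /metric_trace mxtrace_mulC -/(endo g h c p0).
  have -> : endo g h c p0 = invmx Q *m (D *m Q) by rewrite -QH mulKmx.
  by rewrite mxtrace_mulC -mulmxA mulmxV// mulmx1.
have G0 : g c p0 = invmx Q *m (invmx Q)^T.
  apply: (can_inj (mulKmx Qu)); apply: (can_inj (@mulmxK _ _ n Q^T _)).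
    by rewrite unitmx_tr.
  by rewrite QG mulKVmx// -trmx_mul mulmxV// trmx1.
have sym_gam t : sym0_bundle g c (gam t).
  case: (gam t) (gam1 t) (gam2' t) => z1 z2 /= -> ->; split => //=.
  - rewrite px0 G0.
    have Ys : (t *: T + D)^T = t *: T + D.
      by rewrite linearD linearZ /= Ts /D tr_diag_mx.
    rewrite !trmx_mul Ys trmx_inv !mulmxA mulmxK// mulmxKV ?unitmx_tr//.
  - rewrite mxtrace_mulC mulmxA mulmxV// mul1mx.
    by rewrite mxtraceD mxtraceZ T0 D_tr0 mulr0 addr0.
have tan_w : tangent (sym0_bundle g c) (s x0) wT.
  exists gam, 1; split => //.
  - move=> k; apply: Ck_onD; [exact: interval_open| |exact: Ck_on_cst].
    apply: Ck_on_scale; [exact: interval_open| |exact: Ck_on_cst].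
    exact: (@Ck_on_id R R).
  - exact: is_derive_affine.
have sb : mult_bundle g c m0 (s x0).
  split; first by rewrite -gam0.
  rewrite /= px0; exact/(stratumE g h m0 ac cp0).
pose mm : degenerate n := Sub m0 m0n.
have H := h_generic (m := mm) ac cp0 sb.
have : [set 'd s x0 v + w | v in setT & w in tangent (mult_bundle g c m0) (s x0)] wT.
  by move: tan_w; rewrite -H.
move=> [v _ [w tw vw]]; exists v.
have dFz : differentiable F (s x0) by have [+ _] := FC 1; exact.
have Lw : 'd F (s x0) w = 0.
  apply: (tangent_ker oU Us dFz _ tw) => z Uz [zs zm].
  have [Ss SD Sm] := S_sym Uz (or_introl zs).
  have [_ sep] := UP Uz.
  apply/(block_vec_strata Ss SD sep d_m0).
  by apply/Sm.
have LwT : 'd F (s x0) wT = xi.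
  have D1 := is_derive_affine wT (s x0) (0 : R).
  have dFg : differentiable F (gam 0) by rewrite gam0.
  have D2 : is_derive (0 : R) (1 : R) (F \o gam) ('d F (gam 0) wT).
    exact: is_derive_curve D1 dFg.
  have D3 : is_derive (0 : R) (1 : R) (fun t : R => t *: xi + 0) xi.
    exact: is_derive_affine.
  have nU : \forall t \near (0 : R), U (gam t).
    by apply: gamC; rewrite gam0; exact: open_nbhs_nbhs.
  have nE : \forall t \near (0 : R), (F \o gam) t = t *: xi + 0.
    apply: filterS nU => t Ut /=.
    have [[_ Nt] _] := UP Ut.
    have cT : comm_mx (t *: T + D) D.
      by rewrite /comm_mx mulmxDl mulmxDr -scalemxAl -scalemxAr TD.
    have St : S (gam t) = t *: T + D.
      move: Nt (gam1 t) (gam2 t); rewrite /S; case: (gam t) => z1 z2 /= Nt e1 e2.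
      by move: Nt; rewrite e1 e2 g0E => Nt; exact: nf1.
    rewrite /F St linearD linearZ /= Txi; congr (_ + _).
    exact: block_vec_diag.
  have E1 := @derive_val _ _ _ _ _ _ _ D2.
  have E2 := @derive_val _ _ _ _ _ _ _ D3.
  have E3 := near_eq_derive (1 : R) nE.
  rewrite -gam0; exact: (etrans (esym E1) (etrans E3 E2)).
have C1 := congr1 (@^~ v) (diff_comp (s_diff cx0) dFz).
apply: (etrans C1); rewrite /=.
have C2 := etrans (congr1 ('d F (s x0)) vw) LwT.
have C3 := etrans (esym (linearD ('d F (s x0)) ('d s x0 v) w)) C2.
have C4 := etrans (congr1 (fun z => 'd F (s x0) ('d s x0 v) + z) (esym Lw)) C3.
exact: (etrans (esym (addr0 _)) C4).
Qed.

Let F_surj : forall xi, exists v, 'd (F \o s) x0 v = xi.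
Proof.
have [m0n|m0n] := boolP (size (val m0) < n)%N; first exact: model_submersion.
(* Genericity is silent where eigenvalues are distinct, but there the target has dimension 0. *)
move=> xi; exists 0; apply/rowP => q.
have k0 : #|block_coords d| = 0%N.
  by rewrite (card_block_coords d_m0) eigmult_nondegenerate.
by have := leq_trans (ltn_ord q) (eq_leq k0); rewrite ltn0.
Qed.

Let section_S x : sU x ->
  [/\ (S (s x))^T = S (s x), comm_mx (S (s x)) D, separated_blocks d (S (s x)) &
    forall m : eigmult n, chart_image c (stratum g h m) x <->
      has_multiplicities (S (s x)) (val m)].
Proof.
move=> [cx Usx]; have [_ sep] := UP Usx.
have [Ss SD Sm] := S_sym Usx (or_intror (ex_intro2 _ _ x cx erefl)).
split => // m; rewrite (chart_stratumE _ cx) -(Sm (val m)).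
by [].
Qed.

Lemma flat_model_domain : flat_model g h c x0 m0.
Proof.
have [kn [B [Th [U0 [Psi [W [Bu [U0x0 U0U] LI CT TE]]]]]]] :=
  straighten osU FsC sUx0 F_surj.
exists #|block_coords d|, Th, Psi, U0, W; split => //.
- by split => //; exact: card_block_coords.
- by split => // x /U0U[].
split.
- move=> x /U0U/section_S[Ss SD sep ->]; rewrite TE.
  rewrite (block_vec_strata Ss SD sep d_m0) /F /=; split=> [->|FB].
    by rewrite mul0mx.
  by apply: (can_inj (mulmxK Bu)); rewrite mul0mx.
- move=> m x x' t /U0U/section_S[Ss SD sep ->] /U0U/section_S[Ss' SD' sep' ->] t0.
  rewrite !TE scalemxAl => /(can_inj (mulmxK Bu)) FE.
  exact: (block_vec_same_mult Ss Ss' SD SD' sep sep' t0 FE).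
- move=> m0n; have [a [b [ab dab]]] := mult_of_coincidence d_m0 m0n.
  have [xi Hxi] := codim2_direction ab dab.
  (* [straighten] yields coordinates equal to [F] times the invertible [B], so the ray is
     transported by [B]. *)
  exists (xi *m B) => x t U0x t0; rewrite TE scalemxAl => /(can_inj (mulmxK Bu)) FE.
  have [Ss SD sep SE] := section_S (U0U x U0x).
  have [k [Sk k2 kn']] := Hxi _ t Ss SD sep t0 FE.
  have [P1 [e [P1u P1S]]] := symmetric_diagonal Ss.
  have ek := (has_multiplicities_diag k P1u P1S).1 Sk.
  by exists (Sub k (mult_of_wf ek)); split => //; apply/SE.
Qed.

End Domain.

Lemma flat_model_frame : flat_model g h c x0 m0.
Proof. by have [U [oU Us] UP] := good; exact: flat_model_domain oU Us UP. Qed.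

End LocalModel.

Theorem flat_model_exists (R : realType) (n : nat) (M : smoothManifold R n)
    (g : riemannianMetric M) (h : sym2Tensor M) (c : chart R n M) p0 (m0 : eigmult n) :
  (0 < n)%N -> tangent_metrics g h -> generic g h -> atlas c -> dom c p0 ->
  stratum g h m0 p0 -> flat_model g h c (c p0) m0.
Proof.
move=> n0 ht hg ac cp0 p0m0.
have [Q [d [QG QH]]] := endo_diagonal g h ac cp0.
have [nf [N [oN N1D nfP nf1 nfC]]] := normal_form d.
exact: (flat_model_frame n0 ht hg ac cp0 p0m0 QG QH oN N1D nfP nf1 nfC).
Qed.

Lemma eigmult_finite n : finite_set [set: eigmult n].
Proof.
(* Multiplicities are positive and at most [n], so padding with 0 loses nothing: the length is read
   off the nonzero values. *)
pose f (m : eigmult n) : {ffun 'I_n -> 'I_n.+1} := [ffun i : 'I_n => inord (nth 0%N (val m) i)].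
have nth_le (m : eigmult n) i : (nth 0 (val m) i < n.+1)%N.
  case: m => m /= /andP[_ /eqP <-]; rewrite ltnS.
  have [im|im] := ltnP i (size m); last by rewrite nth_default.
  elim: m i im => //= k m IH [|i] /= im; first exact: leq_addr.
  by apply: leq_trans (IH i im) _; exact: leq_addl.
have nth_pos (m : eigmult n) i : (i < size (val m))%N = (0 < nth 0 (val m) i)%N.
  have [im|im] := ltnP i (size (val m)); last by rewrite nth_default.
  by case: m im => m /= /andP[/all_nthP m0 _] im; rewrite m0.
have finj : injective f.
  move=> m m' /ffunP ff; apply: val_inj.
  have nthE i : nth 0%N (val m) i = nth 0%N (val m') i.
    have [lin|nli] := ltnP i n; last first.
      by rewrite !nth_default// (leq_trans (eigmult_size_le _)).
    have := ff (Ordinal lin); rewrite !ffunE /= => /(congr1 val) /=.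
    by rewrite !inordK ?nth_le.
  apply: (eq_from_nth (x0 := 0%N)) => [|i _]; last exact: nthE.
  apply/eqP; rewrite eqn_leq leqNgt [X in _ && X]leqNgt; apply/andP; split; apply/negP.
    by rewrite nth_pos nthE -nth_pos ltnn.
  by rewrite nth_pos -nthE -nth_pos ltnn.
have -> : [set: eigmult n] = f @^-1` setT by [].
by apply: finite_preimage; [move=> ? ? _ _; exact: finj|exact: finite_finset].
Qed.

Section SliceChart.
Context {R : realType} {n : nat} {M : smoothManifold R n}.
Variables (c : chart R n M) (ac : atlas c).
Variables (Theta Psi : 'rV[R]_n -> 'rV[R]_n) (U W : set 'rV[R]_n).
Hypotheses (UC : U `<=` c @` dom c) (LI : local_inverse Theta U Psi W)
  (CT : smooth_on U Theta).
Let oU : open U. Proof. by case: LI. Qed.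
Let oW : open W. Proof. by case: LI. Qed.
Let TK x : U x -> W (Theta x) /\ Psi (Theta x) = x.
Proof. by case: LI => _ _ H _ _; exact: H. Qed.
Let PK y : W y -> U (Psi y) /\ Theta (Psi y) = y.
Proof. by case: LI => _ _ _ H _; exact: H. Qed.
Let CP : smooth_on W Psi. Proof. by case: LI. Qed.

Let flat_dom := dom c `&` c @^-1` U.

Let flat_dom_open : open flat_dom.
Proof.
apply: (open_preimage_on (@dom_open _ _ _ c) oU) => p cp.
exact: (Defs.coord_continuous cp).
Qed.

Let flat_imageE : (Theta \o c) @` flat_dom = W.
Proof.
apply/seteqP; split=> [_ [p [cp Up] <-]|y Wy]; first by have [] := TK Up.
have [UP TP] := PK Wy; have [p cp pE] := UC UP.
by exists p; rewrite /= ?pE//; split => //=; rewrite pE.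
Qed.

Let flat_open : open ((Theta \o c) @` flat_dom).
Proof. by rewrite flat_imageE. Qed.

Let flatK p : flat_dom p -> (param c \o Psi) ((Theta \o c) p) = p.
Proof. by move=> [cp Up] /=; have [_ ->] := TK Up; exact: coordK. Qed.

Let flat_continuous p : flat_dom p -> {for p, continuous (Theta \o c)}.
Proof.
move=> [cp Up]; have c1 := Defs.coord_continuous cp; have c2 := CT 0 (c p) Up.
exact: continuous_comp c1 c2.
Qed.

Let flat_param_continuous p : flat_dom p ->
  {for (Theta \o c) p, continuous (param c \o Psi)}.
Proof.
move=> [cp Up]; have [WT PT] := TK Up; have c1 := CP 0 (Theta (c p)) WT.
have c2 := param_continuous cp.
apply: continuous_comp; first exact: c1.
by rewrite /= PT.
Qed.

Definition flat_chart : chart R n M :=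
  Chart flat_dom_open flat_open flatK flat_continuous flat_param_continuous.

(** Maximality reduces this to compatibility, and the transitions are those of [c] composed with
    [Theta] or [Psi]. *)
Lemma flat_chart_atlas : atlas flat_chart.
Proof.
apply: atlas_maximal => c' ac'; have [T1 T2] := atlas_compatible ac ac'.
have o1 := @chart_image_open _ _ _ flat_chart _ (@dom_open _ _ _ c').
have o2 := @chart_image_open _ _ _ c' _ (@dom_open _ _ _ flat_chart).
have o3 := @chart_image_open _ _ _ c _ (@dom_open _ _ _ c').
split=> k.
- have CP' : Ck_on k (flat_chart @` (dom flat_chart `&` dom c')) Psi.
    apply: Ck_on_sub (CP k) => _ [p [[cp Up] _] <-].
    by have [] := TK Up.
  apply: (Ck_on_comp o1 o3 _ CP' (T1 k)) => _ [p [[cp Up] c'p] <-].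
  by exists p => //=; have [_ ->] := TK Up.
- have T2' : Ck_on k (c' @` (dom c' `&` dom flat_chart)) (c \o param c').
    by apply: Ck_on_sub (T2 k) => _ [p [c'p [cp Up]] <-]; exists p.
  apply: (Ck_on_comp o2 oU _ T2' (CT k)) => _ [p [c'p [cp Up]] <-] /=.
  by rewrite coordK.
Qed.

End SliceChart.

(** * The stratification of the multiplicity locus *)

Section Strata.
Context {R : realType} {n : nat}.
Local Notation V := 'rV[R]_n.

(** The flat model annihilates the first [k] coordinates, whereas [submanifold] asks the last ones
    to vanish. *)
Definition rev_mx : 'M[R]_n := \matrix_(i, j) (i == rev_ord j)%:R.

Lemma mul_rev_mxE (v : V) j : (v *m rev_mx) 0 j = v 0 (rev_ord j).
Proof.
rewrite mxE (bigD1 (rev_ord j))//= mxE eqxx mulr1 big1 ?addr0// => i ij.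
by rewrite mxE (negbTE ij) mulr0.
Qed.

Lemma mul_rev_mxK (v : V) : v *m rev_mx *m rev_mx = v.
Proof. by apply/rowP => j; rewrite !mul_rev_mxE rev_ordK. Qed.

Lemma mul_pid_mxE (v : V) k (j : 'I_k) (i : 'I_n) : val i = val j ->
  (v *m (pid_mx k : 'M[R]_(n, k))) 0 j = v 0 i.
Proof.
move=> ij; rewrite mxE (bigD1 i)//= mxE ij eqxx ltn_ord mulr1 big1 ?addr0// => l li.
rewrite mxE (_ : (val l == val j) = false) ?mulr0//.
by rewrite -ij; apply: contraNF li => /eqP/val_inj ->.
Qed.

Lemma mul_pid_mx_eq0 (v : V) k : (k <= n)%N ->
  v *m (pid_mx k : 'M[R]_(n, k)) = 0 <->
  (forall i : 'I_n, (n - k <= i)%N -> (v *m rev_mx) 0 i = 0).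
Proof.
move=> kn; split=> [/rowP v0 i ik|H].
  rewrite mul_rev_mxE.
  have rk : (rev_ord i < k)%N by move: (ltn_ord i) ik => /=; lia.
  by have := v0 (Ordinal rk); rewrite (@mul_pid_mxE v k (Ordinal rk) (rev_ord i))// mxE.
apply/rowP => j; have jn : (j < n)%N by exact: leq_trans (ltn_ord j) kn.
rewrite (@mul_pid_mxE v k j (Ordinal jn))// mxE.
have := H (rev_ord (Ordinal jn)); rewrite mul_rev_mxE rev_ordK; apply => /=.
by move: (ltn_ord j); lia.
Qed.

Lemma local_inverse_rev (Theta Psi : V -> V) U W :
  local_inverse Theta U Psi W ->
  local_inverse (fun x => Theta x *m rev_mx) U (fun y => Psi (y *m rev_mx))
    [set y | W (y *m rev_mx)].
Proof.
move=> [oU oW TK PK CP].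
have rc : continuous (mulmxr rev_mx : {linear V -> V}) by exact: linear_mx_continuous.
have oW' : open [set y | W (y *m rev_mx)].
  by apply: (@open_comp _ _ (mulmxr rev_mx) W) => // y _; exact: rc.
split => //.
- by move=> x Ux; rewrite /= mul_rev_mxK; exact: TK.
- by move=> y Wy; have [UP TP] := PK _ Wy; rewrite TP mul_rev_mxK.
- move=> k; apply: (Ck_on_comp oW' oW _ _ (CP k)); first by [].
  exact: (@Ck_on_linear _ _ _ k _ (mulmxr rev_mx) rc).
Qed.

Context {M : smoothManifold R n} (g : riemannianMetric M) (h : sym2Tensor M).
Hypotheses (n_gt0 : (0 < n)%N) (ht : tangent_metrics g h) (hg : generic g h).

Lemma chart_image_point (c : chart R n M) (X : set M) p : dom c p ->
  chart_image c X (c p) <-> X p.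
Proof.
move=> cp; split=> [[q [cq Xq] qp]|Xp]; last by exists p.
by rewrite -(coordK cp) -qp coordK.
Qed.

Let model (c : chart R n M) p m : atlas c -> dom c p -> stratum g h m p ->
  flat_model g h c (c p) m.
Proof. by move=> ac cp pm; exact: flat_model_exists. Qed.

Lemma stratum_submanifold (m : eigmult n) :
  submanifold (n - codim (val m)) (stratum g h m).
Proof.
split=> [|p pm]; first exact: leq_subr.
have [c ac cp] := atlas_cover p.
have [k [Th [Psi [U [W [[kE kn] [Ux UC] LI CT [H _ _]]]]]]] := model ac cp pm.
have LI' := local_inverse_rev LI.
have CT' : smooth_on U (fun x => Th x *m rev_mx).
  move=> j; have oU : open U by case: LI.
  apply: Ck_on_mulmx => //; exact: Ck_on_cst.
exists (flat_chart UC LI' CT'); split; first exact: flat_chart_atlas.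
  by split.
rewrite -kE; apply/seteqP; split=> [_ [q [[cq Uq] Xq] <-]|_ [[q [cq Uq] <-] Hq]].
  split; first by exists q.
  by apply/(mul_pid_mx_eq0 _ kn)/(H _ Uq)/chart_image_point.
exists q => //; split; first by split.
by apply/(chart_image_point _ cq)/(H _ Uq)/(mul_pid_mx_eq0 _ kn).
Qed.

(** [X] is its closure intersected with the union of all such [Q]. *)
Lemma locally_closed_local (T : topologicalType) (X : set T) :
  (forall x, X x -> exists Q, [/\ open Q, Q x & Q `&` closure X `<=` X]) ->
  locally_closed X.
Proof.
move=> H.
pose Q := \bigcup_(Q in [set Q | open Q /\ Q `&` closure X `<=` X]) Q.
exists Q, (closure X); split.
- by apply: bigcup_open => Q' [].
- exact: closed_closure.
- apply/seteqP; split=> [x Xx|x [[Q' [_ QX] Qx] cx]]; last exact: QX.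
  split; last exact: subset_closure.
  by have [Q' [oQ Qx QX]] := H x Xx; exists Q'.
Qed.

Lemma stratum_locally_closed (m : eigmult n) : locally_closed (stratum g h m).
Proof.
apply: locally_closed_local => p pm.
have [c ac cp] := atlas_cover p.
have [k [Th [Psi [U [W [_ [Ux UC] LI CT [H _ _]]]]]]] := model ac cp pm.
have oU : open U by case: LI.
have cc q : dom c q -> {for q, continuous c} by move=> cq; exact: Defs.coord_continuous.
exists (dom c `&` c @^-1` U); split => //.
  by apply: (open_preimage_on (@dom_open _ _ _ c) oU) => q; exact: cc.
move=> q [[cq Uq] clq].
apply/(chart_image_point _ cq)/(H _ Uq).
pose f x := Th x *m (pid_mx k : 'M[R]_(n, k)).
(* Where the transverse coordinates are nonzero, a whole neighbourhood misses the stratum, against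
   [clq]. *)
apply/eqP/negPn/negP => fq.
have fC : {for c q, continuous f}.
  exact: (Ck_on_mulmx oU (CT 0) (Ck_on_cst 0 U (pid_mx k : 'M[R]_(n, k)))).
have n1 : \forall x \near q, f (c x) != 0.
  have fcC : {for q, continuous (f \o c)} by exact: continuous_comp (cc q cq) fC.
  have op : open [set x : 'rV[R]_k | x != 0].
    have -> : [set x : 'rV[R]_k | x != 0] = ~` [set 0].
      by apply/seteqP; split=> x /eqP.
    apply: closed_openC; apply: accessible_closed_set1.
    exact: hausdorff_accessible (@norm_hausdorff _ _).
  exact: (fcC _ (open_nbhs_nbhs (conj op fq))).
have n2 : \forall x \near q, dom c x /\ U (c x).
  have := open_preimage_on (@dom_open _ _ _ c) oU cc => oD.
  exact: (open_nbhs_nbhs (conj oD (conj cq Uq))).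
have [x [Xx [fx [cx Ucx]]]] := clq _ (filterI n1 n2).
by move/negP: fx; apply; apply/eqP/(H _ Ucx)/chart_image_point.
Qed.

(** The model is taken at the limit point, in the given chart: there the stratum of the limit is
    flat and all strata are conic. *)
Lemma strata_whitney_conditions (m m' : eigmult n) (c : chart R n M) : atlas c ->
  whitney_a (chart_image c (stratum g h m)) (chart_image c (stratum g h m')) /\
  whitney_b (chart_image c (stratum g h m)) (chart_image c (stratum g h m')).
Proof.
move=> ac; split.
- move=> x_ y T Xx [p [cp pm'] <-] xy sT v tv.
  have [k [Th [Psi [U [W [_ [Ux UC] LI CT [H Xc _]]]]]]] := model ac cp pm'.
  by apply: (flat_whitney_a LI CT (Xc m) _ Ux Xx xy sT tv) => x Uxx /(H x Uxx).
- move=> x_ y_ y l T Xx Yy [p [cp pm'] <-] xy yy sl sT u lu.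
  have [k [Th [Psi [U [W [_ [Ux UC] LI CT [H Xc _]]]]]]] := model ac cp pm'.
  by apply: (flat_whitney_b LI CT (Xc m) _ Ux Xx Yy xy yy sl sT lu) => x Uxx /(H x Uxx).
Qed.

Lemma stratum_codim_le (m : eigmult n) p : stratum g h m p ->
  (codim (val m) <= n)%N.
Proof.
move=> pm; have [c ac cp] := atlas_cover p.
by have [k [Th [Psi [U [W [[<-]]]]]]] := model ac cp pm.
Qed.

Lemma codim2_stratum_exists p : mult_locus g h p ->
  exists2 m : degenerate n, codim (val (val m)) = 2 & degenerate_stratum g h m !=set0.
Proof.
move=> /mult_locusE[m0 m0n pm]; have [c ac cp] := atlas_cover p.
have [k [Th [Psi [U [W [[_ kn] [Ux UC] LI CT [H Xc /(_ m0n)[xi Hxi]]]]]]]] := model ac cp pm.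
have [oU oW TK PK CP] := LI.
have [WT PT] := TK _ Ux.
(* The direction of the ray lifted to [n] coordinates, with zero components along the stratum. *)
pose w : V := xi *m (pid_mx k : 'M[R]_(k, n)).
pose aff (t : R) := t *: w + Th (c p).
have affC : continuous aff.
  move=> t; apply: differentiable_continuous; apply/derivable1_diffP.
  by have [] := is_derive_affine w (Th (c p)) t.
have : \forall t \near (0 : R), W (aff t).
  by apply: affC; rewrite /aff scale0r add0r; exact: open_nbhs_nbhs.
move=> /nbhs_ballP[e /= e0 eP].
(* A positive time at which the ray is still in the domain of [Psi]. *)
have /eP Wt : ball 0 e (e / 2).
  rewrite -ball_normE /= sub0r normrN gtr0_norm ?divr_gt0//.
  by rewrite ltr_pdivrMr// ltr_pMr// ltr1n.
have [UP TP] := PK _ Wt.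
have e2 : 0 < e / 2 by rewrite divr_gt0.
have [|m [[q [cq qm] _] m2 mn]] := Hxi _ (e / 2) UP e2.
  have f0 : Th (c p) *m (pid_mx k : 'M[R]_(n, k)) = 0.
    by apply/(H _ Ux)/chart_image_point.
  rewrite TP mulmxDl f0 addr0 -scalemxAl /w -mulmxA mul_pid_mx minnn (minn_idPr kn).
  by rewrite pid_mx_1 mulmx1.
by exists (Sub m mn) => //; exists q.
Qed.

(** At a point with distinct eigenvalues the model has [k = 0], so its equation holds on all of [U],
    which therefore lies in one nondegenerate stratum. *)
Lemma mult_locus_closed : closed (mult_locus g h).
Proof.
rewrite -[mult_locus g h]setCK; apply: open_closedC.
rewrite openE => p pl; have [m pm] := stratum_exists g h p.
have [c ac cp] := atlas_cover p.
have mn : ~~ (size (val m) < n)%N.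
  by apply/negP => mn; apply: pl; apply/mult_locusE; exists m.
have [k [Th [Psi [U [W [[kE _] [Ux UC] LI CT [H _ _]]]]]]] := model ac cp pm.
have oU : open U by case: LI.
have oD := open_preimage_on (@dom_open _ _ _ c) oU
  (fun q cq => Defs.coord_continuous cq).
apply: filterS (open_nbhs_nbhs (conj oD (conj cp Ux))) => q [cq Uq].
move=> /mult_locusE[m' m'n qm'].
have qm : stratum g h m q.
  apply/(chart_image_point _ cq)/(H _ Uq); apply/rowP => j.
  have k0 : k = 0%N by rewrite kE eigmult_nondegenerate.
  by have := leq_trans (ltn_ord j) (eq_leq k0); rewrite ltn0.
by move: mn; rewrite (stratum_inj qm qm') m'n.
Qed.

Lemma degenerate_strata_whitney :
  whitney_stratification (mult_locus g h) (degenerate_stratum g h)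
    (fun m : degenerate n => (n - codim (val (val m)))%N).
Proof.
split.
- apply/seteqP; split=> p.
    by move=> /mult_locusE[m mn pm]; exists (Sub m mn).
  by move=> [[m mn] _ pm]; apply/mult_locusE; exists m.
- by move=> m m' _ _ [p [pm pm']]; apply: val_inj; exact: stratum_inj pm pm'.
- move=> p; exists setT; first exact: filterT.
  have -> : [set i | degenerate_stratum g h i `&` setT !=set0] =
     (val : degenerate n -> eigmult n) @^-1` [set m | stratum g h m `&` setT !=set0] by [].
  apply: finite_preimage; first by move=> ? ? _ _; exact: val_inj.
  exact: sub_finite_set (@subsetT _ _) (eigmult_finite n).
- by move=> m; exact: stratum_locally_closed.
- by move=> m; exact: stratum_submanifold.
- by move=> m m' _ _ c ac; exact: strata_whitney_conditions.
Qed.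

Lemma degenerate_strata_codim : mult_locus g h !=set0 ->
  strata_codim n (degenerate_stratum g h)
    (fun m : degenerate n => (n - codim (val (val m)))%N) 2.
Proof.
(* Subtraction of naturals truncates; the local model at a point of a nonempty stratum bounds its
   codimension by [n]. *)
have nd (m : degenerate n) : degenerate_stratum g h m !=set0 ->
    (n - (n - codim (val (val m))))%N = codim (val (val m)).
  by move=> [p pm]; rewrite subKn//; exact: stratum_codim_le pm.
move=> [p /codim2_stratum_exists[m m2 mX]]; split.
  by exists m => //; rewrite nd.
move=> m' m'X; rewrite nd//.
case: m' {m'X} => -[m' m'P] /= m'n; have /andP[m'0 /eqP sm'] := m'P.
by apply: codim_degenerate => //; rewrite sm'.
Qed.

End Strata.

Theorem theorem3 (R : realType) (n : nat) (hn : (2 <= n)%N)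
    (M : smoothManifold R n) (hM : compact [set: M])
    (g0 : riemannianMetric M)
    (h : sym2Tensor M) (hh : tangent_metrics g0 h) (hgen : generic g0 h) :
  mult_locus g0 h = set0 \/
  (compact (mult_locus g0 h) /\
   exists d : degenerate n -> nat,
     whitney_stratification (mult_locus g0 h) (degenerate_stratum g0 h) d /\
     strata_codim n (degenerate_stratum g0 h) d 2).
Proof.
have n0 : (0 < n)%N by exact: leq_trans hn.
have [/eqP ->|/set0P S0] := boolP (mult_locus g0 h == set0); first by left.
right; split.
  by apply: subclosed_compact hM _ => //; exact: mult_locus_closed.
exists (fun m : degenerate n => (n - codim (val (val m)))%N); split.
  exact: degenerate_strata_whitney.
exact: degenerate_strata_codim.
Qed.
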